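(* Let $p\ge 3$ be a prime number, $N\in\mathbb N$, and let $T$ be an $N$-valid tree on $V=\{0,1,\dots,p-1\}$ of height $H$. Let $\varphi$ be a function generated by $T$. Then $\varphi$ generates an orthogonal MRA of $L_2(\mathfrak G)$, where $\mathfrak G$ is the $p$-adic Vilenkin group.
   Context: **Group.** $\mathfrak G$ (the $p$-adic Vilenkin group, operation $\dot+$, subtraction $\dot-$) is the group of sequences $x=(x_n)_{n\in\mathbb Z}$, $x_n\in\{0,\dots,p-1\}$, with only finitely many nonzero terms of negative index, added coordinatewise modulo $p$. Put $\mathfrak G_n=\{x: x_k=0 \text{ for } k<n\}$; these subgroups form a base of neighbourhoods of $0$. $g_n$ is the sequence with $1$ at place $n$ and $0$ elsewhere, so $x=\sum_n x_ng_n$ and $pg_n=0$. $\mu$ is the Haar measure with $\mu(\mathfrak G_n)=p^{-n}$. The dilation operator is $\mathcal A\bigl(\sum_n a_ng_n\bigr)=\sum_n a_ng_{n-1}$. $H_0=\{a_{-1}g_{-1}\dot+\dots\dot+a_{-s}g_{-s}: s\in\mathbb N,\ a_j\in\{0,\dots,p-1\}\}$. **Characters.** $X$ is the multiplicative group of continuous characters of $\mathfrak G$; $(\chi,x)$ is the value of $\chi$ at $x$; $\mathfrak G_n^\bot=\{\chi\in X:(\chi,x)=1\ \forall x\in\mathfrak G_n\}$; $\nu$ is the Haar measure on $X$ with $\nu(\mathfrak G_n^\bot)=p^n$. The Fourier transform on $L_2(\mathfrak G)$ is $\hat f(\chi)=\int_{\mathfrak G}f(x)\overline{(\chi,x)}\,d\mu(x)$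 (in the $L_2$ sense), with inverse $f(x)=\int_X\hat f(\chi)(\chi,x)\,d\nu(\chi)$. The Rademacher characters are $(r_n,\sum_k a_kg_k)=\exp(2\pi i a_n/p)$, so $r_n\in\mathfrak G_{n+1}^\bot\setminus\mathfrak G_n^\bot$. $\chi\mathcal A$ is defined by $(\chi\mathcal A,x)=(\chi,\mathcal Ax)$ (so $r_n\mathcal A=r_{n+1}$). **$N$-valid tree.** A rooted tree with vertices labelled by elements of $V=\{0,\dots,p-1\}$ (a label may occur at several vertices), edges directed away from the root, such that (1) the root and all vertices of levels $1,\dots,N-1$ have label $0$ (so the tree starts with a single chain of $N$ zeros; the root has level $0$); (2) for every $(\alpha_1,\dots,\alpha_N)\in V^N$ there is exactly one directed path of $N$ vertices in the tree whose successive labels are $\alpha_1\to\alpha_2\to\dots\to\alpha_N$. The height is the number of vertices in a longest directed path starting at the root. **Function generated by a tree.** For every directed path $(\alpha_s\to\alpha_{s-1}\to\dots\to\alpha_{-N})$ in $T$ with $\alpha_s=\alpha_{s-1}=\dots=\alpha_{s-N+1}=0$, take the cosets $$\mathfrak G_{-N}^\bot r_{-N}^{\alpha_{-N}}r_{-N+1}^{\alpha_{-N+1}}\cdots r_0^{\alpha_0},\ \ \mathfrak G_{-N}^\bot r_{-N}^{\alpha_{-N+1}}r_{-N+1}^{\alpha_{-N+2}}\cdots r_0^{\alpha_1},\ \dots,\ \mathfrak G_{-N}^\bot r_{-N}^{\alpha_{s-N}}\cdots r_0^{\alpha_s},$$ $$\mathfrak G_{-N}^\bot r_{-N}^{\alpha_{s-N+1}}\cdots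 r_{-1}^{\alpha_s},\ \ \mathfrak G_{-N}^\bot r_{-N}^{\alpha_{s-N+2}}\cdots r_{-2}^{\alpha_s},\ \dots,\ \mathfrak G_{-N}^\bot r_{-N}^{\alpha_s}$$ (the cosets of the second line all equal $\mathfrak G_{-N}^\bot$). Let $\tilde E\subset\mathfrak G_1^\bot$ be the union of all these cosets. A mask $m_0$ generated by $T$ is defined on $\mathfrak G_1^\bot$ by: $m_0(\mathfrak G_{-N}^\bot)=1$; $m_0$ is constant on each coset $\mathfrak G_{-N}^\bot r_{-N}^{\alpha_{-N}}\cdots r_{-1}^{\alpha_{-1}}r_0^{\alpha_0}$ with value $\lambda_{\alpha_{-N},\dots,\alpha_{-1},\alpha_0}$, where $|\lambda_{\alpha_{-N},\dots,\alpha_0}|=1$ (otherwise arbitrary complex) if the coset is contained in $\tilde E$, and $\lambda_{\alpha_{-N},\dots,\alpha_0}=0$ if it is contained in $\mathfrak G_1^\bot\setminus\tilde E$. It is extended to $X$ periodically: $m_0(\chi r_1^{\alpha_1}\cdots r_s^{\alpha_s})=m_0(\chi)$ for all $s\in\mathbb N$, $\alpha_j\in\{0,\dots,p-1\}$. The function $\varphi$ with $\hat\varphi(\chi)=\prod_{n=0}^\infty m_0(\chi\mathcal A^{-n})$ is said to be generated by $T$. **MRA.** Closed subspaces $V_n\subset L_2(\mathfrak G)$, $n\in\mathbb Z$, form a multiresolution analysis (MRA) if: (A1) $V_n\subset V_{n+1}$; (A2) $\overline{\bigcup_n V_n}=L_2(\mathfrak G)$ and $\bigcap_nV_n=\{0\}$;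 (A3) $f(x)\in V_n\Leftrightarrow f(\mathcal Ax)\in V_{n+1}$; (A4) $f(x)\in V_0\Rightarrow f(x\dot-h)\in V_0$ for all $h\in H_0$; (A5) there is $\varphi\in L_2(\mathfrak G)$ such that $(\varphi(x\dot-h))_{h\in H_0}$ is an orthonormal basis of $V_0$. A function $\varphi$ generates an orthogonal MRA if $(\varphi(x\dot-h))_{h\in H_0}$ is an orthonormal system and the closed linear spans $V_n$ of $(\varphi(\mathcal A^nx\dot-h))_{h\in H_0}$, $n\in\mathbb Z$, form an MRA (with $\varphi$ as the function in (A5)). *)

(* Defs.v *)
From HB Require Import structures.
From mathcomp Require Import all_boot all_order all_algebra.
From mathcomp Require Import all_classical all_reals all_analysis.
From mathcomp Require Import complex.

Set Implicit Arguments.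
Unset Strict Implicit.
Unset Printing Implicit Defensive.

Import Order.TTheory GRing.Theory Num.Theory.
Import numFieldNormedType.Exports.
Import ComplexField.Normc.

Local Open Scope classical_set_scope.
Local Open Scope ring_scope.
Local Open Scope complex_scope.

HB.instance Definition _ (R : realType) := NormedModule.copy R[i] R[i]^o.

Definition fin_neg_supp (p : nat) : {pred (int -> 'Z_p)} :=
  fun x => `[< finite_set [set k : int | k < 0 /\ x k != 0] >].

Lemma fin_neg_supp_zmod_closed p : zmod_closed (@fin_neg_supp p).
Proof.
split=> [|x y /asboolP fx /asboolP fy]; apply/asboolP.
  rewrite (_ : [set _ | _] = set0) -?subset0; first exact: finite_set0.
  by move=> k [_ /negP]; apply; exact/eqP.
apply: (@sub_finite_set _ _ ([set k : int | k < 0 /\ x k != 0] `|`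
                             [set k : int | k < 0 /\ y k != 0])).
  move=> k [k0 /= nz]; have [xk0|xk] := eqVneq (x k) 0; last by left.
  right; split=> //; apply: contra_neq nz => yk0.
  by rewrite -[LHS]/(x k - y k) xk0 yk0 subr0.
by rewrite finite_setU.
Qed.

HB.instance Definition _ p :=
  GRing.isZmodClosed.Build (int -> 'Z_p) (@fin_neg_supp p)
    (fin_neg_supp_zmod_closed p).

(* For 1 < p the digit ring 'Z_p is {0, ..., p-1} with addition modulo p. *)
Definition vilenkin (p : nat) := {x : int -> 'Z_p | x \in @fin_neg_supp p}.

HB.instance Definition _ p := Choice.on (vilenkin p).
HB.instance Definition _ p := SubType.on (vilenkin p).
HB.instance Definition _ p :=
  [SubChoice_isSubZmodule of vilenkin p by <:].
HB.instance Definition _ p := isPointed.Build (vilenkin p) 0.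

Section vilenkin_group.
Context {p : nat}.
Implicit Types (x y : vilenkin p) (n : int).

Definition digit x n : 'Z_p := val x n.

Definition Gsub n : set (vilenkin p) :=
  [set x | forall k : int, k < n -> digit x k = 0].

Lemma Gsub0 n : Gsub n 0.
Proof. by []. Qed.

Lemma GsubD n x y : Gsub n x -> Gsub n y -> Gsub n (x + y).
Proof.
move=> Gx Gy k kn.
by rewrite -[LHS]/(digit x k + digit y k) Gx// Gy// addr0.
Qed.

Lemma Gsub_le m n : m <= n -> Gsub n `<=` Gsub m.
Proof. by move=> mn x Gx k km; apply: Gx; exact: lt_le_trans mn. Qed.

Definition Gnbhs x : set_system (vilenkin p) :=
  filter_from setT (fun n : int => [set y | Gsub n (y - x)]).

HB.instance Definition _ := hasNbhs.Build (vilenkin p) Gnbhs.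

Global Instance Gnbhs_filter x : ProperFilter (Gnbhs x).
Proof.
apply: filter_from_proper; last by move=> n _; exists x; rewrite /= subrr.
apply: filter_from_filter; first by exists 0.
move=> m n _ _; exists (Order.max m n) => // y Gy; split;
  by apply: Gsub_le Gy; rewrite le_max lexx ?orbT.
Qed.

Fact Gnbhs_singleton x (A : set (vilenkin p)) : Gnbhs x A -> A x.
Proof. by case=> n _; apply; rewrite /= subrr. Qed.

Fact Gnbhs_nbhs x (A : set (vilenkin p)) : Gnbhs x A -> Gnbhs x (Gnbhs^~ A).
Proof.
case=> n _ xA; exists n => // y Gy; exists n => // z Gz; apply: xA.
by rewrite /= -(subrK y z) -addrA; exact: GsubD.
Qed.

HB.instance Definition _ := Nbhs_isNbhsTopological.Build (vilenkin p)
  Gnbhs_filter Gnbhs_singleton Gnbhs_nbhs.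

Definition gvec_fun n : int -> 'Z_p := fun k => if k == n then 1 else 0.

Fact gvec_subproof n : gvec_fun n \in @fin_neg_supp p.
Proof.
apply/asboolP; apply: sub_finite_set (finite_set1 n) => k [_] /=.
by rewrite /gvec_fun; case: (eqVneq k n).
Qed.

Definition gvec n : vilenkin p := Sub (gvec_fun n) (gvec_subproof n).

Definition dil_fun n x : int -> 'Z_p := fun k => digit x (k + n).

Fact dil_subproof n x : dil_fun n x \in @fin_neg_supp p.
Proof.
apply/asboolP; have /asboolP fx := valP x.
apply: (@sub_finite_set _ _ ((fun k : int => k - n) @`
    ([set k : int | k < 0 /\ val x k != 0] `|` [set` `[0, `|n|]]))).
  move=> k [k0 xk]; exists (k + n); last by rewrite addrK.
  have [kn|kn] := ltP (k + n) 0; [by left|right].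
  rewrite /= in_itv/= kn/=; apply: le_trans (ler_norm n).
  by rewrite gerDr ltW.
apply: finite_image; rewrite finite_setU; split=> //.
apply: (@sub_finite_set _ _ (Posz @` `I_(`|n|.+1))).
  move=> [k|k]; rewrite /= in_itv//= => kn; exists k => //.
exact/finite_image/finite_II.
Qed.

(* [dil n] is the n-th power, n of any sign, of the dilation operator
   A (\sum_k a_k g_k) = \sum_k a_k g_(k-1). *)
Definition dil (n : int) x : vilenkin p := Sub (dil_fun n x) (dil_subproof n x).

Lemma dilD n x y : dil n (x + y) = dil n x + dil n y.
Proof. exact: val_inj. Qed.

Definition H_0 : set (vilenkin p) :=
  [set h | exists s (a : 'I_s -> 'Z_p),
     h = \sum_(j < s) gvec (- (j.+1%:Z)) *+ (a j : nat)].

End vilenkin_group.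

Record vilenkin_dual (R : realType) (p : nat) := Dual {
  dual_fun :> vilenkin p -> R[i];
  dual_continuous : continuous dual_fun;
  dualD : forall x y, dual_fun (x + y) = dual_fun x * dual_fun y;
  dual_norm : forall x, `|dual_fun x| = 1 }.

HB.instance Definition _ R p := gen_eqMixin (vilenkin_dual R p).
HB.instance Definition _ R p := gen_choiceMixin (vilenkin_dual R p).

Section dual_group.
Context {R : realType} {p : nat}.
Implicit Types chi psi : vilenkin_dual R p.

Lemma dual_ext chi psi : chi =1 psi -> chi = psi.
Proof.
case: chi psi => [f fc fD fN] [g gc gD gN] /= /funext fg; subst g.
by congr Dual; exact: Prop_irrelevance.
Qed.

Fact dual1_continuous : continuous (fun _ : vilenkin p => 1 : R[i]).
Proof. exact: cst_continuous. Qed.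

Definition dual1 : vilenkin_dual R p.
Proof.
apply: (@Dual R p (fun=> 1) dual1_continuous) => [x y|x].
- by rewrite mulr1.
- by rewrite normr1.
Defined.

Fact dual_mul_continuous chi psi : continuous (fun x => chi x * psi x).
Proof. by move=> x; apply: cvgM; exact: dual_continuous. Qed.

Definition dual_mul chi psi : vilenkin_dual R p.
Proof.
apply: (@Dual R p (fun x => chi x * psi x)
  (@dual_mul_continuous chi psi)) => [x y|x].
- by rewrite !dualD mulrACA.
- by rewrite normrM !dual_norm mulr1.
Defined.

Fact dual_neq0 chi x : chi x != 0.
Proof. by rewrite -normr_eq0 dual_norm oner_eq0. Qed.

Fact dual_inv_continuous chi : continuous (fun x => (chi x)^-1).
Proof.
by move=> x; apply: cvgV; [exact: dual_neq0|exact: dual_continuous].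
Qed.

Definition dual_inv chi : vilenkin_dual R p.
Proof.
apply: (@Dual R p (fun x => (chi x)^-1)
  (@dual_inv_continuous chi)) => [x y|x].
- by rewrite dualD invfM.
- by rewrite normfV dual_norm invr1.
Defined.

Fact dual_mulA : associative dual_mul.
Proof. by move=> ? ? ?; apply: dual_ext => x; exact: mulrA. Qed.
Fact dual_mul1g : left_id dual1 dual_mul.
Proof. by move=> ?; apply: dual_ext => x; exact: mul1r. Qed.
Fact dual_mulg1 : right_id dual1 dual_mul.
Proof. by move=> ?; apply: dual_ext => x; exact: mulr1. Qed.
Fact dual_mulVg : left_inverse dual1 dual_inv dual_mul.
Proof.
by move=> c; apply: dual_ext => x; exact: (mulVf (dual_neq0 c x)).
Qed.
Fact dual_mulgV : right_inverse dual1 dual_inv dual_mul.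
Proof.
by move=> c; apply: dual_ext => x; exact: (mulfV (dual_neq0 c x)).
Qed.

HB.instance Definition _ := isGroup.Build (vilenkin_dual R p)
  dual_mulA dual_mul1g dual_mulg1 dual_mulVg dual_mulgV.
HB.instance Definition _ := isPointed.Build (vilenkin_dual R p) dual1.

(* The topology of the Pontryagin dual. *)
HB.instance Definition _ := Topological.copy (vilenkin_dual R p)
  (@initial_topology (vilenkin_dual R p) {compact-open, vilenkin p -> R[i]}
     (@dual_fun R p)).

Definition annihilator (n : int) : set (vilenkin_dual R p) :=
  [set chi | forall x, Gsub n x -> chi x = 1].

Fact dual_dil_continuous chi (n : int) : continuous (fun x => chi (dil n x)).
Proof.
move=> x; apply: (@continuous_comp _ _ _ (dil n) chi).
  move=> A [m _ mA]; exists (m + n) => // y Gy; apply: mA => k km.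
  by apply: (Gy (k + n)); rewrite ltrD2r.
exact: dual_continuous.
Qed.

Definition dual_dil (n : int) chi : vilenkin_dual R p.
Proof.
apply: (@Dual R p (fun x => chi (dil n x))
  (@dual_dil_continuous chi n)) => [x y|x].
- by rewrite dilD dualD.
- by rewrite dual_norm.
Defined.

Definition cis (t : R) : R[i] := cos t +i* sin t.

Lemma cisD s t : cis (s + t) = cis s * cis t.
Proof.
by rewrite /cis cosD sinD; congr Complex; exact: addrC.
Qed.

Lemma cis_nat2pi n t : cis (t + pi *+ 2 *+ n) = cis t.
Proof.
by rewrite /cis (periodicn (@sinD2pi R)) (periodicn (@cosD2pi R)).
Qed.

Lemma norm_cis t : `|cis t| = 1.
Proof. by rewrite normc_def /= cos2Dsin2 sqrtr1. Qed.

Definition rademacher_fun (n : int) (x : vilenkin p) : R[i] :=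
  cis (pi *+ 2 * (digit x n : nat)%:R / p%:R).

Fact rademacher_fun_continuous n : continuous (rademacher_fun n).
Proof.
move=> x A /nbhs_singleton Ax; exists (n + 1) => // y Gy.
rewrite /= /rademacher_fun (_ : digit y n = digit x n)//.
by apply/eqP; rewrite -subr_eq0; apply/eqP/(Gy n); rewrite ltrDl.
Qed.

Context (p_prime : prime p).

Fact rademacher_funD n x y :
  rademacher_fun n (x + y) = rademacher_fun n x * rademacher_fun n y.
Proof.
have p0 : (p%:R : R) != 0 by rewrite pnatr_eq0 -lt0n prime_gt0.
rewrite /rademacher_fun -cisD -mulrDl -mulrDr -natrD.
rewrite (_ : digit (x + y) n = digit x n + digit y n)// [nat_of_ord (_ + _)]/=.
move: (nat_of_ord (digit x n) + nat_of_ord (digit y n))%N => m.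
rewrite Zp_cast ?prime_gt1//.
have -> : pi *+ 2 * m%:R / p%:R =
    pi *+ 2 * (m %% p)%:R / p%:R + pi *+ 2 *+ (m %/ p) :> R.
  rewrite {1}(divn_eq m p) natrD natrM mulrDr mulrDl addrC; congr (_ + _).
  by rewrite mulrA mulfK// mulr_natr.
by rewrite cis_nat2pi.
Qed.

(* Primality of p is used only through 1 < p: it makes 'Z_p the digits mod p. *)
Definition rademacher (n : int) : vilenkin_dual R p :=
  Dual (@rademacher_fun_continuous n) (rademacher_funD n)
    (fun x => norm_cis _).

End dual_group.

Definition lspan (T : Type) (R : realType) (S : set (T -> R[i])) :
    set (T -> R[i]) :=
  [set f | exists n (c : 'I_n -> R[i]) (g : 'I_n -> T -> R[i]),
     (forall i, S (g i)) /\ f = fun x => \sum_(i < n) c i * g i x].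

Section L2.
Context d (T : measurableType d) (R : realType)
        (mu : {measure set T -> \bar R}).
Implicit Types (f g : T -> R[i]) (D : set T) (S V : set (T -> R[i])).

Definition cintegral D f : R[i] :=
  (\int[mu]_(x in D) complex.Re (f x)) +i* (\int[mu]_(x in D) complex.Im (f x)).

Definition L2norm f : \bar R := ('N[mu]_2%:E[EFin \o (@normc R \o f)])%E.

(* Subsets of L2 are sets of square-integrable representatives; those closed
   under L2 limits are saturated for almost-everywhere equality. *)
Definition L2 : set (T -> R[i]) :=
  [set f | [/\ measurable_fun setT (fun x => complex.Re (f x)),
               measurable_fun setT (fun x => complex.Im (f x))
             & (L2norm f < +oo)%E]].

Definition L2dot f g : R[i] := cintegral setT (fun x => f x * (g x)^*).

Definition L2closure S : set (T -> R[i]) :=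
  [set f | L2 f /\
     forall e : R, 0 < e -> exists2 g, S g & (L2norm (f \- g)%R < e%:E)%E].

Definition closed_subspace V : Prop :=
  [/\ V `<=` L2, lspan V `<=` V & L2closure V `<=` V].

Definition orthonormal_system (I : choiceType) (J : set I)
    (e : I -> T -> R[i]) :=
  (forall i, J i -> L2 (e i)) /\
  (forall i j, J i -> J j -> L2dot (e i) (e j) = (i == j)%:R).

Definition orthonormal_basis (I : choiceType) (J : set I)
    (e : I -> T -> R[i]) V :=
  orthonormal_system J e /\ L2closure (lspan (e @` J)) = V.

End L2.

Notation borel T := (g_sigma_algebraType (@open T)).

Definition haar_vilenkin (R : realType) (p : nat)
    (mu : {measure set (borel (vilenkin p)) -> \bar R}) : Prop :=
  (forall (x : vilenkin p) (B : set (borel (vilenkin p))), measurable B ->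
     mu [set x + y | y in (B : set (vilenkin p))] = mu B) /\
  (forall n : int, mu (Gsub n) = (p%:R ^ (- n))%:E).

Definition haar_dual (R : realType) (p : nat)
    (nu : {measure set (borel (vilenkin_dual R p)) -> \bar R}) : Prop :=
  (forall (chi : vilenkin_dual R p) (B : set (borel (vilenkin_dual R p))),
     measurable B ->
     nu [set (chi * psi)%g | psi in (B : set (vilenkin_dual R p))] = nu B) /\
  (forall n : int, nu (annihilator n) = (p%:R ^ n)%:E).

Section wavelets.
Context {R : realType} {p : nat}.
Context (mu : {measure set (borel (vilenkin p)) -> \bar R})
        (nu : {measure set (borel (vilenkin_dual R p)) -> \bar R}).
Implicit Types (f phi : vilenkin p -> R[i]) (F Phi : vilenkin_dual R p -> R[i]).

(* F is the L2 Fourier transform of f, i.e. the limit in L2 of the transforms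
   of the integrable truncations of f to the compact subgroups Gsub (- n). *)
Definition is_fourier f F : Prop :=
  [/\ L2 mu f, L2 nu F
    & (fun n : nat => L2norm nu (fun chi =>
         F chi - cintegral mu (Gsub (- n%:Z)) (fun x => f x * (chi x)^*)))
      @ \oo --> (0 : \bar R)].

Definition dil_shift phi (n : int) (h : vilenkin p) : vilenkin p -> R[i] :=
  fun x => phi (dil n x - h).

Definition is_MRA (V : int -> set (vilenkin p -> R[i])) : Prop :=
  [/\ (forall n, closed_subspace mu (V n)),
      (forall n, V n `<=` V (n + 1)),
      L2closure mu (\bigcup_n V n) = L2 mu
        /\ (forall f, (forall n, V n f) -> {ae mu, forall x, f x = 0}),
      (forall n f, V n f <-> V (n + 1) (fun x => f (dil 1 x)))
        /\ (forall f h, V 0 f -> H_0 h -> V 0 (fun x => f (x - h)))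
    & exists phi, L2 mu phi /\
        orthonormal_basis mu H_0 (fun h x => phi (x - h)) (V 0)].

Definition generates_orthogonal_MRA phi : Prop :=
  let V n := L2closure mu (lspan (dil_shift phi n @` H_0)) in
  [/\ L2 mu phi,
      orthonormal_system mu H_0 (fun h x => phi (x - h)),
      is_MRA V
    & orthonormal_basis mu H_0 (fun h x => phi (x - h)) (V 0)].

End wavelets.

(* A finite digraph is a tree with edges directed away from [tree_root] iff
   there is exactly one directed walk from [tree_root] to each vertex. *)
Record tree (p : nat) := Tree {
  vertex : finType;
  tree_root : vertex;
  tree_edge : rel vertex;
  tree_label : vertex -> 'Z_p;
  treeP : forall v, exists! q,
    path tree_edge tree_root q /\ last tree_root q = v }.

Section trees.
Context {R : realType} {p : nat} (p_prime : prime p) (T : tree p).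
Implicit Types (N : nat) (q : seq (vertex T)) (chi : vilenkin_dual R p).

(* If [path tree_edge tree_root q] then [last tree_root q] has level [size q];
   a nonempty sequence of vertices is a directed path iff it is
   [sorted tree_edge]. *)
Definition N_valid N : Prop :=
  (forall q, path (@tree_edge p T) (tree_root T) q -> (size q < N)%N ->
     tree_label (last (tree_root T) q) = 0) /\
  (forall a : N.-tuple 'Z_p, exists! q,
     sorted (@tree_edge p T) q /\ map (@tree_label p T) q = a).

Definition is_height (H : nat) : Prop :=
  (exists2 q, path (@tree_edge p T) (tree_root T) q & (size q).+1 = H) /\
  (forall q, path (@tree_edge p T) (tree_root T) q -> ((size q).+1 <= H)%N).

(* The coset of annihilator (- N) with representative
   r_(-N)^(a 0) r_(-N+1)^(a 1) ... r_0^(a N). *)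
Definition annih_coset N (a : {ffun 'I_N.+1 -> 'Z_p}) :
    set (vilenkin_dual R p) :=
  [set (psi * \prod_(j < N.+1)
     rademacher p_prime (j%:Z - N%:Z)%R ^+ (a j : nat))%g
  | psi in annihilator (- N%:Z)].

(* With w = (alpha_(-N), ..., alpha_s), k = 0, ..., s give the cosets read off
   the full windows of the path, and k = s+1, ..., s+N those of its truncated
   windows, in which [nth 0] supplies the missing zero exponents. *)
Definition Etilde N : set (vilenkin_dual R p) :=
  [set chi | exists q,
     let l := map (@tree_label p T) q in
     [/\ sorted (@tree_edge p T) q, (N < size q)%N, take N l = nseq N 0
       & exists2 k, (k < size q)%N
           & annih_coset [ffun j : 'I_N.+1 => nth 0 (rev l) (k + j)] chi]].

Definition is_mask N (m0 : vilenkin_dual R p -> R[i]) : Prop :=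
  [/\ (forall chi, annihilator (- N%:Z) chi -> m0 chi = 1),
      (exists lambda : {ffun 'I_N.+1 -> 'Z_p} -> R[i], forall a,
         [/\ forall chi, annih_coset a chi -> m0 chi = lambda a,
             annih_coset a `<=` Etilde N -> `|lambda a| = 1
           & annih_coset a `<=` annihilator 1 `\` Etilde N -> lambda a = 0])
    & forall chi s (a : 'I_s -> 'Z_p),
        m0 (chi * \prod_(j < s)
              rademacher p_prime (j.+1%:Z)%R ^+ (a j : nat))%g = m0 chi].

Definition generated_by_tree N
    (mu : {measure set (borel (vilenkin p)) -> \bar R})
    (nu : {measure set (borel (vilenkin_dual R p)) -> \bar R})
    (phi : vilenkin p -> R[i]) : Prop :=
  exists (m0 Phi : vilenkin_dual R p -> R[i]),
    [/\ is_mask N m0,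
        forall chi,
          (fun k : nat => \prod_(0 <= n < k) m0 (dual_dil (- n%:Z) chi))
            @ \oo --> Phi chi
      & is_fourier mu nu phi Phi].

End trees.

(* Main.v *)
(** Along each coset of the annihilator of G_(-N) the product of masks runs over
    the windows of N+1 consecutive exponents of the character.  N-validity makes
    every word t in V^N the start of exactly one sequence [A t] all of whose
    windows are read off the tree: the labels met when climbing from the path
    labelled by the reversal of t up to the root, continued by zeros.  Hence the
    transform of [phi] is unimodular, equal to [c t], on the coset of the
    character [chi_t] with exponents [A t] and vanishes off these p^N cosets, so
    phi = p^(-N) \sum_t c_t 1_(G_(-N)) chi_t almost everywhere.
    As [A t] starts with t, the matrix (chi_t(d)), d in H_0 and in G_(-N), is the
    character table of V^N.  Its orthogonality gives the orthonormality of the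
    shifts of [phi], and inverting it shows that V_n is also spanned by the dilated
    shifts of the atoms u_t = 1_(G_(-N)) chi_t.  Now V_n is inside V_(n+1)
    because the shift of [A t] is some [A t']; density holds because u_0 is the
    indicator of G_(-N); and the intersection is trivial because V_(-n) consists
    of limits of functions constant on ever larger balls. *)

Require Import Defs.
From HB Require Import structures.
From mathcomp Require Import all_boot all_order all_algebra.
From mathcomp Require Import all_classical all_reals all_analysis.
From mathcomp Require Import measurable_realfun complex.
From mathcomp Require Import zify ring lra.

Set Implicit Arguments.
Unset Strict Implicit.
Unset Printing Implicit Defensive.

Import Order.TTheory GRing.Theory Num.Theory.
Import numFieldNormedType.Exports.
Import ComplexField.Normc.

Local Open Scope classical_set_scope.
Local Open Scope ring_scope.
Local Open Scope complex_scope.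
(* Reopened so that [^*] means [Num.conj]. *)
Local Open Scope ring_scope.

(** * Digits and balls *)

(** What is known of [phi] is an $L_2$ limit of truncated transforms, so it has to be recovered from
    [Phi] before anything else. The error between [Phi] and the truncation to $G_{-n}$ is constant
    on the relevant cosets of the annihilator of $G_{-n}$. A Bessel bound over finitely many cosets
    turns its small norm into small values at the characters of the finite group $G_{-n}/G_m$.
    Inversion on that finite group then shows that [phi] and the explicit candidate have the same
    integral over every ball.

    The continuation [A t] is unique because of two facts that act together: [N] consecutive labels
    identify their vertices, and a vertex has a single parent, so [N] consecutive exponents force
    the next one. Past the root only zeros can follow, since the only path spelling [N] zeros starts
    at the root, which has no parent. *)

Section vilenkin_digits.
Context {p : nat}.
Implicit Types (x y h : vilenkin p) (n k : int).

Lemma vilenkin_ext x y : digit x =1 digit y -> x = y.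
Proof. by move=> xy; apply/val_inj/funext. Qed.

Lemma digitD x y k : digit (x + y) k = digit x k + digit y k.
Proof. by []. Qed.

Lemma digitN x k : digit (- x) k = - digit x k.
Proof. by []. Qed.

Lemma digitB x y k : digit (x - y) k = digit x k - digit y k.
Proof. by []. Qed.

Lemma digit0 k : digit (0 : vilenkin p) k = 0.
Proof. by []. Qed.

Lemma digitMn x m k : digit (x *+ m) k = digit x k *+ m.
Proof. by elim: m => // m IH; rewrite !mulrS digitD IH. Qed.

Lemma digit_sum (I : Type) (r : seq I) (P : pred I) (F : I -> vilenkin p) k :
  digit (\sum_(i <- r | P i) F i) k = \sum_(i <- r | P i) digit (F i) k.
Proof. exact: (big_morph (fun x => digit x k) (fun x y => digitD x y k) (digit0 k)). Qed.

Lemma digit_gvec n k : digit (gvec n : vilenkin p) k = (k == n)%:R.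
Proof. by rewrite /digit/= /gvec_fun; case: eqP. Qed.

Lemma digit_dil n x k : digit (dil n x) k = digit x (k + n).
Proof. by []. Qed.

Lemma natr_Zp_val (a : 'Z_p) : (a : nat)%:R = a.
Proof. by rewrite Zp_nat valZpK. Qed.

Lemma dil0 x : dil 0 x = x.
Proof. by apply: vilenkin_ext => k; rewrite digit_dil addr0. Qed.

Lemma dil_dil m n x : dil m (dil n x) = dil (m + n) x.
Proof. by apply: vilenkin_ext => k; rewrite !digit_dil addrA. Qed.

Lemma dilNK n : cancel (@dil p (- n)) (dil n).
Proof. by move=> x; rewrite dil_dil subrr dil0. Qed.

Lemma dilB n x y : dil n (x - y) = dil n x - dil n y.
Proof. by apply: vilenkin_ext. Qed.

Lemma dil_gvec n k : dil n (gvec k : vilenkin p) = gvec (k - n).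
Proof.
by apply: vilenkin_ext => j; rewrite digit_dil !digit_gvec -subr_eq opprK.
Qed.

Lemma GsubN n x : Gsub n x -> Gsub n (- x).
Proof. by move=> Gx k kn; rewrite digitN Gx// oppr0. Qed.

Lemma GsubB n x y : Gsub n x -> Gsub n y -> Gsub n (x - y).
Proof. by move=> Gx Gy; apply: GsubD => //; exact: GsubN. Qed.

Lemma GsubBC n x y : Gsub n (x - y) -> Gsub n (y - x).
Proof. by move=> /GsubN; rewrite opprB. Qed.

Lemma Gsub_dil n m x : Gsub n (dil m x) <-> Gsub (n + m) x.
Proof.
split=> Gx k kn; last by rewrite digit_dil Gx// ltrD2r.
by rewrite -(subrK m k) -digit_dil Gx// ltrBlDr.
Qed.

Lemma Gsub_gvec n k : n <= k -> Gsub n (gvec k : vilenkin p).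
Proof. by move=> nk j jn; rewrite digit_gvec lt_eqF// (lt_le_trans jn). Qed.

Lemma Gsub_ex x : exists n : nat, Gsub (- n%:Z) x.
Proof.
have /asboolP fx := valP x.
have [M xM] : exists M : nat, forall k : int, k < 0 -> digit x k != 0 -> (`|k|%N < M)%N.
  have /finite_seqP [s sE] := (finite_image (fun k : int => `|k|%N) fx).
  exists (\max_(i <- s) i).+1 => k k0 xk; rewrite ltnS.
  have ks : `|k|%N \in s.
    have : [set` s] `|k|%N by rewrite -sE; exists k.
    by [].
  exact: (@leq_bigmax_seq _ s xpredT id _ ks).
exists M => k kM; apply/eqP; apply: contraT => xk.
have k0 : k < 0 by lia.
by have := xM k k0 xk; lia.
Qed.

(** A group element has finitely many nonzero digits of negative index, so vanishing from place 0 on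
    already yields a finite combination of generators. The closure properties of [H_0] are all read
    off this form. *)
Lemma H_0P h : H_0 h <-> forall k, 0 <= k -> digit h k = 0.
Proof.
split=> [[s [a ->]] k k0|hk].
  rewrite digit_sum big1// => j _; rewrite digitMn digit_gvec.
  by rewrite (_ : (k == _) = false) ?mul0rn//; lia.
have [M hM] := Gsub_ex h.
exists M, (fun j => digit h (- (j.+1%:Z))); apply: vilenkin_ext => k.
rewrite digit_sum; under eq_bigr do rewrite digitMn digit_gvec.
have [k0|k0] := leP 0 k.
  rewrite hk// big1// => j _.
  by rewrite (_ : (k == _) = false) ?mul0rn//; lia.
have [kM|kM] := ltP k (- M%:Z).
  rewrite hM// big1// => j _.
  by rewrite (_ : (k == _) = false) ?mul0rn//; have := ltn_ord j; lia.
have jM : (`|k|.-1 < M)%N by lia.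
rewrite (bigD1 (Ordinal jM))//= big1 => [|j jk].
  have kE : k = - (`|k|.-1.+1)%:Z by lia.
  by rewrite -kE eqxx addr0 natr_Zp_val.
rewrite (_ : (k == _) = false) ?mul0rn//.
by apply: contra_neqF jk => /eqP kj; apply: val_inj => /=; lia.
Qed.

Lemma H_0_0 : H_0 (0 : vilenkin p).
Proof. by apply/H_0P => k _. Qed.

Lemma H_0D x y : H_0 x -> H_0 y -> H_0 (x + y).
Proof.
by move=> /H_0P Hx /H_0P Hy; apply/H_0P => k k0; rewrite digitD Hx// Hy// addr0.
Qed.

Lemma H_0B x y : H_0 x -> H_0 y -> H_0 (x - y).
Proof.
by move=> /H_0P Hx /H_0P Hy; apply/H_0P => k k0; rewrite digitB Hx// Hy// subrr.
Qed.

Lemma H_0_dil (n : nat) x : H_0 x -> H_0 (dil n%:Z x).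
Proof. by move=> /H_0P Hx; apply/H_0P => k k0; rewrite digit_dil Hx//; lia. Qed.

Lemma H_0_gvec k : k < 0 -> H_0 (gvec k : vilenkin p).
Proof. by move=> k0; apply/H_0P => j j0; rewrite digit_gvec; case: eqP => //; lia. Qed.

Lemma H_0Mn x m : H_0 x -> H_0 (x *+ m).
Proof. by move=> /H_0P Hx; apply/H_0P => j j0; rewrite digitMn Hx// mul0rn. Qed.

(** Selects the representative in [H_0] of the coset of [x] modulo [Gsub 0]. *)
Definition vtrunc_fun x : int -> 'Z_p := fun k => if k < 0 then digit x k else 0.

Fact vtrunc_subproof x : vtrunc_fun x \in @fin_neg_supp p.
Proof.
apply/asboolP; have /asboolP fx := valP x.
by apply: sub_finite_set fx => k /= [k0]; rewrite /vtrunc_fun k0.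
Qed.

Definition vtrunc x : vilenkin p := Sub (vtrunc_fun x) (vtrunc_subproof x).

Lemma digit_vtrunc x k : digit (vtrunc x) k = if k < 0 then digit x k else 0.
Proof. by []. Qed.

Lemma H_0_vtrunc x : H_0 (vtrunc x).
Proof. by apply/H_0P => k k0; rewrite digit_vtrunc ltNge k0. Qed.

(** The codes form a countable type, which lets the balls be enumerated. *)
Definition H_0_code (u : {s : nat & {ffun 'I_s -> 'Z_p}}) : vilenkin p :=
  \sum_(j < tag u) gvec (- (j.+1%:Z)) *+ (tagged u j : nat).

Lemma H_0_codeP h : H_0 h -> exists u, h = H_0_code u.
Proof.
move=> [s [a ->]]; exists (Tagged (fun s => {ffun 'I_s -> 'Z_p}) [ffun j => a j]).
by apply: eq_bigr => j _; rewrite ffunE.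
Qed.

Definition vball n x : set (vilenkin p) := [set y | Gsub n (y - x)].

Lemma vball_center n x : vball n x x.
Proof. by rewrite /vball/= subrr. Qed.

Lemma vball0 n : vball n 0 = Gsub n.
Proof. by apply/seteqP; split=> x; rewrite /vball/= subr0. Qed.

Lemma vball_trans n x y z : vball n x y -> vball n y z -> vball n x z.
Proof. by rewrite /vball/= => xy yz; rewrite -(subrK y z) -addrA; exact: GsubD. Qed.

Lemma vball_sym n x y : vball n x y -> vball n y x.
Proof. exact: GsubBC. Qed.

Lemma vball_eq n x y : vball n x y -> vball n x = vball n y.
Proof.
move=> xy; apply/seteqP; split=> z; last exact: vball_trans.
exact/vball_trans/vball_sym.
Qed.

Lemma vball_vtrunc n x : vball n x = vball n (dil (- n) (vtrunc (dil n x))).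
Proof.
apply/vball_eq/vball_sym => k kn.
by rewrite digitB digit_dil digit_vtrunc digit_dil subrK subr_lt0 kn subrr.
Qed.

Lemma vball_le m n x : m <= n -> vball n x `<=` vball m x.
Proof. by move=> mn y; exact: Gsub_le. Qed.

Lemma vball_open n x : open (vball n x).
Proof. by move=> y xy; exists n => // z; exact: vball_trans. Qed.

Definition vballs : set (set (vilenkin p)) :=
  [set B | B = set0 \/ exists n x, B = vball n x].

(** Balls with a common point are nested; the empty set belongs to [vballs] for the disjoint case.
    This is the $\pi$-system behind the uniqueness of measures and the Dynkin inductions. *)
Lemma vballs_setI : setI_closed vballs.
Proof.
move=> A B [->|[m [x ->]]]; first by rewrite set0I; left.
move=> [->|[n [y ->]]]; first by rewrite setI0; left.
have [->|/set0P [z [xz yz]]] := eqVneq (vball m x `&` vball n y) set0; first by left.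
rewrite (vball_eq xz) (vball_eq yz); right.
have [mn|/ltW nm] := leP m n; [exists n|exists m]; exists z.
  by rewrite setIidr//; exact: vball_le.
by rewrite setIidl//; exact: vball_le.
Qed.

(** An open set is the union of the balls inside it, and these are countably many: at level [n] the
    centre can be moved to a dilate of an element of [H_0]. *)
Lemma vballs_generate : @measurable _ (borel (vilenkin p)) = <<s vballs >>.
Proof.
apply/seteqP; split; last first.
  apply: smallest_sub => [|B [->|[n [x ->]]]].
  - exact: (@sigma_algebra_measurable _ (borel (vilenkin p))).
  - exact: (@measurable0 _ (borel (vilenkin p))).
  - by apply: sub_gen_smallest; exact: vball_open.
apply: smallest_sub; first exact: smallest_sigma_algebra.
move=> O oO.
pose B (c : int * {s : nat & {ffun 'I_s -> 'Z_p}}) :=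
  vball c.1 (dil (- c.1) (H_0_code c.2)).
have -> : O = \bigcup_c (if `[< B c `<=` O >] then B c else set0).
  apply/seteqP; split=> [x Ox|x [c _]]; last by case: asboolP => // cO; exact: cO.
  have [n _ nO] := oO x Ox; have [u uE] := H_0_codeP (H_0_vtrunc (dil n x)).
  have BE : B (n, u) = vball n x by rewrite /B/= -uE -vball_vtrunc.
  by exists (n, u) => //; rewrite BE asboolT//; exact: vball_center.
apply: (@countable_bigcupT_measurable _ (g_sigma_algebraType vballs)) => [|c].
  exact: countableP.
case: ifP => _; last exact: measurable0.
by apply: sub_gen_smallest; right; exists c.1, (dil (- c.1) (H_0_code c.2)).
Qed.

Lemma bigcup_Gsub : \bigcup_(n : nat) Gsub (- n%:Z) = [set: vilenkin p].
Proof. by apply/seteqP; split=> // x _; have [n] := Gsub_ex x; exists n. Qed.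

Lemma measurable_vball n x : measurable (vball n x : set (borel (vilenkin p))).
Proof. by apply: sub_gen_smallest; exact: vball_open. Qed.

Lemma measurable_Gsub n : measurable (Gsub n : set (borel (vilenkin p))).
Proof. by rewrite -vball0; exact: measurable_vball. Qed.

End vilenkin_digits.

(** * Squared moduli of complex numbers *)

Section complex_facts.
Context {R : realType}.
Implicit Types z w : R[i].

Definition sqn z : R := complex.Re z ^+ 2 + complex.Im z ^+ 2.

Lemma sqn_ge0 z : 0 <= sqn z.
Proof. by rewrite addr_ge0 ?sqr_ge0. Qed.

Lemma normc_sqr z : normc z ^+ 2 = sqn z.
Proof. by case: z => a b; rewrite /normc sqr_sqrtr// addr_ge0 ?sqr_ge0. Qed.

Lemma sqn_conj z : (sqn z)%:C = z * z^*.
Proof.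
case: z => a b; apply/eqP; rewrite eq_complex /sqn/=; apply/andP; split; apply/eqP; ring.
Qed.

Lemma sqn_eq1 z : (sqn z == 1) = (`|z| == 1).
Proof.
rewrite normc_def -[complex.Re z ^+ 2 + _]/(sqn z) -[1 in RHS]/(1%:C) (inj_eq (@complexI _)).
by rewrite -[X in _ = (_ == X)]sqrtr1 eqr_sqrt ?sqn_ge0.
Qed.

Lemma sqnM z w : sqn (z * w) = sqn z * sqn w.
Proof. by case: z w => a b [c d]; rewrite /sqn/=; ring. Qed.

Lemma sqn0 : sqn 0 = 0.
Proof. by rewrite /sqn/= expr0n/= addr0. Qed.

Lemma sqnN z : sqn (- z) = sqn z.
Proof. by case: z => a b; rewrite /sqn/= !sqrrN. Qed.

Lemma sqn_eq0 z : sqn z = 0 -> z = 0.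
Proof.
move=> /eqP; rewrite paddr_eq0 ?sqr_ge0// !sqrf_eq0; case: z => a b /=.
by move=> /andP[/eqP -> /eqP ->].
Qed.

Lemma sqnD_le z w : sqn (z + w) <= 2 * sqn z + 2 * sqn w.
Proof.
by case: z w => a b [c d]; rewrite /sqn/=; have := sqr_ge0 (a - c); have := sqr_ge0 (b - d); nra.
Qed.

Lemma complexReD z w : complex.Re (z + w) = complex.Re z + complex.Re w.
Proof. by case: z w => a b []. Qed.

Lemma complexImD z w : complex.Im (z + w) = complex.Im z + complex.Im w.
Proof. by case: z w => a b []. Qed.

Lemma complexReM z w : complex.Re (z * w) = complex.Re z * complex.Re w - complex.Im z * complex.Im w.
Proof. by case: z w => a b []. Qed.

Lemma complexImM z w : complex.Im (z * w) = complex.Re z * complex.Im w + complex.Im z * complex.Re w.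
Proof. by case: z w => a b []. Qed.

End complex_facts.

(** * Square-integrable functions *)

Section L2_theory.
Context d (T : measurableType d) (R : realType) (mu : {measure set T -> \bar R}).
Implicit Types (f g : T -> R[i]) (S V : set (T -> R[i])) (D : set T).

Definition cmeas f :=
  measurable_fun setT (fun x => complex.Re (f x)) /\
  measurable_fun setT (fun x => complex.Im (f x)).

(** Squared norms involve no roots and restrict well to subsets; their triangle inequality with
    factors 2 serves all the approximation arguments. *)
Definition nsq D f : \bar R := (\int[mu]_(x in D) (sqn (f x))%:E)%E.

Lemma cmeasD f g : cmeas f -> cmeas g -> cmeas (f \+ g).
Proof.
move=> [? ?] [? ?]; split.
- by under eq_fun do rewrite /= complexReD; exact: measurable_funD.
- by under eq_fun do rewrite /= complexImD; exact: measurable_funD.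
Qed.

Lemma cmeasM f g : cmeas f -> cmeas g -> cmeas (f \* g).
Proof.
move=> [? ?] [? ?]; split.
- under eq_fun do rewrite /= complexReM.
  by apply: measurable_funB; exact: measurable_funM.
- under eq_fun do rewrite /= complexImM.
  by apply: measurable_funD; exact: measurable_funM.
Qed.

Lemma cmeas_cst (c : R[i]) : cmeas (fun=> c).
Proof. by split; exact: measurable_cst. Qed.

Lemma cmeasZ (c : R[i]) f : cmeas f -> cmeas (fun x => c * f x).
Proof. by move=> mf; apply: (cmeasM (cmeas_cst c) mf). Qed.

Lemma cmeasB f g : cmeas f -> cmeas g -> cmeas (f \- g).
Proof.
move=> mf mg; rewrite (_ : f \- g = f \+ (fun x => -1 * g x)).
  by apply: cmeasD => //; exact: cmeasZ.
by apply/funext => x; rewrite /= mulN1r.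
Qed.

Lemma cmeas_conj f : cmeas f -> cmeas (fun x => (f x)^*).
Proof.
move=> [mr mi]; split.
- by rewrite (_ : (fun x => complex.Re (f x)^*) = fun x => complex.Re (f x))//; apply/boolp.funext => x; case: (f x).
- rewrite (_ : (fun x => complex.Im (f x)^*) = fun x => - complex.Im (f x)).
    exact: measurable_funN.
  by apply/funext => x; case: (f x).
Qed.

Lemma measurable_sqn f : cmeas f -> measurable_fun setT (fun x => sqn (f x)).
Proof. by move=> [mr mi]; apply: measurable_funD; exact: measurable_funX. Qed.

Lemma measurable_sqnE D f : cmeas f -> measurable D ->
  measurable_fun D (fun x => (sqn (f x))%:E).
Proof.
move=> mf mD; apply/measurable_EFinP.
exact/(measurable_funS measurableT)/measurable_sqn.
Qed.

Lemma nsq_ge0 D f : (0 <= nsq D f)%E.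
Proof. by apply: integral_ge0 => x _; rewrite lee_fin sqn_ge0. Qed.

Lemma L2normE f : L2norm mu f = (nsq setT f `^ 2^-1)%E.
Proof.
rewrite /L2norm unlock; congr (_ `^ _)%E; apply: eq_integral => x _ /=.
have n0 : 0 <= normc (f x) by case: (f x) => a b; exact: sqrtr_ge0.
by rewrite ger0_norm// (powR_mulrn 2 n0) normc_sqr.
Qed.

Lemma L2norm_lt f (e : R) : 0 < e -> (L2norm mu f < e%:E)%E = (nsq setT f < (e ^+ 2)%:E)%E.
Proof.
move=> e0; rewrite L2normE; move: (nsq_ge0 setT f).
case: (nsq setT f) => [r|_|//]; last by rewrite poweRyr ?invr_neq0// !ltNge !leey.
rewrite lee_fin => r0; rewrite poweR_EFin !lte_fin powR12_sqrt//.
by rewrite -[in RHS](sqr_sqrtr r0) ltr_pXn2r ?nnegrE ?sqrtr_ge0// ltW.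
Qed.

Lemma L2P f : L2 mu f <-> cmeas f /\ (nsq setT f < +oo)%E.
Proof.
have E : (L2norm mu f < +oo)%E <-> (nsq setT f < +oo)%E.
  rewrite L2normE; case: (nsq setT f) (nsq_ge0 setT f) => [r||//] _.
    by rewrite poweR_EFin !ltey.
  by rewrite poweRyr ?invr_neq0.
by split=> [[? ? /E]|[[? ?] /E]].
Qed.

Lemma nsqD_le D f g : measurable D -> cmeas f -> cmeas g ->
  (nsq D (f \+ g)%R <= 2%:E * nsq D f + 2%:E * nsq D g)%E.
Proof.
move=> mD mf mg; have mf' := measurable_sqnE mf mD; have mg' := measurable_sqnE mg mD.
rewrite -!ge0_integralZl//; try by move=> x _; rewrite lee_fin sqn_ge0.
rewrite -ge0_integralD//; try by [
  move=> x _; rewrite -EFinM lee_fin mulr_ge0 ?sqn_ge0 | exact: measurable_funeM].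
apply: ge0_le_integral => //.
- by move=> x _; rewrite lee_fin sqn_ge0.
- by apply: measurable_sqnE => //; exact: cmeasD.
- by apply: emeasurable_funD; exact: measurable_funeM.
- by move=> x _; rewrite -!EFinM -EFinD lee_fin; exact: sqnD_le.
Qed.

Lemma nsqZ D (c : R[i]) f : measurable D -> cmeas f ->
  nsq D (fun x => c * f x) = ((sqn c)%:E * nsq D f)%E.
Proof.
move=> mD mf; rewrite -ge0_integralZl ?lee_fin ?sqn_ge0//.
- by apply: eq_integral => x _; rewrite sqnM EFinM.
- exact: measurable_sqnE.
- by move=> x _; rewrite lee_fin sqn_ge0.
Qed.

Lemma nsq_subset D f : measurable D -> cmeas f -> (nsq D f <= nsq setT f)%E.
Proof.
move=> mD mf; apply: ge0_subset_integral => //; first exact: measurable_sqnE.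
by move=> x _; rewrite lee_fin sqn_ge0.
Qed.

Lemma nsqN D f : nsq D (fun x => - f x) = nsq D f.
Proof. by apply: eq_integral => x _; rewrite sqnN. Qed.

Lemma nsqBC D f g : nsq D (f \- g) = nsq D (g \- f).
Proof. by rewrite -nsqN; congr nsq; apply/funext => x /=; rewrite opprB. Qed.

Lemma nsqD_lt D f g (a b : R) : measurable D -> cmeas f -> cmeas g ->
  (nsq D f < a%:E)%E -> (nsq D g < b%:E)%E -> (nsq D (f \+ g)%R < (2 * a + 2 * b)%:E)%E.
Proof.
move=> mD mf mg fa gb; apply: le_lt_trans (nsqD_le mD mf mg) _.
rewrite (_ : (2 * a + 2 * b)%:E = 2%:E * a%:E + 2%:E * b%:E)%E//.
by apply: lteD; rewrite lte_pmul2l// lte_fin.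
Qed.

Lemma L2_cmeas f : L2 mu f -> cmeas f.
Proof. by move=> /L2P[]. Qed.

Lemma L2_nsq f : L2 mu f -> (nsq setT f < +oo)%E.
Proof. by move=> /L2P[]. Qed.

Lemma L2D f g : L2 mu f -> L2 mu g -> L2 mu (f \+ g).
Proof.
move=> /L2P[mf f2] /L2P[mg g2]; apply/L2P; split; first exact: cmeasD.
apply: le_lt_trans (nsqD_le measurableT mf mg) _.
by apply: lte_add_pinfty; apply: lte_mul_pinfty.
Qed.

Lemma L2Z (c : R[i]) f : L2 mu f -> L2 mu (fun x => c * f x).
Proof.
move=> /L2P[mf f2]; apply/L2P; split; first exact: cmeasZ.
by rewrite nsqZ//; apply: lte_mul_pinfty => //; rewrite lee_fin sqn_ge0.
Qed.

Lemma L2B f g : L2 mu f -> L2 mu g -> L2 mu (f \- g).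
Proof.
move=> Lf Lg; rewrite (_ : f \- g = f \+ (fun x => -1 * g x)).
  by apply: L2D => //; exact: L2Z.
by apply/funext => x; rewrite /= mulN1r.
Qed.

Lemma L2_0 : L2 mu (fun=> 0).
Proof.
apply/L2P; split; first exact: cmeas_cst.
by rewrite /nsq sqn0 integral0.
Qed.

Lemma L2_sum (I : Type) (r : seq I) (F : I -> T -> R[i]) :
  (forall i, L2 mu (F i)) -> L2 mu (fun x => \sum_(i <- r) F i x).
Proof.
move=> LF; elim: r => [|i r IH].
  by under eq_fun do rewrite big_nil; exact: L2_0.
by under eq_fun do rewrite big_cons; exact: L2D.
Qed.

Lemma L2M_norm1 f g : L2 mu f -> cmeas g -> (forall x, `|g x| = 1) -> L2 mu (f \* g).
Proof.
move=> /L2P[mf f2] mg g1; apply/L2P; split; first exact: cmeasM.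
rewrite (_ : nsq _ _ = nsq setT f)//; apply: eq_integral => x _.
by rewrite sqnM (eqP (_ : sqn (g x) == 1)) ?mulr1// sqn_eq1 g1.
Qed.

Lemma sub_lspan S : S `<=` lspan S.
Proof.
move=> f Sf; exists 1%N, (fun=> 1), (fun=> f); split=> //.
by apply/funext => x; rewrite big_ord1 mul1r.
Qed.

Lemma lspan0 S : lspan S (fun=> 0).
Proof.
exists 0%N, (fun=> 0), (fun _ _ => 0); split=> [[]//|].
by apply/funext => x; rewrite big_ord0.
Qed.

Lemma lspanD S f g : lspan S f -> lspan S g -> lspan S (f \+ g).
Proof.
move=> [m [c [u [Su ->]]]] [n [c' [v [Sv ->]]]].
exists (m + n)%N, (fun i => match fintype.split i with inl j => c j | inr j => c' j end),
  (fun i => match fintype.split i with inl j => u j | inr j => v j end); split=> [i|].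
  by case: (fintype.split i).
apply/funext => x /=; rewrite big_split_ord/=; congr (_ + _); apply: eq_bigr => i _.
- by rewrite (unsplitK (inl i : 'I_m + 'I_n)).
- by rewrite (unsplitK (inr i : 'I_m + 'I_n)).
Qed.

Lemma lspanZ S (a : R[i]) f : lspan S f -> lspan S (fun x => a * f x).
Proof.
move=> [m [c [u [Su ->]]]]; exists m, (fun i => a * c i), u; split=> //.
by apply/funext => x; rewrite mulr_sumr; apply: eq_bigr => i _; rewrite mulrA.
Qed.

Lemma lspan_sum S (I : Type) (r : seq I) (F : I -> T -> R[i]) :
  (forall i, lspan S (F i)) -> lspan S (fun x => \sum_(i <- r) F i x).
Proof.
move=> SF; elim: r => [|i r IH].
  by under eq_fun do rewrite big_nil; exact: lspan0.
by under eq_fun do rewrite big_cons; exact: lspanD.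
Qed.

Lemma lspan_ind S (P : (T -> R[i]) -> Prop) :
  P (fun=> 0) -> (forall f g, P f -> P g -> P (f \+ g)) ->
  (forall (a : R[i]) f, S f -> P (fun x => a * f x)) -> lspan S `<=` P.
Proof.
move=> P0 PD PZ _ [n [c [g [Sg ->]]]]; elim: n => [|n IH] in c g Sg *.
  by rewrite (_ : (fun _ => _) = fun=> 0)//; apply/funext => x; rewrite big_ord0.
under eq_fun do rewrite big_ord_recl.
by apply: PD; [exact: PZ|exact: IH].
Qed.

Lemma lspan_sub S S' : S `<=` lspan S' -> lspan S `<=` lspan S'.
Proof.
move=> SS'; apply: lspan_ind; [exact: lspan0|move=> ? ?; exact: lspanD|].
by move=> a f /SS'; exact: lspanZ.
Qed.

Lemma lspan_L2 S : S `<=` L2 mu -> lspan S `<=` L2 mu.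
Proof.
move=> SL; apply: lspan_ind; [exact: L2_0|move=> ? ?; exact: L2D|].
by move=> a f /SL; exact: L2Z.
Qed.

Lemma L2closureP S f : L2closure mu S f <->
  L2 mu f /\ forall e : R, 0 < e -> exists2 g, S g & (nsq setT (f \- g)%R < e%:E)%E.
Proof.
split=> -[Lf Sf]; split=> // e e0.
  have se0 : 0 < Num.sqrt e by rewrite sqrtr_gt0.
  have [g Sg] := Sf _ se0.
  by rewrite L2norm_lt ?sqrtr_gt0// sqr_sqrtr 1?ltW//; exists g.
have [g Sg fg] := Sf (e ^+ 2) (exprn_gt0 _ e0).
by exists g => //; rewrite L2norm_lt.
Qed.

Lemma L2closure_L2 S : L2closure mu S `<=` L2 mu.
Proof. by move=> f []. Qed.

Lemma nsq_subrr D f : nsq D (f \- f) = 0%E.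
Proof.
by rewrite /nsq; under eq_integral do rewrite /= subrr sqn0; rewrite integral0.
Qed.

Lemma sub_L2closure S : S `<=` L2 mu -> S `<=` L2closure mu S.
Proof.
move=> SL f Sf; apply/L2closureP; split; first exact: SL.
by move=> e e0; exists f => //; rewrite nsq_subrr lte_fin.
Qed.

Lemma L2closure_idem S S' : S `<=` L2 mu -> S' `<=` L2closure mu S ->
  L2closure mu S' `<=` L2closure mu S.
Proof.
move=> SL SS' f /L2closureP[Lf S'f]; apply/L2closureP; split=> // e e0.
(* [nsqD_lt] doubles both errors, so each may use a quarter of [e]. *)
have e4 : 0 < e / 4 by rewrite divr_gt0.
have [g S'g fg] := S'f _ e4; have /L2closureP[Lg Sg] := SS' _ S'g.
have [h Sh gh] := Sg _ e4; exists h => //.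
have [mf mg mh] : [/\ cmeas f, cmeas g & cmeas h].
  by split; apply: L2_cmeas => //; exact: SL.
rewrite (_ : f \- h = (f \- g) \+ (g \- h)).
  have -> : e = 2 * (e / 4) + 2 * (e / 4) by field.
  by apply: nsqD_lt => //; exact: cmeasB.
by apply/funext => x /=; rewrite addrA subrK.
Qed.

Lemma L2closure_sub S S' : S' `<=` L2 mu -> S `<=` S' -> L2closure mu S `<=` L2closure mu S'.
Proof.
move=> S'L SS'; apply: L2closure_idem => //.
by move=> f /SS'; exact: sub_L2closure.
Qed.

Section closed_span.
Variable (S : set (T -> R[i])) (SL : S `<=` L2 mu).
Let C := L2closure mu (lspan S).

Lemma closed_spanD f g : C f -> C g -> C (f \+ g).
Proof.
move=> /L2closureP[Lf Sf] /L2closureP[Lg Sg]; apply/L2closureP; split; first exact: L2D.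
move=> e e0; have e4 : 0 < e / 4 by rewrite divr_gt0.
have [f' Sf' ff'] := Sf _ e4; have [g' Sg' gg'] := Sg _ e4.
exists (f' \+ g'); first exact: lspanD.
have [/L2_cmeas mf' /L2_cmeas mg'] := (lspan_L2 SL Sf', lspan_L2 SL Sg').
have [mf mg] := (L2_cmeas Lf, L2_cmeas Lg).
rewrite (_ : _ \- _ = (f \- f') \+ (g \- g')).
  have -> : e = 2 * (e / 4) + 2 * (e / 4) by field.
  by apply: nsqD_lt => //; exact: cmeasB.
by apply/funext => x /=; rewrite opprD addrACA.
Qed.

Lemma closed_spanZ (a : R[i]) f : C f -> C (fun x => a * f x).
Proof.
move=> /L2closureP[Lf Sf]; apply/L2closureP; split; first exact: L2Z.
(* Dividing by [sqn a + 1] instead of [sqn a] covers [a = 0] as well. *)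
move=> e e0; have a1 : 0 < sqn a + 1 by rewrite ltr_wpDl ?sqn_ge0.
have [g Sg fg] := Sf (e / (sqn a + 1)) (divr_gt0 e0 a1).
exists (fun x => a * g x); first exact: lspanZ.
rewrite (_ : _ \- _ = fun x => a * (f \- g) x); last first.
  by apply/funext => x /=; rewrite mulrBr.
have mfg : cmeas (f \- g) by apply: cmeasB; apply: L2_cmeas => //; exact: lspan_L2 Sg.
rewrite nsqZ//; have := nsq_ge0 setT (f \- g).
move: fg; case: (nsq _ _) => [r||//] ; last by rewrite ltNge leey.
rewrite !lte_fin lee_fin ltr_pdivlMr// => re r0.
apply: le_lt_trans re; rewrite mulrC ler_wpM2l// lerDl//.
Qed.

Lemma closed_span0 : C (fun=> 0).
Proof. by apply: sub_L2closure; [exact: lspan_L2|exact: lspan0]. Qed.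

Lemma closed_span_lspan : lspan C `<=` C.
Proof.
apply: lspan_ind; [exact: closed_span0|move=> ? ?; exact: closed_spanD|].
by move=> a f; exact: closed_spanZ.
Qed.

Lemma closed_span_closed : L2closure mu C `<=` C.
Proof. by apply: L2closure_idem => //; exact: lspan_L2. Qed.

Lemma closed_span_sub S' : S' `<=` C -> L2closure mu (lspan S') `<=` C.
Proof.
move=> S'C; apply: L2closure_idem; first exact: lspan_L2.
apply: lspan_ind; [exact: closed_span0|move=> ? ?; exact: closed_spanD|].
by move=> a f /S'C; exact: closed_spanZ.
Qed.

Lemma sub_closed_span : S `<=` C.
Proof.
by move=> f Sf; apply: sub_L2closure; [exact: lspan_L2|exact: sub_lspan].
Qed.

Lemma closed_span_subspace : closed_subspace mu C.
Proof.
by split; [exact: L2closure_L2|exact: closed_span_lspan|exact: closed_span_closed].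
Qed.

Lemma closed_span_approx f : L2 mu f ->
  (forall e : R, 0 < e -> exists2 g, C g & (nsq setT (f \- g)%R < e%:E)%E) -> C f.
Proof. by move=> Lf Cf; apply: closed_span_closed; apply/L2closureP. Qed.

End closed_span.

End L2_theory.

(** * Integrals of complex-valued functions *)

Section cintegral_theory.
Context d (T : measurableType d) (R : realType) (mu : {measure set T -> \bar R}).
Implicit Types (f g : T -> R[i]) (D : set T).

Definition cintegrable D f :=
  mu.-integrable D (fun x => (complex.Re (f x))%:E) /\
  mu.-integrable D (fun x => (complex.Im (f x))%:E).

Lemma eq_cintegral D f g : (forall x, D x -> f x = g x) ->
  cintegral mu D f = cintegral mu D g.
Proof.
move=> fg; rewrite /cintegral; congr (_ +i* _);
  by apply: eq_Rintegral => x /[!inE] Dx; rewrite fg.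
Qed.

Lemma cintegral0 D : cintegral mu D (fun=> 0) = 0.
Proof.
by rewrite /cintegral/=; congr (_ +i* _); rewrite /Rintegral integral0.
Qed.

Lemma cintegrable0 D : cintegrable D (fun=> 0).
Proof. by split; exact: integrable0. Qed.

Lemma cintegrableD D f g : measurable D -> cintegrable D f -> cintegrable D g ->
  cintegrable D (f \+ g).
Proof.
move=> mD [fr fi] [gr gi]; split.
- rewrite (_ : (fun _ => _) = (fun x => (complex.Re (f x))%:E) \+ (fun x => (complex.Re (g x))%:E))%E.
    exact: integrableD.
  by apply/boolp.funext => x /=; rewrite complexReD EFinD.
- rewrite (_ : (fun _ => _) = (fun x => (complex.Im (f x))%:E) \+ (fun x => (complex.Im (g x))%:E))%E.
    exact: integrableD.
  by apply/boolp.funext => x /=; rewrite complexImD EFinD.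
Qed.

Lemma cintegralD D f g : measurable D -> cintegrable D f -> cintegrable D g ->
  cintegral mu D (f \+ g) = cintegral mu D f + cintegral mu D g.
Proof.
move=> mD [fr fi] [gr gi]; rewrite /cintegral.
under eq_Rintegral do rewrite complexReD.
under [X in _ +i* X]eq_Rintegral do rewrite complexImD.
by rewrite !RintegralD.
Qed.

Lemma cintegrableZ D (c : R[i]) f : measurable D -> cintegrable D f ->
  cintegrable D (fun x => c * f x).
Proof.
move=> mD [fr fi]; split.
- rewrite (_ : (fun _ => _) = (fun x => (complex.Re c)%:E * (complex.Re (f x))%:E) \-
      (fun x => (complex.Im c)%:E * (complex.Im (f x))%:E))%E.
    by apply: integrableB => //; exact: integrableZl.
  by apply/boolp.funext => x /=; rewrite complexReM EFinB !EFinM.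
- rewrite (_ : (fun _ => _) = (fun x => (complex.Re c)%:E * (complex.Im (f x))%:E) \+
      (fun x => (complex.Im c)%:E * (complex.Re (f x))%:E))%E.
    by apply: integrableD => //; exact: integrableZl.
  by apply/boolp.funext => x /=; rewrite complexImM EFinD !EFinM.
Qed.

Lemma cintegralZ D (c : R[i]) f : measurable D -> cintegrable D f ->
  cintegral mu D (fun x => c * f x) = c * cintegral mu D f.
Proof.
move=> mD [fr fi]; rewrite /cintegral.
have Z r h : mu.-integrable D (EFin \o h) -> mu.-integrable D (EFin \o (fun x => r * h x)).
  move=> ih; rewrite (_ : _ \o _ = (fun x => r%:E * (EFin \o h) x)%E); first exact: integrableZl.
  by apply/boolp.funext => x /=; rewrite EFinM.
under eq_Rintegral do rewrite complexReM.
under [X in _ +i* X]eq_Rintegral do rewrite complexImM.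
rewrite RintegralB ?RintegralD//; try exact: Z.
rewrite !RintegralZl//.
by case: c => a b.
Qed.

Lemma cintegrable_sum D (I : Type) (r : seq I) (F : I -> T -> R[i]) : measurable D ->
  (forall i, cintegrable D (F i)) -> cintegrable D (fun x => \sum_(i <- r) F i x).
Proof.
move=> mD iF; elim: r => [|i r IH].
  by under eq_fun do rewrite big_nil; exact: cintegrable0.
by under eq_fun do rewrite big_cons; exact: cintegrableD.
Qed.

Lemma cintegral_sum D (I : Type) (r : seq I) (F : I -> T -> R[i]) : measurable D ->
  (forall i, cintegrable D (F i)) ->
  cintegral mu D (fun x => \sum_(i <- r) F i x) = \sum_(i <- r) cintegral mu D (F i).
Proof.
move=> mD iF; elim: r => [|i r IH].
  by under eq_cintegral do rewrite big_nil; rewrite big_nil cintegral0.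
rewrite big_cons -IH -cintegralD//; last exact: cintegrable_sum.
by apply: eq_cintegral => x _; rewrite big_cons.
Qed.

Lemma cintegral_mkcond D f :
  cintegral mu D f = cintegral mu setT (fun x => (x \in D)%:R * f x).
Proof.
by rewrite /cintegral; congr (_ +i* _); rewrite Rintegral_mkcond;
  apply: eq_Rintegral => x _; rewrite patchE; case: ifP => _; rewrite ?mul1r// mul0r.
Qed.

(** Constants are integrable on a set of finite measure, and $2|a|\le 1+a^2$ bounds real and
    imaginary parts by [1 + sqn (f x)]. *)
Lemma L2_cintegrable D f : measurable D -> (mu D < +oo)%E -> L2 mu f -> cintegrable D f.
Proof.
move=> mD fD Lf; have [mr mi] := L2_cmeas Lf.
have i1 : mu.-integrable D (fun x => (1 + sqn (f x))%:E).
  rewrite (_ : (fun _ => _) = (fun=> 1%:E) \+ (fun x => (sqn (f x))%:E))%E//.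
  apply: integrableD => //.
    by apply/integrableP; split=> //; rewrite integral_cst// normr1 mul1e.
  apply/integrableP; split; first exact: measurable_sqnE (L2_cmeas Lf) mD.
  apply: le_lt_trans (L2_nsq Lf).
  rewrite (_ : (\int[_]_(x in _) _)%E = nsq mu D f); last first.
    by apply: eq_integral => x _; rewrite gee0_abs// lee_fin sqn_ge0.
  exact: nsq_subset (L2_cmeas Lf).
split; apply: (le_integrable mD _ _ i1) => [|x _].
- by apply/measurable_EFinP; exact: measurable_funS mr.
- rewrite !abse_EFin lee_fin [leRHS]ger0_norm; last by rewrite addr_ge0// sqn_ge0.
  rewrite /sqn.
  set a := complex.Re _; set b := complex.Im _.
  have := sqr_ge0 (`|a| - 1); rewrite -(real_normK (num_real a)).
  have := sqr_ge0 b; have := normr_ge0 a; nra.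
- by apply/measurable_EFinP; exact: measurable_funS mi.
- rewrite !abse_EFin lee_fin [leRHS]ger0_norm; last by rewrite addr_ge0// sqn_ge0.
  rewrite /sqn.
  set a := complex.Re _; set b := complex.Im _.
  have := sqr_ge0 (`|b| - 1); rewrite -(real_normK (num_real b)).
  have := sqr_ge0 a; have := normr_ge0 b; nra.
Qed.

Lemma ae_eq_cintegral f g : cmeas f -> cmeas g -> {ae mu, forall x, f x = g x} ->
  cintegral mu setT f = cintegral mu setT g.
Proof.
move=> [fr fi] [gr gi] fg; rewrite /cintegral /Rintegral.
congr (fine _ +i* fine _); apply: ae_eq_integral => //;
  try (by apply/measurable_EFinP); by apply: filterS fg => x /= -> _.
Qed.

Lemma nsq_ae0 D f : measurable D -> cmeas f -> nsq mu D f = 0%E ->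
  {ae mu, forall x, D x -> f x = 0}.
Proof.
move=> mD mf f0.
have : (\int[mu]_(x in D) `|(sqn (f x))%:E|)%E = 0%E.
  by rewrite -[RHS]f0; apply: eq_integral => x _; rewrite gee0_abs// lee_fin sqn_ge0.
move=> /(ae_eq_integral_abs _ mD (measurable_sqnE mf mD)).
by apply: filterS => x /= fx /fx [/sqn_eq0].
Qed.

Lemma ae0_nsq D f : measurable D -> cmeas f -> {ae mu, forall x, f x = 0} -> nsq mu D f = 0%E.
Proof.
move=> mD mf f0; rewrite /nsq (@ae_eq_integral _ _ _ _ _ (fun=> 0%E)) ?integral0//.
- exact: measurable_sqnE.
- by apply: filterS f0 => x /= -> _; rewrite sqn0.
Qed.

End cintegral_theory.

(** * Haar measure of the Vilenkin group *)

Section haar_vilenkin_theory.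
Context {R : realType} {p : nat} (p_prime : prime p).
Context (mu : {measure set (borel (vilenkin p)) -> \bar R}) (mu_haar : haar_vilenkin mu).
Implicit Types (n m k : int) (x y h : vilenkin p) (f : vilenkin p -> R[i]).

Local Lemma p_gt0 : 0 < p%:R :> R.
Proof. by rewrite ltr0n prime_gt0. Qed.

Lemma haar_vball n x : mu (vball n x) = (p%:R ^ (- n))%:E.
Proof.
have [tr bl] := mu_haar; rewrite -bl -(tr x (Gsub n) (measurable_Gsub n)).
congr (mu _); apply/seteqP; split=> [y|_ [z Gz <-]]; rewrite /vball/=.
  by exists (y - x) => //; rewrite addrC subrK.
by rewrite addrC addKr.
Qed.

Lemma haar_Gsub n : mu (Gsub n) = (p%:R ^ (- n))%:E.
Proof. by have [_] := mu_haar. Qed.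

Lemma measurable_fun_vballs (f : vilenkin p -> vilenkin p) :
  (forall n x, exists m y, f @^-1` vball n x = vball m y) ->
  measurable_fun setT (f : borel (vilenkin p) -> borel (vilenkin p)).
Proof.
move=> fB; apply: (@measurability _ _ (borel (vilenkin p)) (borel (vilenkin p)) setT f vballs) => [|_ [_ [->|[n [x ->]]] <-]].
- exact: vballs_generate.
- by rewrite setTI preimage_set0.
- by rewrite setTI; have [m [y ->]] := fB n x; exact: measurable_vball.
Qed.

Lemma preimage_shift_vball h n x : (fun y => y - h) @^-1` vball n x = vball n (x + h).
Proof.
have E y : y - (x + h) = y - h - x by rewrite opprD addrA addrAC.
by apply/seteqP; split=> y; rewrite /vball/= E.
Qed.

Lemma preimage_dil_vball m n x : dil m @^-1` vball n x = vball (n + m) (dil (- m) x).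
Proof.
apply/seteqP; split=> y; rewrite /vball/= => H.
  by apply/Gsub_dil; rewrite dilB dilNK.
by move/Gsub_dil : H; rewrite dilB dilNK.
Qed.

Lemma measurable_shift h : measurable_fun setT
  ((fun y => y - h) : borel (vilenkin p) -> borel (vilenkin p)).
Proof.
by apply: measurable_fun_vballs => n x; exists n, (x + h); rewrite preimage_shift_vball.
Qed.

Lemma measurable_dil m : measurable_fun setT
  (dil m : borel (vilenkin p) -> borel (vilenkin p)).
Proof.
apply: measurable_fun_vballs => n x.
by exists (n + m), (dil (- m) x); rewrite preimage_dil_vball.
Qed.

Section change_of_variables.
Variables (F : borel (vilenkin p) -> borel (vilenkin p)) (c : R).
Hypotheses (mF : measurable_fun setT F) (c0 : 0 <= c).
Hypothesis FB : forall n x, mu (F @^-1` vball n x) = (c%:E * mu (vball n x))%E.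

(** Both sides are measures in [B] that agree on the $\pi$-system of balls, and the subgroups
    [Gsub (- k)] exhaust the group with finite mass. Translations are the case [c = 1], dilations
    the case $c=p^{-m}$. *)
Lemma haar_preimage B : measurable B -> mu (F @^-1` B) = (c%:E * mu B)%E.
Proof.
move=> mB.
pose F' : {mfun borel (vilenkin p) >-> borel (vilenkin p)} :=
  HB.pack F (isMeasurableFun.Build _ _ _ _ _ mF).
have := @measure_unique _ R (borel (vilenkin p)) vballs (fun k : nat => Gsub (- k%:Z))
  vballs_generate vballs_setI.
move=> /(_ _ bigcup_Gsub (pushforward mu F') (mscale (NngNum c0) mu)).
apply=> //.
- by move=> k; right; exists (- k%:Z), 0; rewrite vball0.
- move=> A [->|[n [x ->]]]; last exact: FB.
  by rewrite !measure0.
- move=> k; have := FB (- k%:Z) 0; rewrite vball0 haar_Gsub => E.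
  change (mu (F @^-1` Gsub (- k%:Z)) < +oo)%E; rewrite E.
  by rewrite -EFinM ltey.
Qed.

Lemma haar_ge0_integral (D : set (borel (vilenkin p))) (g : borel (vilenkin p) -> \bar R) :
  measurable D -> measurable_fun setT g -> (forall x, 0 <= g x)%E ->
  (\int[mu]_(x in F @^-1` D) g (F x) = c%:E * \int[mu]_(x in D) g x)%E.
Proof.
move=> mD mg g0.
have mgD : measurable_fun D g by exact: measurable_funS mg.
pose F' : {mfun borel (vilenkin p) >-> borel (vilenkin p)} :=
  HB.pack F (isMeasurableFun.Build _ _ _ _ _ mF).
rewrite -(ge0_integral_pushforward mF mu mD mgD); last by move=> x _; exact: g0.
rewrite (_ : c = (NngNum c0)%:num)//.
rewrite -ge0_integral_mscale//.
apply: (@eq_measure_integral _ _ _ _ (mscale (NngNum c0) mu) (pushforward mu F')) => A mA _.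
exact: haar_preimage.
Qed.

End change_of_variables.

Lemma haar_shift_integral h (D : set (borel (vilenkin p))) (g : borel (vilenkin p) -> \bar R) :
  measurable D -> measurable_fun setT g ->
  (\int[mu]_(x in (fun y => y - h)%R @^-1` D) g (x - h)%R = \int[mu]_(x in D) g x)%E.
Proof.
move=> mD mg; have FB n x : mu ((fun y => y - h) @^-1` vball n x) = (1%:E * mu (vball n x))%E.
  by rewrite preimage_shift_vball !haar_vball mul1e.
rewrite [LHS]integralE [RHS]integralE; congr (_ - _)%E.
- rewrite -[RHS]mul1e -(haar_ge0_integral (measurable_shift h) ler01 FB)//.
    by apply: eq_integral => x _; rewrite !funeposE.
  exact: measurable_funepos.
- rewrite -[RHS]mul1e -(haar_ge0_integral (measurable_shift h) ler01 FB)//.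
    by apply: eq_integral => x _; rewrite !funenegE.
  exact: measurable_funeneg.
Qed.

Lemma haar_shift_cintegral h (D : set (borel (vilenkin p))) f : measurable D ->
  cmeas (T := borel (vilenkin p)) f ->
  cintegral mu ((fun y => y - h) @^-1` D) (fun x => f (x - h)) = cintegral mu D f.
Proof.
move=> mD [mr mi]; rewrite /cintegral /Rintegral.
congr (fine _ +i* fine _).
- by apply: (@haar_shift_integral h D (fun x => (complex.Re (f x))%:E)) => //; exact/measurable_EFinP.
- by apply: (@haar_shift_integral h D (fun x => (complex.Im (f x))%:E)) => //; exact/measurable_EFinP.
Qed.

Lemma cmeas_shift h f : cmeas (T := borel (vilenkin p)) f ->
  cmeas (T := borel (vilenkin p)) (fun x => f (x - h)).
Proof.
move=> [mr mi]; split.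
- exact: (measurableT_comp mr (measurable_shift h)).
- exact: (measurableT_comp mi (measurable_shift h)).
Qed.

Lemma cmeas_dil m f : cmeas (T := borel (vilenkin p)) f ->
  cmeas (T := borel (vilenkin p)) (fun x => f (dil m x)).
Proof.
move=> [mr mi]; split.
- exact: (measurableT_comp mr (measurable_dil m)).
- exact: (measurableT_comp mi (measurable_dil m)).
Qed.

Lemma nsq_shift h f : cmeas (T := borel (vilenkin p)) f ->
  nsq mu setT (fun x => f (x - h)) = nsq mu setT f.
Proof.
move=> mf; by rewrite -[RHS](haar_shift_integral h)//; exact: measurable_sqnE.
Qed.

Lemma nsq_dil m f : cmeas (T := borel (vilenkin p)) f ->
  nsq mu setT (fun x => f (dil m x)) = ((p%:R ^ (- m))%:E * nsq mu setT f)%E.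
Proof.
move=> mf; have FB n x : mu (dil m @^-1` vball n x) = ((p%:R ^ (- m))%:E * mu (vball n x))%E.
  rewrite preimage_dil_vball !haar_vball -EFinM -expfzDr ?gt_eqF ?p_gt0//.
  by rewrite -opprD addrC.
have c0 : 0 <= p%:R ^ (- m) :> R by rewrite exprz_ge0// ltW// p_gt0.
rewrite -(haar_ge0_integral (measurable_dil m) c0 FB)//.
- exact: measurable_sqnE.
- by move=> x; rewrite lee_fin sqn_ge0.
Qed.

Lemma L2_shift h f : L2 mu f -> L2 mu (fun x => f (x - h)).
Proof.
move=> /L2P[mf f2]; apply/L2P; split; first exact: cmeas_shift.
by rewrite nsq_shift.
Qed.

Lemma L2_dil m f : L2 mu f -> L2 mu (fun x => f (dil m x)).
Proof.
move=> /L2P[mf f2]; apply/L2P; split; first exact: cmeas_dil.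
rewrite nsq_dil//; apply: lte_mul_pinfty => //.
by rewrite lee_fin exprz_ge0// ltW// p_gt0.
Qed.

Definition loc_const n f := forall x y, vball n x y -> f y = f x.

(** Every preimage is a union of balls of level [n], hence open. Characters and atoms get their
    measurability from here. *)
Lemma loc_const_cmeas n f : loc_const n f -> cmeas (T := borel (vilenkin p)) f.
Proof.
move=> lf; have H (g : R[i] -> R) : measurable_fun setT
    ((fun x => g (f x)) : borel (vilenkin p) -> R).
  move=> _ B mB; rewrite setTI; apply: sub_gen_smallest.
  suff : @open (vilenkin p) ((fun x => g (f x)) @^-1` B) by [].
  by move=> x Bx; exists n => // y xy; rewrite /= (lf x y).
by split; exact: H.
Qed.

Lemma loc_const_le m n f : m <= n -> loc_const m f -> loc_const n f.
Proof. by move=> mn lf x y xy; apply: lf; exact: vball_le xy. Qed.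

Lemma nsq_vball n x f : loc_const n f ->
  nsq mu (vball n x) f = (sqn (f x) * p%:R ^ (- n))%:E.
Proof.
move=> lf; rewrite /nsq; under eq_integral => y /[!inE] xy do rewrite (lf x y)//.
by rewrite integral_cst ?haar_vball//; exact: measurable_vball.
Qed.

End haar_vilenkin_theory.

(** * Characters *)

Section characters.
Context {R : realType} {p : nat} (p_prime : prime p).
Implicit Types (x y h : vilenkin p) (a : 'Z_p).

Definition zchar a : R[i] := cis (pi *+ 2 * (a : nat)%:R / p%:R).

Lemma rademacherE n x : @rademacher R p p_prime n x = zchar (digit x n).
Proof. by []. Qed.

Lemma zchar0 : zchar 0 = 1.
Proof. by rewrite /zchar mulr0 mul0r /cis cos0 sin0. Qed.

(** Digit 0 of a multiple of [gvec 0] can be any residue, so the multiplicativity of the Rademacher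
    character on the group transfers to ['Z_p]. *)
Lemma zcharD a (b : 'Z_p) : zchar (a + b) = zchar a * zchar b.
Proof.
pose x := (gvec 0 : vilenkin p) *+ a; pose y := (gvec 0 : vilenkin p) *+ b.
have dx : digit x 0 = a by rewrite digitMn digit_gvec natr_Zp_val.
have dy : digit y 0 = b by rewrite digitMn digit_gvec natr_Zp_val.
by have := rademacher_funD (R := R) p_prime 0 x y; rewrite /rademacher_fun digitD dx dy.
Qed.

Lemma norm_zchar a : `|zchar a| = 1.
Proof. exact: norm_cis. Qed.

Lemma zchar_conj a : zchar a * (zchar a)^* = 1.
Proof. by rewrite -sqn_conj (eqP (_ : sqn (zchar a) == 1)) // sqn_eq1 norm_zchar. Qed.

Lemma zcharN a : zchar (- a) = (zchar a)^*.
Proof.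
have z0 : zchar a != 0 by rewrite -normr_eq0 norm_zchar oner_eq0.
by apply: (mulfI z0); rewrite zchar_conj -zcharD subrr zchar0.
Qed.

Lemma zcharMn a n : zchar a ^+ n = zchar (a *+ n).
Proof.
by elim: n => [|n IH]; rewrite ?expr0 ?mulr0n ?zchar0// exprS IH mulrS zcharD.
Qed.

(** The real part is $\cos 2u=1-2\sin^2 u$ with $u=\pi a/p$; a nonzero digit has $0<u<\pi$, where
    the sine is positive. *)
Lemma zchar_eq1 a : zchar a = 1 -> a = 0.
Proof.
move=> /(congr1 (@complex.Re R)); rewrite /zchar/=.
set t := (X in cos X) => ct.
apply/eqP; apply: contraT => a0.
have ap : (a < p)%N by apply: leq_trans (ltn_ord a) _; rewrite Zp_cast// prime_gt1.
have a0' : (0 < a)%N by rewrite lt0n; apply: contraNneq a0 => a0; apply/eqP/val_inj.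
have p0 : 0 < p%:R :> R by rewrite ltr0n prime_gt0.
have tE : t = (pi * a%:R / p%:R) *+ 2 by rewrite /t mulrnAl mulrnAl.
have s0 : 0 < sin (pi * a%:R / p%:R : R).
  have u0 : 0 < pi * a%:R / p%:R :> R by rewrite divr_gt0// mulr_gt0 ?pi_gt0// ltr0n.
  have upi : pi * a%:R / p%:R < pi :> R by rewrite ltr_pdivrMr// ltr_pM2l ?pi_gt0// ltr_nat.
  by apply: sin_gt0_pi; rewrite ?u0 ?upi.
move: ct; rewrite tE cos_mulr2n cos2sin2 => ct.
suff : 0 < 0 :> R by rewrite ltxx.
by have := exprn_gt0 2 s0; lra.
Qed.

Lemma zchar_inj : injective zchar.
Proof.
move=> a b ab; apply/eqP; rewrite -subr_eq0; apply/eqP/zchar_eq1.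
by rewrite zcharD zcharN -ab zchar_conj.
Qed.

(** Replacing [a] by [a + 1] permutes the terms and multiplies the sum by [zchar b], which is not 1
    unless [b = 0]. *)
Lemma sum_zchar (b : 'Z_p) : \sum_(a : 'Z_p) zchar (a * b) = p%:R * (b == 0)%:R.
Proof.
have [->|b0] := eqVneq b 0.
  under eq_bigr do rewrite mulr0 zchar0.
  by rewrite sumr_const card_ord Zp_cast ?prime_gt1// mulr1.
rewrite mulr0; set S := (LHS).
have SE : S = zchar b * S.
  rewrite mulr_sumr /S (reindex_inj (addIr 1))/=; apply: eq_bigr => a _.
  by rewrite mulrDl mul1r addrC zcharD.
have b1 : 1 - zchar b != 0.
  by rewrite subr_eq0 eq_sym; apply: contra_neq b0 => /zchar_eq1.
by apply: (mulfI b1); rewrite mulr0 mulrBl mul1r -SE subrr.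
Qed.

(** The character $\prod_j r_{b+j}^{a_j}$ as a plain function; [wdual] is its counterpart in the
    dual group. *)
Definition wchar (b : int) (K : nat) (a : 'I_K -> 'Z_p) x : R[i] :=
  \prod_(j < K) zchar (a j * digit x (b + j%:Z)).

Lemma wcharD (b : int) K (a : 'I_K -> 'Z_p) x y : wchar b a (x + y) = wchar b a x * wchar b a y.
Proof. by rewrite -big_split/=; apply: eq_bigr => j _; rewrite mulrDr zcharD. Qed.

Lemma norm_wchar (b : int) K (a : 'I_K -> 'Z_p) x : `|wchar b a x| = 1.
Proof. by rewrite normr_prod big1// => j _; exact: norm_zchar. Qed.

Lemma wcharN (b : int) K (a : 'I_K -> 'Z_p) x : wchar b a (- x) = (wchar b a x)^*.
Proof.
rewrite rmorph_prod; apply: eq_bigr => j _.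
by rewrite digitN mulrN zcharN.
Qed.

Lemma wchar_Gsub (b : int) K (a : 'I_K -> 'Z_p) x : Gsub (b + K%:Z) x -> wchar b a x = 1.
Proof.
move=> Gx; rewrite /wchar big1// => j _; rewrite Gx ?mulr0 ?zchar0//.
by rewrite ltrD2l ltz_nat.
Qed.

Lemma wchar_loc_const (b : int) K (a : 'I_K -> 'Z_p) : loc_const (b + K%:Z) (wchar b a).
Proof.
by move=> x y xy; rewrite -(subrK x y) wcharD wchar_Gsub// mul1r.
Qed.

(** The sum over words factors into one complete character sum per place. On [Gsub b] it is a
    multiple of the indicator of [Gsub (b + K)]. *)
Lemma sum_wchar (b : int) K x : \sum_(a : {ffun 'I_K -> 'Z_p}) wchar b a x =
  p%:R ^+ K * [forall j : 'I_K, digit x (b + j%:Z) == 0]%:R.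
Proof.
rewrite -(bigA_distr_bigA (fun (j : 'I_K) a => zchar (a * digit x (b + j%:Z)))).
under eq_bigr do rewrite sum_zchar.
rewrite big_split/= prodr_const card_ord; congr (_ * _).
have [/forallP xj|] := boolP [forall j : 'I_K, digit x (b + j%:Z) == 0].
  by rewrite big1// => j _; rewrite (eqP (xj j)) eqxx.
by move=> /forallPn[j xj]; rewrite (bigD1 j)//= (negbTE xj) mul0r.
Qed.

End characters.

Section character_integral.
Context {R : realType} {p : nat} (p_prime : prime p).
Context (mu : {measure set (borel (vilenkin p)) -> \bar R}) (mu_haar : haar_vilenkin mu).
Implicit Types (n m k : int) (x y h : vilenkin p) (f : vilenkin p -> R[i]).

Lemma loc_const_L2 n m f : loc_const n f -> (forall x, `|f x| = 1) ->
  L2 mu (fun x => (x \in Gsub m)%:R * f x).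
Proof.
move=> lf f1; apply/L2P; split.
  apply: (@loc_const_cmeas _ _ (Order.max n m)) => x y xy.
  congr (_ * _); last by apply/lf/(vball_le _ xy); rewrite le_max lexx.
  have xy' : Gsub m (y - x) by apply: vball_le xy; rewrite le_max lexx orbT.
  congr ((_ : bool)%:R); apply/idP/idP => /set_mem H; apply/mem_set.
    by rewrite -[x](subrK y) -opprB; apply: GsubD => //; exact: GsubN.
  by rewrite -(subrK x y); exact: GsubD.
rewrite [ltLHS](_ : _ = mu (Gsub m)); first by rewrite haar_Gsub// ltey.
transitivity (\int[mu]_(x in setT) (\1_(Gsub m : set (borel (vilenkin p))) x)%:E)%E.
  apply: eq_integral => x _; congr EFin.
  rewrite indicE sqnM (eqP (_ : sqn (f x) == 1)) ?sqn_eq1 ?f1// mulr1.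
  by case: (x \in _); rewrite /sqn/= ?expr0n ?expr1n ?addr0.
rewrite integral_indic ?setIT//; exact: measurable_Gsub.
Qed.

Lemma loc_const_cintegrable n m f : loc_const n f -> (forall x, `|f x| = 1) ->
  cintegrable (T := borel (vilenkin p)) mu (Gsub m) f.
Proof.
move=> lf f1; have := L2_cintegrable (measurable_Gsub m) _ (loc_const_L2 m lf f1).
rewrite haar_Gsub// ltey => /(_ isT) [ir ii].
split; [apply: eq_integrable ir|apply: eq_integrable ii] => //;
  by [exact: measurable_Gsub|move=> x xG; rewrite xG mul1r].
Qed.

Lemma cintegral_cst_vball n x c :
  cintegral (T := borel (vilenkin p)) mu (vball n x) (fun=> c) = c * (p%:R ^ (- n))%:C.
Proof.
rewrite /cintegral !Rintegral_cst ?haar_vball//; try exact: measurable_vball.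
by case: c => a b /=; congr Complex; rewrite ?mulr0 ?subr0 ?add0r.
Qed.

Lemma cintegral_char n m f : loc_const m f -> (forall x y, f (x + y) = f x * f y) ->
  (forall x, `|f x| = 1) ->
  cintegral (T := borel (vilenkin p)) mu (Gsub n) f =
  (if `[< forall x, Gsub n x -> f x = 1 >] then p%:R ^ (- n) else 0)%:C.
Proof.
move=> lf fD f1.
have mf := loc_const_cmeas lf.
case: asboolP => [f1G|].
  by rewrite (@eq_cintegral _ _ _ _ _ _ (fun=> 1))// -vball0 cintegral_cst_vball mul1r.
(* Translation by [h] preserves [Gsub n] and multiplies the integral by [f (- h)], which is not 1;
   hence the integral is 0. *)
move=> /existsNP[h /not_implyP[Gh fh]].
have f0 x : f x != 0 by rewrite -normr_eq0 f1 oner_eq0.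
have f00 : f 0 = 1 by apply: (mulfI (f0 0)); rewrite mulr1 -fD addr0.
have E : cintegral (T := borel (vilenkin p)) mu (Gsub n) f =
    f (- h) * cintegral (T := borel (vilenkin p)) mu (Gsub n) f.
  rewrite -{1}(haar_shift_cintegral mu_haar h (measurable_Gsub n) mf).
  rewrite -{1}vball0 preimage_shift_vball add0r.
  have -> : vball n h = Gsub n.
    by rewrite -vball0; apply/esym/vball_eq; rewrite /vball/= subr0.
  rewrite -cintegralZ//; last 2 first.
  - exact: measurable_Gsub.
  - exact: loc_const_cintegrable lf f1.
  by apply: eq_cintegral => x _; rewrite fD mulrC.
have fh1 : 1 - f (- h) != 0.
  rewrite subr_eq0; apply: contra_notN fh => /eqP fh.
  by rewrite -[LHS]mulr1 fh -fD subrr f00.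
by apply: (mulfI fh1); rewrite mulr0 mulrBl mul1r -E subrr.
Qed.

End character_integral.

Section indicators.
Context d (T : measurableType d) (R : realType) (mu : {measure set T -> \bar R}).
Implicit Types (A D : set T).

Definition cindic A : T -> R[i] := fun x => (x \in A)%:R.

Lemma sqn_bool (b : bool) : sqn (b%:R : R[i]) = b%:R.
Proof. by case: b; rewrite /sqn/= ?expr0n ?expr1n ?addr0. Qed.

Lemma cmeas_indic A : measurable A -> cmeas (cindic A).
Proof.
move=> mA; split.
- rewrite (_ : (fun _ => _) = \1_A :> (T -> R)); first exact: measurable_indic.
  by apply/boolp.funext => x; rewrite indicE /cindic; case: (x \in A).
- rewrite (_ : (fun _ => _) = cst 0); first exact: measurable_cst.
  by apply/boolp.funext => x; rewrite /cindic; case: (x \in A).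
Qed.

Lemma nsq_indic A : measurable A -> nsq mu setT (cindic A) = mu A.
Proof.
move=> mA; transitivity (\int[mu]_(x in setT) (\1_A x)%:E)%E.
  by apply: eq_integral => x _; rewrite /cindic sqn_bool indicE.
by rewrite integral_indic ?setIT.
Qed.

Lemma L2_indic A : measurable A -> (mu A < +oo)%E -> L2 mu (cindic A).
Proof.
by move=> mA fA; apply/L2P; split; [exact: cmeas_indic|rewrite nsq_indic].
Qed.

End indicators.

Lemma cvge0_lt (R : realType) (u : (\bar R)^nat) (e : R) : u @ \oo --> 0%E -> 0 < e ->
  exists n, forall m, (n <= m)%N -> (u m < e%:E)%E.
Proof.
move=> u0 e0; have : nbhs (0%E : \bar R) [set y | (y < e%:E)%E].
  by apply: open_nbhs_nbhs; split; [exact: open_ereal_lt_ereal|rewrite /= lte_fin].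
by move=> /u0 [n _ ne]; exists n => m nm; exact: ne.
Qed.

(** * Density of the indicators of balls *)

Section vball_density.
Context {R : realType} {p : nat} (p_prime : prime p).
Context (mu : {measure set (borel (vilenkin p)) -> \bar R}) (mu_haar : haar_vilenkin mu).
Implicit Types (k : int) (x y : vilenkin p) (f : vilenkin p -> R[i]).
Implicit Type E : set (borel (vilenkin p)).

Definition vball_indics : set (vilenkin p -> R[i]) :=
  [set f | exists n x, f = cindic R (vball n x : set (borel (vilenkin p)))].

Let C := L2closure mu (lspan vball_indics).

Lemma vball_indics_L2 : vball_indics `<=` L2 mu.
Proof.
move=> _ [n [x ->]]; apply: L2_indic; first exact: measurable_vball.
by rewrite haar_vball// ltey.
Qed.

Let L2C := vball_indics_L2.

Lemma measurable_setIG E k : measurable E ->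
  measurable (E `&` Gsub k : set (borel (vilenkin p))).
Proof. by move=> mE; apply: measurableI => //; exact: measurable_Gsub. Qed.

Lemma haar_setIG_lty E k : measurable E -> (mu (E `&` Gsub k) < +oo)%E.
Proof.
move=> mE; apply: (@le_lt_trans _ _ (mu (Gsub k))); last by rewrite haar_Gsub// ltey.
apply: le_measure; rewrite ?inE; [exact: measurable_setIG|exact: measurable_Gsub|].
exact: subIsetr.
Qed.

(** Dynkin induction over the balls; the intersection with [Gsub k] keeps all sets of finite
    measure, so complements and countable unions stay in $L_2$. *)
Lemma indic_closure E k : measurable E -> C (cindic R (E `&` Gsub k)).
Proof.
have [C0 CD CZ] : [/\ C (fun=> 0), forall f g, C f -> C g -> C (f \+ g) &
    forall a f, C f -> C (fun x => a * f x)].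
  by split; [exact: closed_span0|move=> f g; exact: closed_spanD|move=> a f; exact: closed_spanZ].
have CB A : vballs A -> C (cindic R (A : set (borel (vilenkin p)))).
  move=> [->|[n [x ->]]]; last by apply: sub_closed_span => //; exists n, x.
  rewrite (_ : cindic _ _ = fun=> 0)//.
  by apply/boolp.funext => x; rewrite /cindic in_set0.
have VG A : vballs A -> vballs (A `&` Gsub k).
  by move=> VA; apply: vballs_setI => //; right; exists k, 0; rewrite vball0.
have CGk : C (cindic R (Gsub k : set (borel (vilenkin p)))).
  by apply: CB; right; exists k, 0; rewrite vball0.
move=> mE; have := mE; rewrite vballs_generate.
move: E {mE}; apply: (@dynkin_induction _ (borel (vilenkin p)) vballs
  (fun E => C (cindic R (E `&` Gsub k)))).
- exact: vballs_generate.
- exact: vballs_setI.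
- by rewrite setTI.
- by move=> A /VG /CB.
- move=> S mS CS.
  rewrite (_ : cindic _ _ = cindic R (Gsub k : set (borel (vilenkin p))) \+
      (fun x => -1 * cindic R (S `&` Gsub k) x)).
    by apply: CD => //; exact: CZ.
  apply/boolp.funext => x; rewrite /cindic/= !in_setI in_setC.
  by case: (x \in S); case: (x \in Gsub k); rewrite /= ?mulr0 ?mulr1 ?addr0 ?subrr.
- move=> F mF tF CF.
  pose U n := \big[setU/set0]_(i < n) F i.
  have mU n : measurable (U n) by apply: bigsetU_measurable => i _; exact: mF.
  have UE n x : U n x <-> exists2 i, (i < n)%N & F i x.
    rewrite /U -bigcup_mkord; split=> [[i /= ? ?]|[i ? ?]]; by exists i.
  have mUF : measurable (\bigcup_k F k) by exact: bigcup_measurable.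
  (* The remainders decrease to the empty set within finite measure. Their measures, which are the
     squared $L_2$ errors of the partial unions, therefore tend to 0. *)
  pose W n : set (borel (vilenkin p)) := (\bigcup_k F k `\` U n) `&` Gsub k.
  have mW n : measurable (W n) by apply: measurable_setIG; exact: measurableD.
  have CU n : C (cindic R (U n `&` Gsub k)).
    elim: n => [|n IH].
      rewrite /U big_ord0 set0I (_ : cindic _ _ = fun=> 0)//.
      by apply/boolp.funext => x; rewrite /cindic in_set0.
    rewrite (_ : cindic _ _ = cindic R (U n `&` Gsub k) \+ cindic R (F n `&` Gsub k)).
      exact: CD.
    apply/boolp.funext => x; rewrite /cindic/= /U big_ord_recr/= -/(U n).
    rewrite !in_setI in_setU.
    have : ~~ ((x \in U n) && (x \in F n)).
      apply/negP => /andP[/set_mem/UE[i ni Fi] /set_mem Fn].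
      have /trivIsetP/(_ i n I I) := tF; rewrite (ltn_eqF ni) => /(_ isT).
      by move=> FF; have : set0 x by rewrite -FF.
    by case: (x \in U n); case: (x \in F n) => //=; case: (x \in Gsub k);
      rewrite /= ?addr0 ?add0r.
    rewrite /C; apply: (@closed_span_approx _ _ _ mu vball_indics L2C (cindic R (\bigcup_k F k `&` Gsub k))).
    by apply: L2_indic; [exact: measurable_setIG|exact: haar_setIG_lty].
  move=> e e0.
  have W0 : mu \o W @ \oo --> 0%E.
    rewrite -(@measure0 _ _ _ mu).
    have -> : set0 = \bigcap_n W n.
      apply/esym; rewrite -subset0 => x Wx.
      have [[[i _ Fi] _] _] := Wx 0%N I.
      by have [[_ /UE []]] := Wx i.+1 I; exists i.
    apply: nonincreasing_cvg_mu => //.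
    - by apply: haar_setIG_lty; exact: measurableD.
    - exact: bigcapT_measurable.
    - move=> i j ij; apply/subsetPset => x [[Ux Ujx] Gx]; split=> //; split=> //.
      by move=> /UE[l li Fl]; apply: Ujx; apply/UE; exists l => //; exact: leq_trans ij.
  have [n /(_ n (leqnn n)) We] := cvge0_lt W0 e0; exists (cindic R (U n `&` Gsub k)); first exact: CU.
  rewrite (_ : _ \- _ = cindic R (W n)) ?nsq_indic//.
  apply/boolp.funext => x; rewrite /cindic/= /W; do 3 rewrite in_setI; rewrite in_setD.
  have : (x \in U n) ==> (x \in \bigcup_k F k).
    by apply/implyP => /set_mem/UE[i _ Fi]; apply/mem_set; exists i.
  by case: (x \in U n); case: (x \in \bigcup_k _) => //=; case: (x \in Gsub k);
    rewrite /= ?subrr ?subr0.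
Qed.

Import HBNNSimple.

Lemma ge0_closure (h : borel (vilenkin p) -> R) : measurable_fun setT h ->
  (forall x, 0 <= h x) -> L2 mu (fun x => (h x)%:C) -> C (fun x => (h x)%:C).
Proof.
move=> mh h0 Lh.
have mhE : measurable_fun setT (EFin \o h) by exact/measurable_EFinP.
have [g [ndg cg]] := approximation measurableT mhE (fun t _ => h0 t).
have cg' x : (g^~ x) @ \oo --> h x by have /fine_cvgP[] := cg x I.
have gh (n : nat) x : g n x <= h x.
  rewrite -(cvg_lim _ (cg' x))//; apply: nondecreasing_cvgn_le; last by apply/cvg_ex; exists (h x).
  by move=> i j /ndg /lefP.
(* The simple minorants are cut off to [Gsub (- n)] so that [indic_closure] covers their level sets.
   Each point lies in all late [Gsub (- n)], so they still converge pointwise to [h], and $h^2$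
   dominates the squared errors. *)
pose s (n : nat) : vilenkin p -> R[i] :=
  fun x => (g n x)%:C * cindic R (Gsub (- n%:Z) : set (borel (vilenkin p))) x.
have Cs n : C (s n).
  have -> : s n = fun x => \sum_(y <- finmap.enum_fset (fset_set (range (g n))))
      y%:C * cindic R (g n @^-1` [set y] `&` Gsub (- n%:Z)) x.
    apply/boolp.funext => x; rewrite /s fimfunE fsbig_finite// rmorph_sum mulr_suml.
    apply: eq_bigr => y _; rewrite rmorphM/= -mulrA; congr (_ * _).
    rewrite /cindic in_setI indicE.
    by case: (x \in Gsub _); rewrite ?andbT ?andbF ?mulr1 ?mulr0//; case: (x \in _).
  rewrite /C; apply: (@closed_span_lspan _ _ _ mu vball_indics L2C); apply: lspan_sum => i.
  apply: lspanZ; apply: sub_lspan; apply: indic_closure.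
  exact: measurable_funPTI.
rewrite /C; apply: (@closed_span_approx _ _ _ mu vball_indics L2C) => // e e0.
have Ls n : L2 mu (s n) by apply: L2closure_L2 (Cs n).
have mLs n : cmeas (T := borel (vilenkin p)) ((fun x => (h x)%:C) \- s n).
  by apply: cmeasB; [exact: (L2_cmeas Lh)|exact: (L2_cmeas (Ls n))].
pose f_ n (x : borel (vilenkin p)) := (sqn ((h x)%:C - s n x))%:E.
have sE n x : sqn ((h x)%:C - s n x) = (h x - (if x \in Gsub (- n%:Z) then g n x else 0)) ^+ 2.
  by rewrite /s /cindic; case: (x \in _); rewrite ?mulr1 ?mulr0 /sqn/= ?subr0 ?expr0n/= ?addr0.
have cv : (fun n : nat => nsq mu setT ((fun x => (h x)%:C) \- s n)) @ \oo --> (0%E : \bar R).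
  rewrite -(@integral0 _ (borel (vilenkin p)) R mu setT).
  have [] // := @dominated_convergence _ (borel (vilenkin p)) R mu setT measurableT f_ (cst 0%E)
    (fun x => (h x ^+ 2)%:E).
  - by move=> n; apply: measurable_sqnE (mLs n) measurableT.
  - apply: aeW => x _; apply: cvg_EFin; first by apply: nearW.
    have c0 : (fun n => (h x - g n x) ^+ 2) @ \oo --> (0 : R).
      have -> : 0 = (h x - h x) ^+ 2 by rewrite subrr expr0n.
      by apply: cvgM; apply: cvgB => //; exact: cvg_cst.
    apply: cvg_trans c0; apply: near_eq_cvg.
    have [N xN] := Gsub_ex x; exists N => // n /= Nn.
    rewrite /f_ /= sE mem_set//; apply: Gsub_le xN.
    by rewrite lerN2 lez_nat.
  - apply/integrableP; split; first by apply/measurable_EFinP; exact: measurable_funX.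
    apply: le_lt_trans (L2_nsq Lh); rewrite le_eqVlt; apply/orP; left; apply/eqP.
    apply: eq_integral => x _.
    by rewrite gee0_abs ?lee_fin ?sqr_ge0// /sqn/= expr0n addr0.
  - apply: aeW => x n _; rewrite /f_ gee0_abs ?lee_fin ?sqn_ge0// sE.
    have gx0 : 0 <= g n x by exact: fun_ge0.
    by have := gh n x; have := h0 x; case: ifP => _; nra.
have [n /(_ n (leqnn n)) ne] := cvge0_lt cv e0.
by exists (s n); [exact: Cs|exact: ne].
Qed.

(** The positive and negative parts of the real and imaginary parts have squares bounded by
    [sqn (f x)], so [ge0_closure] applies to each. *)
Lemma vball_dense : L2 mu `<=` C.
Proof.
move=> f Lf; have [mr mi] := L2_cmeas Lf.
have C0 (h : borel (vilenkin p) -> R) : measurable_fun setT h -> (forall x, 0 <= h x) ->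
    (forall x, (h x) ^+ 2 <= sqn (f x)) -> C (fun x => (h x)%:C).
  move=> mh h0 hf; apply: ge0_closure => //.
  have mh' : cmeas (T := borel (vilenkin p)) (fun x => (h x)%:C) by split=> //; exact: measurable_cst.
  apply/L2P; split=> //; apply: le_lt_trans (L2_nsq Lf).
  apply: ge0_le_integral => //.
  - by move=> x _; rewrite lee_fin sqn_ge0.
  - exact: measurable_sqnE.
  - by apply: measurable_sqnE => //; exact: L2_cmeas.
  - by move=> x _; rewrite lee_fin; apply: le_trans (hf x); rewrite /sqn/= expr0n addr0.
have CR (h : borel (vilenkin p) -> R) : measurable_fun setT h ->
    (forall x, (h x) ^+ 2 <= sqn (f x)) -> C (fun x => (h x)%:C).
  move=> mh hf.
  rewrite (_ : (fun _ => _) = (fun x => (Num.max (h x) 0)%:C) \+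
      (fun x => -1 * (Num.max (- h x) 0)%:C)).
    apply: closed_spanD => //; last apply: closed_spanZ => //; apply: C0.
    - by apply: measurable_maxr => //; exact: measurable_cst.
    - by move=> x; rewrite le_max lexx orbT.
    - by move=> x; apply: le_trans (hf x); case: (ltP (h x) 0) => _; rewrite ?expr0n ?sqr_ge0.
    - by apply: measurable_maxr; [exact: measurable_funN|exact: measurable_cst].
    - by move=> x; rewrite le_max lexx orbT.
    - by move=> x; apply: le_trans (hf x); case: (ltP (- h x) 0) => _; rewrite ?sqrrN ?expr0n ?sqr_ge0.
  apply/boolp.funext => x /=; rewrite mulN1r -rmorphB/=; congr (_%:C).
  case: (ltP (h x) 0) => ?; case: (ltP (- h x) 0) => ?; lra.
rewrite (_ : f = (fun x => (complex.Re (f x))%:C) \+ (fun x => 'i%C * (complex.Im (f x))%:C)).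
  apply: closed_spanD => //; last apply: closed_spanZ => //; apply: CR => // x.
    by rewrite lerDl sqr_ge0.
  by rewrite lerDr sqr_ge0.
by apply/boolp.funext => x /=; rewrite -complexE.
Qed.

(** On each [Gsub k] the function is integrable, and a Dynkin induction carries the vanishing from
    balls to all measurable subsets. It is therefore zero almost everywhere on sets that exhaust the
    group. *)
Lemma vball_integral0_ae f : L2 mu f ->
  (forall n x, cintegral (T := borel (vilenkin p)) mu (vball n x) f = 0) ->
  {ae mu, forall x, f x = 0}.
Proof.
move=> Lf f0; have [mr mi] := L2_cmeas Lf.
have key (h : borel (vilenkin p) -> R) : measurable_fun setT h ->
    (forall k, mu.-integrable (Gsub k) (EFin \o h)) ->
    (forall n x, \int[mu]_(y in vball n x) h y = 0) -> {ae mu, forall x, h x = 0}.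
  move=> mh ih h0.
  have iE k E : measurable E -> mu.-integrable (E `&` Gsub k) (EFin \o h).
    move=> mE; apply: integrableS (ih k) => //; [exact: measurable_Gsub|exact: measurable_setIG].
  have hB k A : vballs A -> (\int[mu]_(y in (A `&` Gsub k : set (borel (vilenkin p)))) (h y)%:E = 0)%E.
    move=> VA; have : vballs (A `&` Gsub k).
      by apply: vballs_setI => //; right; exists k, 0; rewrite vball0.
    have mA : measurable (A : set (borel (vilenkin p))).
      by move: VA => [->|[n [x ->]]] //; exact: measurable_vball.
    have fi := integrable_fin_num (measurable_setIG k mA) (iE k _ mA).
    move=> [A0|[n [x Ax]]]; first by rewrite A0 integral_set0.
    by rewrite -[LHS]fineK// Ax; congr EFin; exact: h0.
  have hE k E : measurable E -> (\int[mu]_(y in E `&` Gsub k) (h y)%:E = 0)%E.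
    move=> mE; have := mE; rewrite vballs_generate.
    move: E {mE}; apply: (@dynkin_induction _ (borel (vilenkin p)) vballs
      (fun E => \int[mu]_(y in E `&` Gsub k) (h y)%:E = 0)%E).
    - exact: vballs_generate.
    - exact: vballs_setI.
    - by have := hB k (Gsub k); rewrite setIid setTI; apply; right; exists k, 0; rewrite vball0.
    - by move=> A; exact: hB.
    - move=> S mS hS.
      have GE : Gsub k = (S `&` Gsub k) `|` (~` S `&` Gsub k).
        by rewrite -setIUl setUv setTI.
      have := hB k (Gsub k); rewrite setIid => /(_ _) H.
      have {}H : (\int[mu]_(y in Gsub k) (h y)%:E = 0)%E.
        by apply: H; right; exists k, 0; rewrite vball0.
      rewrite GE integral_setU/= in H; last 4 first.
      - exact: measurable_setIG.
      - by apply: measurable_setIG; exact: measurableC.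
      - by apply/measurable_EFinP; exact: measurable_funS mh.
      - apply/disj_setPS => x [[Sx _] [nSx _]]; exact: nSx.
      by rewrite hS add0e in H.
    - move=> F mF tF hF; rewrite setI_bigcupl integral_bigcup.
      + by apply: eseries0 => i _ _; rewrite hF.
      + by apply: trivIset_setIr.
      + by move=> i; exact: measurable_setIG.
      + by rewrite -setI_bigcupl; apply: iE; exact: bigcup_measurable.
  have H (k : nat) : {ae mu, forall x, Gsub (- k%:Z) x -> h x = 0}.
    have : ae_eq mu (Gsub (- k%:Z)) (EFin \o h) (fun=> 0%E).
      apply: integral_ae_eq => //; first exact: measurable_Gsub.
      by move=> E EG mE; rewrite integral0 -(hE (- k%:Z) _ mE) setIidl.
    by apply: filterS => x hx /hx [].
  move/ae_foralln : H; apply: filterS => x hx; have [k kx] := Gsub_ex x; exact: hx kx.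
have iC k : cintegrable (T := borel (vilenkin p)) mu (Gsub k) f.
  apply: L2_cintegrable => //; first exact: measurable_Gsub.
  by rewrite haar_Gsub// ltey.
have re0 : {ae mu, forall x, complex.Re (f x) = 0}.
  apply: key => //; first by move=> k; have [] := iC k.
  by move=> n x; have [] := f0 n x.
have im0 : {ae mu, forall x, complex.Im (f x) = 0}.
  apply: key => //; first by move=> k; have [] := iC k.
  by move=> n x; have [] := f0 n x.
apply: (@filterS2 _ _ (ae_filter_ringOfSetsType mu) _ _ _ _ re0 im0) => x.
by case: (f x) => a b /= -> ->.
Qed.

End vball_density.

(** * Windows of a valid tree *)

Section tree_windows.
Context {p : nat} (T : tree p) (N : nat) (N_gt0 : (0 < N)%N).
Hypothesis T_valid : N_valid T N.
Notation e := (@tree_edge p T).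
Notation lab := (@tree_label p T).
Notation root := (tree_root T).
Implicit Types (q r : seq (vertex T)) (w a : nat -> 'Z_p).

(* The coset of the annihilator of G_(-N) with exponents w 0, ..., w N lies in
   [Etilde]. *)
Definition good_window w := exists q, [/\ sorted e q, (N < size q)%N,
  take N (map lab q) = nseq N 0 &
  exists2 k, (k < size q)%N & forall j, (j <= N)%N -> w j = nth 0 (rev (map lab q)) (k + j)].

Lemma walk_inj q r : path e root q -> path e root r -> last root q = last root r -> q = r.
Proof.
move=> pq pr qr; have [q0 [_ uq]] := treeP (last root r).
by rewrite -(uq q)// -(uq r).
Qed.

Lemma walk_ex v : exists2 q, path e root q & last root q = v.
Proof. by have [q [[pq lq] _]] := treeP v; exists q. Qed.

(** Two parents would extend to two different walks from the root to the same vertex. *)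
Lemma parent_inj (u v x : vertex T) : e u x -> e v x -> u = v.
Proof.
have [qu pu <-] := walk_ex u; have [qv pv <-] := walk_ex v => ux vx.
have : rcons qu x = rcons qv x.
  by apply: walk_inj; rewrite ?rcons_path ?pu ?pv ?last_rcons.
by move=> /rcons_inj [->].
Qed.

Lemma root_no_parent u : ~~ e u root.
Proof.
apply/negP; have [qu pu <-] := walk_ex u => ur.
have : rcons qu root = [::] by apply: walk_inj; rewrite ?rcons_path ?pu ?last_rcons.
by case: qu {pu ur}.
Qed.

Lemma label_path_inj q r : sorted e q -> sorted e r -> size q = N ->
  map lab q = map lab r -> q = r.
Proof.
move=> sq sr qN qr; have sz : size (map lab q) == N by rewrite size_map qN.
have [q0 [_ uq]] := T_valid.2 (Tuple sz).
by rewrite -(uq q)// -(uq r).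
Qed.

Lemma walk_level_label q i : path e root q -> (i < N)%N -> (i <= size q)%N ->
  lab (nth root (root :: q) i) = 0.
Proof.
move=> pq iN iq; have := T_valid.1 (take i q) (take_path i pq).
rewrite size_takel// => /(_ iN).
by case: i iq {iN} => [|i] iq; rewrite ?take0// (last_nth root) size_takel//= nth_take.
Qed.

(** The path spelling [t] backwards is prolonged upwards by the walk from the root to its first
    vertex. The reversal puts [t] first when labels are read towards the root. *)
Lemma walk_extends (t : {ffun 'I_N -> 'Z_p}) : exists q s,
  path e root q /\ map lab (root :: q) = s ++ rev [tuple t i | i < N].
Proof.
have [r [[sr lr] _]] := T_valid.2 [tuple of rev [tuple t i | i < N]].
case: r => [|v r] in sr lr.
  move/(congr1 size): lr; rewrite /= size_rev size_tuple ?card_ord => NE.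
  by exfalso; have := N_gt0; rewrite -NE.
have [q pq lq] := walk_ex v; exists (q ++ r), (map lab (belast root q)); split.
  by rewrite cat_path pq lq.
by rewrite -lr -map_cat -cat_cons lastI lq cat_rcons.
Qed.

Lemma walk_long : exists2 q, path e root q & (N <= size q)%N.
Proof.
(* A walk with fewer than [N] edges ends at a label 0; the walk for the word of ones ends at a label
   1. *)
have [q [s [pq lq]]] := walk_extends [ffun=> 1]; exists q => //.
rewrite leqNgt; apply/negP => qN; have := T_valid.1 q pq qN.
have <- : last 0 (map lab (root :: q)) = lab (last root q) by rewrite /= last_map.
have last_rev (x : 'Z_p) u : last x (rev u) = head x u.
  by case: u => // y u; rewrite rev_cons last_rcons.
rewrite lq last_cat last_rev -nth0 (nth_mktuple _ _ (Ordinal N_gt0)) ffunE.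
by move/eqP; rewrite oner_eq0.
Qed.

Lemma walk_take_label q : path e root q -> (N <= (size q).+1)%N ->
  take N (map lab (root :: q)) = nseq N 0.
Proof.
move=> pq qN; apply: (@eq_from_nth _ 0) => [|i].
  by rewrite size_takel ?size_nseq//= size_map.
rewrite size_takel/= ?size_map// => iN.
rewrite nth_take// nth_nseq iN -[X in nth _ X _]/(map lab (root :: q)) (nth_map root).
  by rewrite walk_level_label// -ltnS (leq_trans iN).
by rewrite (leq_trans iN).
Qed.

(** The chain at the root spells [N] zeros, and no other path of [N] vertices spells the same
    word. *)
Lemma zero_path_root q : sorted e q -> (N <= size q)%N ->
  take N (map lab q) = nseq N 0 -> exists2 q', path e root q' & q = root :: q'.
Proof.
move=> sq qN lq; have [r pr rN] := walk_long.
have E : take N q = take N (root :: r).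
  apply: label_path_inj.
  - exact: take_sorted.
  - exact: take_sorted.
  - by rewrite size_takel.
  - by rewrite !map_take lq walk_take_label// (leq_trans rN).
case: q => [|v q] in sq qN lq E *.
  by move: qN; rewrite leqNgt N_gt0.
move: E; rewrite -(prednK N_gt0)/= => -[vr _]; rewrite vr in sq *.
by exists q.
Qed.

Lemma good_window0 w : (forall j, (j <= N)%N -> w j = 0) -> good_window w.
Proof.
move=> w0; have [q pq qN] := walk_long; exists (root :: q).
split=> //; first by apply: walk_take_label => //; exact: leqW.
(* In the reversed list, index [size q] is the label of the root; all later entries are the default
   0. *)
exists (size q) => //= j jN; rewrite w0//.
case: j jN => [|j] jN; last by rewrite nth_default// size_rev/= size_map addnS leq_addr.
rewrite addn0 nth_rev/= ?size_map// subnn/=.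
by have := walk_level_label (i := 0) pq N_gt0 (leq0n _).
Qed.

(** A window that overruns the start of the path sees only its [N] initial zeros and default zeros.
    Any other window lists the labels of [N + 1] consecutive vertices against the edges. *)
Lemma good_window_path w : good_window w -> (forall j, (j <= N)%N -> w j = 0) \/
  exists r, [/\ sorted e r, size r = N.+1 &
    forall j, (j <= N)%N -> lab (nth root r j) = w (N - j)%N].
Proof.
move=> [q [sq qN lq [k kq wq]]].
have [kN|kN] := leqP (size q) (k + N); [left|right].
  move=> j jN; rewrite wq//.
  have [kjq|kjq] := leqP (size q) (k + j); first by rewrite nth_default// size_rev size_map.
  rewrite nth_rev size_map//; set i := (_ - _)%N.
  have iN : (i < N)%N by rewrite /i; lia.
  have := congr1 (nth 0 ^~ i) lq; rewrite nth_take// nth_nseq iN.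
  by move=> ->.
exists (take N.+1 (drop (size q - (k + N).+1) q)); split.
- by apply: take_sorted; exact: drop_sorted.
- by rewrite size_takel// size_drop; lia.
- move=> j jN; rewrite nth_take// nth_drop wq; last by lia.
  rewrite nth_rev size_map; last by lia.
  rewrite (nth_map root); last by lia.
  by congr (lab (nth _ _ _)); lia.
Qed.

(** The first [N] entries of a window are the labels of its [N] lower vertices and so identify these
    vertices; the last entry is the label of their unique parent. *)
Lemma good_window_det w w' : good_window w -> good_window w' ->
  (forall j, (j < N)%N -> w j = w' j) -> w N = w' N.
Proof.
(* Mixed case: without its first vertex the genuine path spells [N] zeros, so it begins at the root,
   and the removed vertex would be a parent of the root. *)
have absurd v v' : (forall j, (j <= N)%N -> v j = 0) ->
    (exists r, [/\ sorted e r, size r = N.+1 &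
    forall j, (j <= N)%N -> lab (nth root r j) = v' (N - j)%N]) ->
    (forall j, (j < N)%N -> v j = v' j) -> False.
  move=> v0 [[|x r] [sr rN lr]]// vv'.
  have rN' : size r = N by case: rN.
  have lr0 : map lab r = nseq N 0.
    apply: (@eq_from_nth _ 0) => [|i]; rewrite size_map ?size_nseq// rN' => iN.
    rewrite (nth_map root) ?rN'// nth_nseq iN.
    have := lr i.+1 iN; rewrite /= => ->.
    by rewrite -vv' ?v0//; lia.
  have [q pq rq] : exists2 q', path e root q' & r = root :: q'.
    apply: zero_path_root.
    - exact: path_sorted sr.
    - by rewrite rN'.
    - by rewrite take_oversize// size_map rN'.
  by move: sr; rewrite rq /= (negbTE (root_no_parent x)).
move=> gw gw' ww'.
have [w0|[r [sr rN lr]]] := good_window_path gw; have [w'0|[r' [sr' rN' lr']]] := good_window_path gw'.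
- by rewrite w0 ?w'0.
- by have [] := absurd w w' w0 (ex_intro _ r' (And3 sr' rN' lr')) ww'.
- have [] := absurd w' w w'0 (ex_intro _ r (And3 sr rN lr)).
  by move=> j jN; rewrite ww'.
- case: r => [//|x r] in sr rN lr *; case: r' => [//|x' r'] in sr' rN' lr' *.
  have rr' : r = r'.
    apply: label_path_inj; [exact: path_sorted sr|exact: path_sorted sr'|by case: rN|].
    apply: (@eq_from_nth _ 0) => [|i]; rewrite !size_map; first by case: rN rN' => -> [->].
    move=> ir; have iN : (i < N)%N by case: rN => <-.
    rewrite !(nth_map root)//; last by case: rN' => ->.
    have := lr i.+1 iN; have := lr' i.+1 iN; rewrite /= => -> ->.
    by apply: ww'; lia.
  have := lr 0%N (leq0n _); have := lr' 0%N (leq0n _); rewrite /= subn0 => <- <-.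
  congr lab; move: sr sr'; rewrite -rr'; case: r rN {lr rr'} => [[N0]|y r _].
    by have := N_gt0; rewrite -N0.
  by rewrite /= => /andP[xy _] /andP[x'y _]; exact: parent_inj xy x'y.
Qed.

Lemma tree_extension (H : nat) : is_height T H -> exists A : {ffun 'I_N -> 'Z_p} -> nat -> 'Z_p,
  [/\ forall t (j : 'I_N), A t j = t j,
      forall t j, (H <= j)%N -> A t j = 0,
      forall t i, good_window (fun j => A t (i + j)%N) &
      forall a, (forall i, good_window (fun j => a (i + j)%N)) -> a =1 A [ffun j : 'I_N => a j]].
Proof.
move=> [_ TH].
have [Q QP] := boolp.choice walk_extends.
pose A t j := nth 0 (rev (map lab (root :: Q t))) j.
have A1 t (j : 'I_N) : A t j = t j.
  have [s [_ E]] := QP t; rewrite /A E rev_cat revK nth_cat size_tuple ltn_ord.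
  exact: nth_mktuple.
have A0 t j : (size (Q t) < j)%N -> A t j = 0.
  by move=> qj; rewrite /A nth_default// size_rev/= size_map.
have A3 t i : good_window (fun j => A t (i + j)%N).
  have [s [pq _]] := QP t.
  have [Ni|iN] := ltnP (size (Q t)) i.
    by apply: good_window0 => j _; rewrite A0// ltn_addr.
  (* [good_window] asks for more than [N] vertices. A shorter walk carries only labels 0, so the
     zero window takes its place. *)
  have [QN|NQ] := ltnP (size (Q t)) N.
    apply: good_window0 => j _; rewrite /A.
    have [ij|ij] := ltnP (size (Q t)) (i + j); first by rewrite nth_default// size_rev/= size_map.
    rewrite nth_rev/= size_map// -/(map lab (root :: Q t)) (nth_map root)/=; last by lia.
    by apply: walk_level_label => //; lia.
  exists (root :: Q t); split=> //; first by rewrite walk_take_label// leqW.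
  by exists i.
exists A; split=> //.
  move=> t j Hj; apply: A0; have [s [pq _]] := QP t.
  exact: leq_trans (TH _ pq) Hj.
move=> a ga j; elim/ltn_ind: j => j IH.
have [jN|Nj] := ltnP j N.
  by rewrite (A1 _ (Ordinal jN)) ffunE.
(* From index [N] on, each value is forced by the [N] values before it, through the window that
   starts at [j - N]. *)
have := @good_window_det (fun i => a (j - N + i)%N) (fun i => A [ffun j : 'I_N => a j] (j - N + i)%N).
rewrite subnK//; apply=> // i iN.
by apply: IH; lia.
Qed.

End tree_windows.

(** * The dual group and masks *)

Section dual_facts.
Context {R : realType} {p : nat} (p_prime : prime p).
Implicit Types (chi psi : vilenkin_dual R p) (x y : vilenkin p).

Lemma dual_mulE chi psi x : (chi * psi)%g x = chi x * psi x.
Proof. by []. Qed.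

Lemma dual_invE chi x : (chi^-1)%g x = (chi x)^-1.
Proof. by []. Qed.

Lemma dual_expE chi n x : (chi ^+ n)%g x = chi x ^+ n.
Proof.
elim: n => [|n IH]; first by rewrite expr0 expg0.
by rewrite expgS dual_mulE IH exprS.
Qed.

Lemma dual_prodE (I : Type) (r : seq I) (F : I -> vilenkin_dual R p) x :
  (\prod_(i <- r) F i)%g x = \prod_(i <- r) F i x.
Proof. by elim/big_rec2: _ => // i y1 y2 _ <-; rewrite dual_mulE. Qed.

Lemma dual0 chi : chi 0 = 1.
Proof. by apply: (mulfI (dual_neq0 chi 0)); rewrite -dualD addr0 mulr1. Qed.

Lemma dualMn chi x n : chi (x *+ n) = chi x ^+ n.
Proof.
by elim: n => [|n IH]; rewrite ?mulr0n ?dual0 ?expr0// mulrS dualD IH exprS.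
Qed.

Lemma dual_conj chi x : (chi x)^* = (chi x)^-1.
Proof.
apply: (mulfI (dual_neq0 chi x)); rewrite divff ?dual_neq0// -sqn_conj.
by rewrite (eqP (_ : sqn (chi x) == 1))// sqn_eq1 dual_norm.
Qed.

(** Removing the digit at place [b] moves a point of [Gsub b] into [Gsub (b + 1)], so generators are
    added one at a time. Membership in an annihilator thus reduces to finitely many values. *)
Lemma annihilator_gvec (b : int) K chi : annihilator (b + K%:Z) chi ->
  (forall j, (j < K)%N -> chi (gvec (b + j%:Z)) = 1) -> annihilator b chi.
Proof.
elim: K b => [|K IH] b; first by rewrite addr0.
move=> cK cj x Gx.
pose y := x - gvec b *+ digit x b.
have Gy : Gsub (b + 1) y.
  move=> k; rewrite -/((b + 1)%R) => kb; rewrite digitB digitMn digit_gvec.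
  have [->|kb'] := eqVneq k b; first by rewrite natr_Zp_val subrr.
  by rewrite Gx ?mul0rn ?subrr//; lia.
have c1 : annihilator (b + 1) chi.
  apply: IH => [|j jK]; first by rewrite -addrA -natz -(natrD _ 1 K) natz.
  by rewrite -addrA -natz -(natrD _ 1 j) natz; apply: cj.
have -> : x = y + gvec b *+ digit x b by rewrite subrK.
rewrite dualD c1// mul1r dualMn.
by have := cj 0%N (ltn0Sn _); rewrite addr0 => ->; rewrite expr1n.
Qed.

Definition wdual (b : int) K (a : 'I_K -> 'Z_p) : vilenkin_dual R p :=
  (\prod_(j < K) rademacher p_prime (b + j%:Z)%R ^+ (a j : nat))%g.

Lemma wdualE (b : int) K (a : 'I_K -> 'Z_p) x : wdual b a x = wchar b a x.
Proof.
rewrite dual_prodE; apply: eq_bigr => j _.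
rewrite dual_expE rademacherE (zcharMn p_prime) -mulr_natl natr_Zp_val//.
Qed.

Lemma wchar_gvec_in (b : int) K (a : 'I_K -> 'Z_p) (j : 'I_K) :
  wchar b a (gvec (b + j%:Z)) = zchar (a j) :> R[i].
Proof.
rewrite /wchar (bigD1 j)//= big1 => [|i ij]; rewrite digit_gvec.
  by rewrite eqxx !mulr1.
rewrite (inj_eq (addrI b)) eqz_nat (inj_eq val_inj) (negbTE ij) mulr0.
by rewrite zchar0.
Qed.

Lemma wchar_gvec_out (b : int) K (a : 'I_K -> 'Z_p) (k : int) :
  (k < b) || (b + K%:Z <= k) -> wchar b a (gvec k) = 1 :> R[i].
Proof.
move=> kb; rewrite /wchar big1// => i _; rewrite digit_gvec.
have := ltn_ord i; case: eqP => [|_ _]; first by lia.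
by rewrite mulr0 zchar0.
Qed.

Lemma annih_cosetE N (a : {ffun 'I_N.+1 -> 'Z_p}) :
  annih_coset p_prime a = [set (psi * wdual (- N%:Z) a)%g | psi in annihilator (- N%:Z)].
Proof.
rewrite /annih_coset /wdual.
by under eq_bigr do rewrite addrC.
Qed.

(** Evaluation at the generators recovers the exponents, so a coset determines its word. *)
Lemma annih_coset_gvec N (a : {ffun 'I_N.+1 -> 'Z_p}) chi (j : 'I_N.+1) :
  annih_coset p_prime a chi -> chi (gvec (- N%:Z + j%:Z)) = zchar (a j).
Proof.
rewrite annih_cosetE => -[psi psiN <-]; rewrite dual_mulE wdualE wchar_gvec_in.
rewrite psiN ?mul1r//; apply: Gsub_gvec; lia.
Qed.

Lemma annih_coset_inj N (a b : {ffun 'I_N.+1 -> 'Z_p}) chi :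
  annih_coset p_prime a chi -> annih_coset p_prime b chi -> a = b.
Proof.
move=> ca cb; apply/ffunP => j; apply: (zchar_inj p_prime (R := R)).
by rewrite -(annih_coset_gvec j ca) (annih_coset_gvec j cb).
Qed.

Lemma annih_coset_rep N (a : {ffun 'I_N.+1 -> 'Z_p}) :
  annih_coset p_prime a (wdual (- N%:Z) a).
Proof.
rewrite annih_cosetE; exists dual1 => //; apply: dual_ext => x.
by rewrite dual_mulE mul1r.
Qed.

Lemma annih_coset_annihilator N (a : {ffun 'I_N.+1 -> 'Z_p}) :
  @annih_coset R p p_prime N a `<=` annihilator 1.
Proof.
move=> _ [psi psiN <-] x Gx.
have := annih_coset_rep a; rewrite annih_cosetE => _.
have -> : (\prod_(j < N.+1) rademacher p_prime (j%:Z - N%:Z)%R ^+ (a j : nat))%g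
    = wdual (- N%:Z) a by rewrite /wdual; under eq_bigr do rewrite addrC.
rewrite dual_mulE wdualE psiN ?mul1r; last by apply: Gsub_le Gx; lia.
by rewrite wchar_Gsub//; apply: Gsub_le Gx; lia.
Qed.

End dual_facts.

Section mask.
Context {R : realType} {p : nat} (p_prime : prime p) (T : tree p) (N : nat).
Hypothesis N_gt0 : (0 < N)%N.
Variables (m0 Phi : vilenkin_dual R p -> R[i]).
Hypothesis m0_mask : is_mask p_prime T N m0.
Hypothesis m0_Phi : forall chi,
  (fun k : nat => \prod_(0 <= n < k) m0 (dual_dil (- n%:Z) chi)) @ \oo --> Phi chi.
Implicit Types (chi psi : vilenkin_dual R p) (x y : vilenkin p) (a : nat -> 'Z_p).

(** Here [a k] is the exponent of [chi] at place [k - N]. Periodicity strips the exponents at places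
    from 1 on, finitely many because [chi] is trivial on [Gsub (s + 1)]; what remains lies in the
    coset of the first [N + 1] exponents. *)
Lemma mask_window : exists lambda : {ffun 'I_N.+1 -> 'Z_p} -> R[i],
  [/\ forall chi (s : nat) a, annihilator (s%:Z + 1) chi ->
        (forall k : nat, chi (gvec (k%:Z - N%:Z)) = zchar (a k)) ->
        m0 chi = lambda [ffun i : 'I_N.+1 => a i],
      forall a, good_window T N a -> `|lambda [ffun i : 'I_N.+1 => a i]| = 1,
      forall a, ~ good_window T N a -> lambda [ffun i : 'I_N.+1 => a i] = 0 &
      lambda [ffun=> 0] = 1].
Proof.
have [m01 [lambda lP] m0P] := m0_mask; exists lambda.
have val chi (s : nat) a : annihilator (s%:Z + 1) chi ->
    (forall k : nat, chi (gvec (k%:Z - N%:Z)) = zchar (a k)) ->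
    m0 chi = lambda [ffun i : 'I_N.+1 => a i].
  move=> cs ca.
  (* Place [j + 1] carries the exponent of index [j + N.+1]. *)
  pose P := wdual (R := R) p_prime 1 (fun j : 'I_s => a (j + N.+1)%N).
  have PE : P = (\prod_(j < s) rademacher p_prime (j.+1%:Z)%R ^+ (a (j + N.+1)%N : nat))%g.
    by apply: eq_bigr => j _; congr (rademacher _ _ ^+ _)%g; lia.
  have -> : m0 chi = m0 (chi * P^-1)%g.
    rewrite -[in LHS](mulgVK P chi) {2}PE.
    exact: (m0P _ s (fun j : 'I_s => a (j + N.+1)%N)).
  have [+ _ _] := lP [ffun i : 'I_N.+1 => a i]; apply; rewrite annih_cosetE.
  exists (chi * P^-1 * (wdual p_prime (- N%:Z) [ffun i : 'I_N.+1 => a i])^-1)%g; last first.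
    by rewrite mulgVK.
  have out (b : int) K (c : 'I_K -> 'Z_p) x : Gsub (b + K%:Z) x ->
      ((wdual p_prime b c)^-1)%g x = 1 :> R[i].
    by move=> Gx; rewrite dual_invE wdualE wchar_Gsub ?invr1.
  apply: (@annihilator_gvec _ _ p_prime (- N%:Z) (N.+1 + s)) => [x Gx|j jN].
    rewrite !dual_mulE cs ?out ?mulr1//; apply: Gsub_le Gx; lia.
  rewrite !dual_mulE !dual_invE !wdualE.
  have -> : chi (gvec (- N%:Z + j%:Z)) = zchar (a j) by rewrite addrC ca.
  have [jN1|Nj] := ltnP j N.+1.
    rewrite (wchar_gvec_out p_prime (b := 1)); last by lia.
    rewrite (wchar_gvec_in _ _ (Ordinal jN1)) ffunE/= invr1 mulr1 divff//.
    by rewrite -normr_eq0 norm_zchar oner_eq0.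
  have js : (j - N.+1 < s)%N by lia.
  rewrite [X in _ / _ / X](wchar_gvec_out p_prime); last by lia.
  have -> : - N%:Z + j%:Z = 1 + (Ordinal js)%:Z by rewrite /=; lia.
  rewrite wchar_gvec_in /= subnK// invr1 mulr1 divff//.
  by rewrite -normr_eq0 norm_zchar oner_eq0.
(* As exponents are unique, one character of the coset in [Etilde] makes its word a window of the
   tree: a coset lies inside [Etilde] or is disjoint from it. *)
have coset a chi : annih_coset p_prime [ffun i : 'I_N.+1 => a i] chi -> Etilde p_prime T N chi ->
    good_window T N a.
  move=> ca [q [sq qN lq [k kq cw]]]; exists q; split=> //; exists k => // j jN.
  have := annih_coset_inj ca cw => /ffunP /(_ (Ordinal (jN : (j < N.+1)%N))).
  by rewrite !ffunE.
split=> //.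
- move=> a [q [sq qN lq [k kq aw]]]; have [_ + _] := lP [ffun i : 'I_N.+1 => a i]; apply.
  move=> chi ca; exists q; split=> //; exists k => //.
  rewrite (_ : [ffun j => _] = [ffun i : 'I_N.+1 => a i])//.
  by apply/ffunP => j; rewrite !ffunE aw// -ltnS.
- move=> a na; have [_ _ +] := lP [ffun i : 'I_N.+1 => a i]; apply => chi ca; split.
    exact: annih_coset_annihilator ca.
  by move=> /(coset _ _ ca).
- rewrite (_ : [ffun=> 0] = [ffun i : 'I_N.+1 => (fun=> 0) (i : nat)]); last first.
    by apply/ffunP => i; rewrite !ffunE.
  rewrite -(val dual1 0%N (fun=> 0)).
  + by apply: m01.
  + by [].
  + by move=> k; rewrite zchar0.
Qed.

Lemma dual_dil_annihilator (s n : nat) chi : annihilator (s%:Z + 1) chi ->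
  annihilator (s%:Z + 1) (dual_dil (- n%:Z) chi).
Proof.
move=> cs x Gx; apply: cs; apply/Gsub_dil; apply: Gsub_le Gx; lia.
Qed.

(** Composition with $\mathcal A^{-n}$ advances the exponents by [n], so the factor of index [n]
    sees the window starting there. Beyond [s + N] all exponents are 0 and the factors are 1, hence
    the product is finite. *)
Lemma mask_product : exists lambda : {ffun 'I_N.+1 -> 'Z_p} -> R[i],
  [/\ forall chi (s M : nat) a, annihilator (s%:Z + 1) chi ->
        (forall k : nat, chi (gvec (k%:Z - N%:Z)) = zchar (a k)) ->
        (s + N < M)%N -> Phi chi = \prod_(n < M) lambda [ffun i : 'I_N.+1 => a (n + i)%N],
      forall a, good_window T N a -> `|lambda [ffun i : 'I_N.+1 => a i]| = 1 &
      forall a, ~ good_window T N a -> lambda [ffun i : 'I_N.+1 => a i] = 0].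
Proof.
have [lambda [val lg lb l0]] := mask_window; exists lambda; split=> //.
move=> chi s M a cs ca sM.
have a0 k : (s + N < k)%N -> a k = 0.
  move=> sk; apply: (zchar_eq1 p_prime (R := R)); rewrite -ca; apply: cs.
  by apply: Gsub_gvec; lia.
have mE n : m0 (dual_dil (- n%:Z) chi) = lambda [ffun i : 'I_N.+1 => a (n + i)%N].
  apply: (val _ s (fun i => a (n + i)%N)); first exact: dual_dil_annihilator.
  move=> k; rewrite -ca; congr (chi _); rewrite dil_gvec; congr gvec; lia.
have hR : hausdorff_space R[i] by exact: norm_hausdorff.
rewrite -(cvg_lim hR (@m0_Phi chi)); apply: (cvg_lim hR).
apply: cvg_near_cst; exists M => // k /= Mk.
rewrite (eq_bigr _ (fun n _ => mE n)) big_mkord.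
rewrite -(subnKC Mk) big_split_ord/= [X in _ * X]big1 ?mulr1// => i _.
rewrite -l0; congr lambda; apply/ffunP => j; rewrite !ffunE; apply: a0.
by rewrite /=; lia.
Qed.

Lemma Phi_norm1 chi (s : nat) a : annihilator (s%:Z + 1) chi ->
  (forall k : nat, chi (gvec (k%:Z - N%:Z)) = zchar (a k)) ->
  (forall n, good_window T N (fun j => a (n + j)%N)) -> `|Phi chi| = 1.
Proof.
move=> cs ca ga; have [lambda [lP lg _]] := mask_product.
rewrite (lP chi s (s + N).+1 a)// normr_prod big1// => n _.
exact: (lg (fun j => a (n + j)%N)).
Qed.

Lemma Phi_eq0 chi (s : nat) a n : annihilator (s%:Z + 1) chi ->
  (forall k : nat, chi (gvec (k%:Z - N%:Z)) = zchar (a k)) ->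
  ~ good_window T N (fun j => a (n + j)%N) -> Phi chi = 0.
Proof.
move=> cs ca na; have [lambda [lP _ lb]] := mask_product.
have nM : (n < (s + N).+1 + n.+1)%N by rewrite ltn_addl.
rewrite (lP chi s ((s + N).+1 + n.+1)%N a)//; last by rewrite ltn_addr.
by rewrite (bigD1 (Ordinal nM))//= (lb (fun j => a (n + j)%N))// mul0r.
Qed.

(** A partial product long enough for both characters computes both values, and its factors depend
    on [a] alone. *)
Lemma Phi_eq chi chi' (s s' : nat) a :
  annihilator (s%:Z + 1) chi -> annihilator (s'%:Z + 1) chi' ->
  (forall k : nat, chi (gvec (k%:Z - N%:Z)) = zchar (a k)) ->
  (forall k : nat, chi' (gvec (k%:Z - N%:Z)) = zchar (a k)) -> Phi chi = Phi chi'.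
Proof.
move=> cs cs' ca ca'; have [lambda [lP _ _]] := mask_product.
rewrite (lP chi s (s + N + (s' + N)).+1 a)//; last by rewrite ltnS leq_addr.
by rewrite (lP chi' s' (s + N + (s' + N)).+1 a)// ltnS leq_addl.
Qed.

End mask.

(** The integral of a nonnegative function is a supremum over simple minorants, and this is monotone
    for arbitrary functions. *)
Lemma le_integral_nonmeasurable (R : realType) d (S : measurableType d) (mu : {measure set S -> \bar R})
    (f g : S -> \bar R) : (forall x, 0 <= f x)%E -> (forall x, f x <= g x)%E ->
  (\int[mu]_x f x <= \int[mu]_x g x)%E.
Proof.
move=> f0 fg; have g0 x : (0 <= g x)%E by exact: le_trans (f0 x) (fg x).
rewrite !ge0_integralTE//; apply: le_ereal_sup => _ [h hf <-]; exists h => // x.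
exact: le_trans (hf x) (fg x).
Qed.

(** * Fourier inversion *)

Section dual_haar.
Context {R : realType} {p : nat} (p_prime : prime p).
Context (nu : {measure set (borel (vilenkin_dual R p)) -> \bar R}) (nu_haar : haar_dual nu).
Implicit Types (chi psi : vilenkin_dual R p) (x y : vilenkin p) (n : int).

(** A coset of [annihilator n], described by point evaluations; this form exhibits it as a closed
    set, hence Borel. *)
Definition dual_coset n chi : set (vilenkin_dual R p) :=
  [set psi | forall x, Gsub n x -> psi x = chi x].

Lemma open_dual_eval x (O : set R[i]) : open O -> open [set psi : vilenkin_dual R p | O (psi x)].
Proof.
move=> oO.
have oK : open ([set g | g @` [set x] `<=` O] : set {compact-open, vilenkin p -> R[i]}).
  by apply: compact_open_open => //; exact: compact_set1.
have := @initial_continuous (vilenkin_dual R p) {compact-open, vilenkin p -> R[i]} (@dual_fun R p).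
move=> /continuousP /(_ _ oK); congr open.
apply/seteqP; split=> psi /=; last by move=> Opsi _ [_ -> <-].
by apply; exists x.
Qed.

Lemma measurable_dual_coset n chi : measurable (dual_coset n chi : set (borel (vilenkin_dual R p))).
Proof.
rewrite -[X in measurable X]setCK; apply: measurableC; apply: sub_gen_smallest.
have -> : ~` dual_coset n chi = \bigcup_(x in Gsub n) [set psi | (~` [set chi x]) (psi x)].
  apply/seteqP; split=> psi /=.
    by move=> /existsNP[x /not_implyP[Gx px]]; exists x.
  by move=> [x Gx px] /(_ x Gx).
apply: bigcup_open => x _; apply: open_dual_eval.
apply: closed_openC; apply: accessible_closed_set1.
apply: hausdorff_accessible; exact: norm_hausdorff.
Qed.

Lemma haar_dual_coset n chi : nu (dual_coset n chi) = (p%:R ^ n)%:E.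
Proof.
have [tr an] := nu_haar; rewrite -an -(tr chi (annihilator n)); last first.
  have -> : annihilator n = dual_coset n dual1 by [].
  exact: measurable_dual_coset.
congr (nu _); apply/seteqP; split=> [psi cpsi|_ [psi apsi <-] x Gx].
  exists (chi^-1 * psi)%g; last by rewrite mulVKg.
  by move=> x Gx; rewrite dual_mulE dual_invE cpsi// mulVf ?dual_neq0.
by rewrite dual_mulE apsi// mulr1.
Qed.

(* [F] need not be measurable, hence the detour through a simple minorant. *)
Lemma dual_coset_bessel (I : finType) n (X : I -> vilenkin_dual R p) (F : vilenkin_dual R p -> R[i]) :
  (forall i j, dual_coset n (X i) (X j) -> i = j) ->
  (forall i psi, dual_coset n (X i) psi -> F psi = F (X i)) ->
  ((p%:R ^ n * \sum_(i : I) sqn (F (X i)))%:E <= nsq nu setT F)%E.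
Proof.
move=> Xinj FX.
pose B i : set (borel (vilenkin_dual R p)) := dual_coset n (X i).
pose F' (psi : borel (vilenkin_dual R p)) : \bar R :=
  (\sum_(i : I) (sqn (F (X i)))%:E * (\1_(B i) psi)%:E)%E.
have mB i : measurable (B i) by exact: measurable_dual_coset.
have -> : ((p%:R ^ n * \sum_(i : I) sqn (F (X i)))%:E = \int[nu]_psi F' psi)%E.
  rewrite ge0_integral_sum//; last 2 first.
  - by move=> i; apply: measurable_funeM; apply/measurable_EFinP; exact: measurable_indic.
  - by move=> i psi _; rewrite mule_ge0 ?lee_fin ?sqn_ge0.
  rewrite mulr_sumr -sumEFin; apply: eq_bigr => i _.
  rewrite ge0_integralZl ?lee_fin ?sqn_ge0//; last by apply/measurable_EFinP; exact: measurable_indic.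
  by rewrite integral_indic// setIT haar_dual_coset mulrC EFinM.
apply: le_integral_nonmeasurable => psi.
  by apply: sume_ge0 => i _; rewrite mule_ge0 ?lee_fin ?sqn_ge0.
rewrite /F'; have [[i Bi]|nB] := pselect (exists i, B i psi).
  rewrite (bigD1 i)//= big1 => [|j ji].
    by rewrite adde0 indicE mem_set// mule1 lee_fin (FX i psi Bi).
  rewrite indicE memNset ?mule0// => Bj; move: ji; rewrite (Xinj i j) ?eqxx//.
  by move=> x Gx; rewrite -Bi// Bj.
rewrite big1 ?lee_fin ?sqn_ge0// => i _.
by rewrite indicE memNset ?mule0// => Bi; apply: nB; exists i.
Qed.

End dual_haar.

Lemma L2_indicM d (T : measurableType d) (R : realType) (mu : {measure set T -> \bar R})
    (A : set T) (f : T -> R[i]) : measurable A -> L2 mu f ->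
  L2 mu (fun x => (x \in A)%:R * f x).
Proof.
move=> mA Lf; have mf := L2_cmeas Lf.
have mAf : cmeas (fun x => (x \in A)%:R * f x) by exact: cmeasM (cmeas_indic R mA) mf.
apply/L2P; split=> //; apply: le_lt_trans (L2_nsq Lf).
apply: ge0_le_integral => //; try exact: measurable_sqnE.
  by move=> x _; rewrite lee_fin sqn_ge0.
move=> x _; rewrite lee_fin sqnM sqn_bool.
by case: (x \in A); rewrite ?mul1r// mul0r sqn_ge0.
Qed.

Lemma sqn_sum_le (R : realType) (I : Type) (r : seq I) (u : I -> R[i]) :
  sqn (\sum_(i <- r) u i) <= (size r)%:R * \sum_(i <- r) sqn (u i).
Proof.
elim: r => [|i r IH]; first by rewrite !big_nil sqn0 mul0r.
rewrite !big_cons; set S := \sum_(j <- r) u j in IH *; set Q := \sum_(j <- r) sqn (u j) in IH *.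
case: r => [|j r] in S Q IH *.
  by rewrite /S /Q !big_nil !addr0 mul1r.
set t : R := (size (j :: r))%:R in IH *.
have t0 : 0 < t by rewrite ltr0n.
have -> : (size [:: i, j & r])%:R = 1 + t :> R by rewrite nat1r.
(* Young's inequality weighted by the length [t] of the remaining list: after the induction
   hypothesis contributes a factor [t], both coefficients equal [1 + t]. *)
have young : sqn (u i + S) <= (1 + t) * sqn (u i) + (1 + t^-1) * sqn S.
  case: (u i) S {IH} => a b [c d]; rewrite /sqn/= -subr_ge0.
  have -> : (1 + t) * (a ^+ 2 + b ^+ 2) + (1 + t^-1) * (c ^+ 2 + d ^+ 2) -
      ((a + c) ^+ 2 + (b + d) ^+ 2) = t^-1 * ((t * a - c) ^+ 2 + (t * b - d) ^+ 2).
    by field; rewrite gt_eqF.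
  by apply: mulr_ge0; [rewrite invr_ge0 ltW|rewrite addr_ge0 ?sqr_ge0].
apply: le_trans young _; rewrite [leRHS]mulrDr lerD2l.
apply: le_trans (_ : (1 + t^-1) * (t * Q) <= _).
  by rewrite ler_wpM2l// addr_ge0 ?invr_ge0 ?ltW.
by rewrite mulrA mulrDl mul1r mulVf ?gt_eqF// addrC.
Qed.

Lemma sqnX (R : realType) (z : R[i]) n : sqn (z ^+ n) = sqn z ^+ n.
Proof.
by elim: n => [|n IH]; rewrite ?expr0 ?exprS ?sqnM ?IH// /sqn/= expr1n expr0n addr0.
Qed.

Lemma sqn_nat (R : realType) n : sqn (n%:R : R[i]) = n%:R ^+ 2.
Proof.
have -> : n%:R = (n%:R)%:C :> R[i] by rewrite rmorph_nat.
by rewrite /sqn/= expr0n addr0.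
Qed.

Section fourier_inversion.
Context {R : realType} {p : nat} (p_prime : prime p).
Context (mu : {measure set (borel (vilenkin p)) -> \bar R}) (mu_haar : haar_vilenkin mu).
Context (nu : {measure set (borel (vilenkin_dual R p)) -> \bar R}) (nu_haar : haar_dual nu).
Implicit Types (chi psi : vilenkin_dual R p) (x y : vilenkin p) (f g : vilenkin p -> R[i]).

Definition trunc_fourier (n : nat) f chi : R[i] :=
  cintegral mu (Gsub (- n%:Z)) (fun x => f x * (chi x)^*).

Lemma annihilator_loc_const (n : int) chi : annihilator n chi -> loc_const n chi.
Proof. by move=> cn x y xy; rewrite -(subrK x y) dualD cn// mul1r. Qed.

Lemma cintegral_restrict (D E : set (borel (vilenkin p))) f : D `<=` E ->
  cintegral mu E (fun x => (x \in D)%:R * f x) = cintegral mu D f.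
Proof.
move=> DE; rewrite [LHS]cintegral_mkcond [RHS]cintegral_mkcond.
apply: eq_cintegral => x _; rewrite mulrA; congr (_ * _).
have [xD|xD] := boolP (x \in D); last by rewrite mulr0.
by rewrite mem_set ?mul1r//; apply: DE; exact: set_mem.
Qed.

(** Fourier inversion on the finite group $G_{-n}/G_{-n+K}$: summed over all words, the characters
    at [y - x] give $p^K$ times the indicator of the ball around [y]. *)
Lemma vball_integral_fourier (n K : nat) y f : L2 mu f -> Gsub (- n%:Z) y ->
  p%:R ^+ K * cintegral (T := borel (vilenkin p)) mu (vball (- n%:Z + K%:Z) y) f =
  \sum_(a : {ffun 'I_K -> 'Z_p}) wchar (- n%:Z) a y * trunc_fourier n f (wdual p_prime (- n%:Z) a).
Proof.
move=> Lf Gy.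
have mG : measurable (Gsub (- n%:Z) : set (borel (vilenkin p))) by exact: measurable_Gsub.
have fG : (mu (Gsub (- n%:Z)) < +oo)%E by rewrite haar_Gsub// ltey.
have ia (a : {ffun 'I_K -> 'Z_p}) : cintegrable (T := borel (vilenkin p)) mu (Gsub (- n%:Z))
    (fun x => f x * (wdual (R := R) p_prime (- n%:Z) a x)^*).
  apply: L2_cintegrable => //; apply: (@L2M_norm1 _ (borel (vilenkin p)) _ mu f (fun x => (wdual p_prime (- n%:Z) a x)^*)) => //.
    apply: cmeas_conj; apply: (@loc_const_cmeas _ _ (- n%:Z + K%:Z)) => x z xz.
    by rewrite !wdualE; exact: wchar_loc_const.
  by move=> x; rewrite norm_conjC dual_norm.
under eq_bigr do rewrite -cintegralZ//.
rewrite -cintegral_sum//; last by move=> a; exact: cintegrableZ.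
rewrite -(@cintegral_restrict (vball (- n%:Z + K%:Z) y) (Gsub (- n%:Z))); last first.
  move=> x xy; have -> : x = (x - y) + y by rewrite subrK.
  by apply: GsubD => //; apply: Gsub_le xy; lia.
have iB : cintegrable (T := borel (vilenkin p)) mu (Gsub (- n%:Z))
    (fun x => (x \in vball (- n%:Z + K%:Z) y)%:R * f x).
  by apply: L2_cintegrable => //; apply: L2_indicM => //; exact: measurable_vball.
rewrite -cintegralZ//; apply: eq_cintegral => x Gx.
transitivity (f x * \sum_(a : {ffun 'I_K -> 'Z_p}) wchar (- n%:Z) a (y - x)); last first.
  rewrite mulr_sumr; apply: eq_bigr => a _.
  by rewrite wcharD// wcharN// wdualE mulrCA.
rewrite sum_wchar// [RHS]mulrCA [f x * _]mulrC; congr (_ * (_%:R * _)).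
congr nat_of_bool; apply/idP/forallP => [/set_mem xy j|xy].
  by apply/eqP/(GsubBC xy); have := ltn_ord j; lia.
apply/mem_set/GsubBC => k kK.
have [kn|nk] := ltP k (- n%:Z); first by rewrite digitB Gy// Gx// subrr.
have jK : (absz (k + n%:Z)%R < K)%N by lia.
have := eqP (xy (Ordinal jK)); rewrite /=.
by have -> : - n%:Z + (absz (k + n%:Z)%R)%:Z = k by lia.
Qed.

(** The weight $p^{-n}$ is the mass of a coset of [annihilator (- n)], so the hypothesis is what a
    Bessel bound on the dual side delivers. Inversion and Cauchy-Schwarz over the $p^K$ words then
    bound the integral over a ball. *)
Lemma fourier_inj f : L2 mu f ->
  (forall e : R, 0 < e -> exists n0 : nat, forall n K : nat, (n0 <= n)%N ->
    p%:R ^ (- n%:Z) * \sum_(a : {ffun 'I_K -> 'Z_p})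
      sqn (trunc_fourier n f (wdual p_prime (- n%:Z) a)) < e) ->
  {ae mu, forall x, f x = 0}.
Proof.
move=> Lf small; apply: (vball_integral0_ae mu_haar) => // m y.
set J := cintegral _ _ _.
apply: sqn_eq0; apply/eqP; apply: contraT => J0.
have p0 : 0 < p%:R :> R by rewrite ltr0n prime_gt0.
have J1 : 0 < p%:R ^ m * sqn J by rewrite mulr_gt0 ?exprz_gt0// lt0r J0 sqn_ge0.
have [n1 n1P] := small _ J1; have [n2 n2P] := Gsub_ex y.
(* With [K = m + n] the inverted ball has level [m], and the estimate yields that $p^m|J|^2$ is less
   than the chosen tolerance, which is $p^m|J|^2$ itself. *)
pose n := (n1 + n2 + absz m)%N; pose K := absz (m + n%:Z).
have KE : - n%:Z + K%:Z = m by rewrite /K /n; lia.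
have Gy : Gsub (- n%:Z) y by apply: Gsub_le n2P; rewrite /n; lia.
have n1n : (n1 <= n)%N by rewrite /n -addnA leq_addr.
have lt1 := n1P n K n1n.
have B := sqn_sum_le (enum {ffun 'I_K -> 'Z_p}) (fun a =>
  wchar (- n%:Z) a y * trunc_fourier n f (wdual p_prime (- n%:Z) a)).
have cardA : #|{ffun 'I_K -> 'Z_p}| = (p ^ K)%N.
  by rewrite card_ffun !card_ord Zp_cast ?prime_gt1.
rewrite !big_enum/= -vball_integral_fourier// KE -/J -cardE cardA sqnM sqnX sqn_nat in B.
rewrite [X in _ <= _ * X](_ : _ = \sum_(a : {ffun 'I_K -> 'Z_p})
    sqn (trunc_fourier n f (wdual p_prime (- n%:Z) a))) in B; last first.
  apply: eq_bigr => a _; rewrite sqnM (eqP (_ : sqn (wchar _ _ _) == 1)) ?mul1r//.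
  by rewrite sqn_eq1 norm_wchar.
have pK : 0 < p%:R ^+ K :> R by rewrite exprn_gt0.
rewrite natrX exprAC expr2 -mulrA ler_pM2l// in B.
move: lt1; rewrite -KE expfzDr ?gt_eqF// -mulrA ltr_pM2l ?exprz_gt0//.
by rewrite -exprnP ltNge B.
Qed.

End fourier_inversion.

Lemma cintegrable_mkcond d (T : measurableType d) (R : realType)
    (mu : {measure set T -> \bar R}) (D : set T) (f : T -> R[i]) : measurable D ->
  cintegrable mu D f -> cintegrable mu setT (fun x => (x \in D)%:R * f x).
Proof.
move=> mD [fr fi]; split.
- apply: eq_integrable ((integrable_mkcond _ mD).1 fr) => // x _.
  by rewrite patchE; case: ifP => _; rewrite ?mul1r// mul0r.
- apply: eq_integrable ((integrable_mkcond _ mD).1 fi) => // x _.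
  by rewrite patchE; case: ifP => _; rewrite ?mul1r// mul0r.
Qed.

(** * Atoms and the scaling function *)

Section wavelet_atoms.
Context {R : realType} {p : nat} (p_prime : prime p).
Context (mu : {measure set (borel (vilenkin p)) -> \bar R}) (mu_haar : haar_vilenkin mu).
Context (N H : nat) (A : {ffun 'I_N -> 'Z_p} -> nat -> 'Z_p).
Hypothesis A_prefix : forall t (j : 'I_N), A t j = t j.
Hypothesis A_eq0 : forall t j, (H <= j)%N -> A t j = 0.
Hypothesis A_shift : forall t, exists t', forall j, A t' j = A t j.+1.
Hypothesis A_0 : forall j, A 0 j = 0.
Context (c : {ffun 'I_N -> 'Z_p} -> R[i]) (c_norm : forall t, `|c t| = 1).
Implicit Types (chi psi : vilenkin_dual R p) (x y z h : vilenkin p) (t s d : {ffun 'I_N -> 'Z_p}).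
Local Notation G := (Gsub (- N%:Z) : set (vilenkin p)).

(** The exponent [A t j] stands at place [j - N]; [H] factors exhaust the sequence. *)
Definition tail_dual t : vilenkin_dual R p := wdual p_prime (- N%:Z) (fun j : 'I_H => A t j).

Definition atom t x : R[i] := (x \in G)%:R * tail_dual t x.

(** The factor $p^{-N}$ is the mass of one coset of [annihilator (- N)], as inverse transformation
    requires. *)
Definition scaling x : R[i] := (p%:R ^+ N)^-1 * \sum_t c t * atom t x.

Lemma pN_neq0 : p%:R ^+ N != 0 :> R[i].
Proof. by rewrite expf_neq0// pnatr_eq0 -lt0n prime_gt0. Qed.

Lemma A_inj t s : A t =1 A s -> t = s.
Proof. by move=> ts; apply/ffunP => j; rewrite -!A_prefix. Qed.

Lemma tail_dualE t M x : (H <= M)%N ->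
  tail_dual t x = \prod_(j < M) zchar (A t j * digit x (- N%:Z + j%:Z)).
Proof.
move=> HM; rewrite wdualE /wchar -(subnKC HM) big_split_ord/= [X in _ * X]big1 ?mulr1// => j _.
by rewrite A_eq0 ?leq_addr// mul0r zchar0.
Qed.

Lemma tail_dual_gvec t (k : nat) : tail_dual t (gvec (k%:Z - N%:Z)) = zchar (A t k).
Proof.
rewrite (tail_dualE t _ (leq_addr k.+1 H)).
have kM : (k < H + k.+1)%N by rewrite ltn_addl.
rewrite (bigD1 (Ordinal kM))//= big1 => [|j jk]; rewrite digit_gvec addrC.
  by rewrite addrC eqxx !mulr1.
by rewrite (inj_eq (addIr _)) eqz_nat (negbTE (_ : (j : nat) != k)) ?mulr0 ?zchar0.
Qed.

Lemma tail_dual_annihilator t : annihilator (H%:Z + 1) (tail_dual t).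
Proof.
by move=> x Gx; rewrite wdualE wchar_Gsub//; apply: Gsub_le Gx; lia.
Qed.

Lemma tail_dual_loc_const t : loc_const (- N%:Z + H%:Z) (tail_dual t).
Proof. by move=> x y xy; rewrite !wdualE; exact: wchar_loc_const. Qed.

Lemma tail_dual0 x : tail_dual 0 x = 1.
Proof.
by rewrite wdualE /wchar big1// => j _; rewrite A_0 mul0r zchar0.
Qed.

Lemma GsubDl x y : G y -> (y + x \in G) = (x \in G).
Proof.
move=> Gy; apply/idP/idP => /set_mem Gx; apply/mem_set; last exact: GsubD.
by rewrite -(addKr y x) addrC; apply: GsubB.
Qed.

Lemma atom_loc_const t : loc_const (H%:Z - N%:Z) (atom t).
Proof.
move=> x y xy; rewrite /atom; congr (_%:R * _).
  rewrite -(subrK x y) GsubDl//; apply: Gsub_le xy; lia.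
by apply: tail_dual_loc_const; rewrite addrC.
Qed.

Lemma atom_L2 t : L2 mu (atom t).
Proof.
exact: (loc_const_L2 mu_haar _ (tail_dual_loc_const t) (dual_norm (tail_dual t))).
Qed.

Lemma scaling_L2 : L2 mu scaling.
Proof. by apply: L2Z; apply: L2_sum => t; apply: L2Z; exact: atom_L2. Qed.

(** Orthogonality of characters on the compact group [G]: they agree there exactly when their
    exponents from place [-N] on agree. *)
Lemma atom_integral chi (s : nat) t (a : nat -> 'Z_p) : annihilator (s%:Z + 1) chi ->
  (forall k : nat, chi (gvec (k%:Z - N%:Z)) = zchar (a k)) ->
  cintegral (T := borel (vilenkin p)) mu G (fun x => tail_dual t x * (chi x)^*) =
  p%:R ^+ N * (`[< A t =1 a >])%:R.
Proof.
move=> cs ca.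
rewrite (@cintegral_char R p mu mu_haar (- N%:Z) (H%:Z + s%:Z + 1)); last 3 first.
- move=> x y xy; congr (_ * _).
    by apply: tail_dual_loc_const; apply: vball_le xy; lia.
  congr (_^*); rewrite -(subrK x y) dualD cs ?mul1r//.
  by apply: Gsub_le xy; lia.
- by move=> x y; rewrite !dualD rmorphM mulrACA.
- by move=> x; rewrite normrM norm_conjC !dual_norm mulr1.
have E : (forall x, G x -> tail_dual t x * (chi x)^* = 1) <-> A t =1 a.
  split=> [E k|E].
    have := E (gvec (k%:Z - N%:Z)); rewrite dual_conj tail_dual_gvec ca => /(_ _) E'.
    apply: (zchar_inj p_prime (R := R)); apply: (mulIf (invr_neq0 (dual_neq0 chi (gvec (k%:Z - N%:Z))))).
    rewrite ca E' ?divff//; first by rewrite -normr_eq0 norm_zchar oner_eq0.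
    by apply: Gsub_gvec; lia.
  have : annihilator (- N%:Z) (tail_dual t * chi^-1)%g.
    apply: (@annihilator_gvec _ _ p_prime _ (N + s + H + 1)).
      move=> x Gx; rewrite dual_mulE dual_invE cs ?invr1 ?mulr1.
        by apply: tail_dual_annihilator; apply: Gsub_le Gx; lia.
      by apply: Gsub_le Gx; lia.
    move=> j _; rewrite dual_mulE dual_invE addrC ca tail_dual_gvec E divff//.
    by rewrite -normr_eq0 norm_zchar oner_eq0.
  by move=> an x Gx; rewrite dual_conj; exact: an.
case: asboolP => [/E Ea|nE]; first by rewrite asboolT// mulr1 opprK -exprnP rmorphXn rmorph_nat.
by rewrite asboolF ?mulr0// => /E.
Qed.

Lemma scaling_fourier (n : nat) chi (s : nat) (a : nat -> 'Z_p) : (N <= n)%N ->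
  annihilator (s%:Z + 1) chi ->
  (forall k : nat, chi (gvec (k%:Z - N%:Z)) = zchar (a k)) ->
  trunc_fourier mu n scaling chi = \sum_t c t * (`[< A t =1 a >])%:R.
Proof.
move=> Nn cs ca; rewrite /trunc_fourier.
have mG : measurable (Gsub (- n%:Z) : set (borel (vilenkin p))) by exact: measurable_Gsub.
have it t : cintegrable (T := borel (vilenkin p)) mu (Gsub (- n%:Z))
    (fun x => (x \in G)%:R * (tail_dual t x * (chi x)^*)).
  apply: L2_cintegrable => //; first by rewrite haar_Gsub// ltey.
  apply: (loc_const_L2 mu_haar (n := H%:Z + s%:Z + 1)).
    move=> x y xy; congr (_ * _).
      by apply: tail_dual_loc_const; apply: vball_le xy; lia.
    congr (_^*); rewrite -(subrK x y) dualD cs ?mul1r//.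
    by apply: Gsub_le xy; lia.
  by move=> x; rewrite normrM norm_conjC !dual_norm mulr1.
transitivity (cintegral (T := borel (vilenkin p)) mu (Gsub (- n%:Z)) (fun x => \sum_t
    ((p%:R ^+ N)^-1 * c t) * ((x \in G)%:R * (tail_dual t x * (chi x)^*)))).
  apply: eq_cintegral => x _; rewrite /scaling -mulrA mulr_suml mulr_sumr.
  by apply: eq_bigr => t _; rewrite /atom !mulrA.
rewrite cintegral_sum//; last by move=> t; exact: cintegrableZ.
apply: eq_bigr => t _; rewrite cintegralZ// cintegral_restrict; last by apply: Gsub_le; lia.
rewrite (atom_integral _ cs ca) [_ * c t]mulrC -!mulrA; congr (_ * _).
by rewrite mulrA mulVf ?pN_neq0// mul1r.
Qed.

(** The refinement equation. [dil 1] moves the digit at place [-N] to [-N - 1], and only the summand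
    that subtracts exactly this digit lands in [G]. The digit accounts for the first factor of the
    character, and the other factors follow the shifted sequence. *)
Lemma atom_shift_eq t : exists t', forall z, atom t z =
  \sum_(b : 'Z_p) zchar (A t 0 * b) * atom t' (dil 1 z - gvec (- N%:Z - 1) *+ b).
Proof.
have [t' tt'] := A_shift t; exists t' => z.
have dg (b : 'Z_p) (k : int) : digit (dil 1 z - gvec (- N%:Z - 1) *+ b) k =
    digit z (k + 1) - (k == - N%:Z - 1)%:R * b.
  by rewrite digitB digitMn digit_gvec digit_dil; congr (_ - _); case: eqP => _; rewrite ?mul0rn ?mul0r ?mul1r// natr_Zp_val.
have Gz (b : 'Z_p) : (dil 1 z - gvec (- N%:Z - 1) *+ b \in G) = (z \in G) && (digit z (- N%:Z) == b).
  apply/idP/andP => [/set_mem Gz|[/set_mem Gz /eqP zb]].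
    split.
      apply/mem_set => k kN; have [kN1|kN1] := eqVneq k (- N%:Z); first by lia.
      have := Gz (k - 1); rewrite dg subrK => /(_ _) E.
      rewrite -E; last by lia.
      by rewrite (_ : (k - 1 == _) = false) ?mul0r ?subr0//; lia.
    have := Gz (- N%:Z - 1); rewrite dg eqxx subrK mul1r => /(_ _) E.
    by rewrite -subr_eq0 E//; lia.
  apply/mem_set => k kN; rewrite dg; have [->|kN1] := eqVneq k (- N%:Z - 1).
    by rewrite subrK mul1r zb subrr.
  by rewrite mul0r subr0 Gz//; lia.
have [zG|zG] := boolP (z \in G); last first.
  rewrite /atom (negbTE zG) mul0r big1// => b _.
  by rewrite Gz (negbTE zG) mul0r mulr0.
rewrite (bigD1 (digit z (- N%:Z)))//= big1 => [|b bz]; last first.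
  by rewrite /atom Gz eq_sym (negbTE bz) andbF mul0r mulr0.
rewrite addr0 /atom Gz zG eqxx !mul1r (tail_dualE t _ (leqnSn H)) (tail_dualE t' _ (leqnn H)).
rewrite big_ord_recl addr0; congr (_ * _); apply: eq_bigr => j _.
rewrite dg tt' (_ : (_ == _) = false) ?mul0r ?subr0; last by lia.
by congr (zchar (_ * digit z _)); rewrite /= /bump/=; lia.
Qed.

(** These points make up the intersection of [H_0] and [G], that is, the shifts from [H_0] that
    preserve [G]. *)
Definition vsum d : vilenkin p := \sum_(j < N) gvec (- N%:Z + j%:Z) *+ d j.

Lemma H_0_vsum d : H_0 (vsum d).
Proof.
rewrite /vsum; apply: big_ind => [||j _]; [exact: H_0_0|by move=> x y; exact: H_0D|].
by apply: H_0Mn; apply: H_0_gvec; have := ltn_ord j; lia.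
Qed.

Lemma Gsub_vsum d : G (vsum d).
Proof.
rewrite /vsum; apply: big_ind => [||j _]; [by []|by move=> x y; exact: GsubD|].
by move=> k kN; rewrite digitMn digit_gvec (_ : (k == _) = false) ?mul0rn//; lia.
Qed.

Lemma vsum_digits h : H_0 h -> G h -> h = vsum [ffun j : 'I_N => digit h (- N%:Z + j%:Z)].
Proof.
move=> /H_0P Hh Gh; apply: vilenkin_ext => k; rewrite digit_sum.
have E (j : 'I_N) : digit (gvec (- N%:Z + j%:Z) *+ [ffun j : 'I_N => digit h (- N%:Z + j%:Z)] j) k =
    (k == - N%:Z + j%:Z)%:R * digit h k.
  rewrite digitMn digit_gvec ffunE; case: eqP => [->|_]; last by rewrite mul0rn mul0r.
  by rewrite natr_Zp_val mul1r.
under eq_bigr do rewrite E.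
have [kN|kN] := ltP k (- N%:Z); first by rewrite Gh// big1// => j _; rewrite mulr0.
have [k0|k0] := leP 0 k; first by rewrite Hh// big1// => j _; rewrite mulr0.
have jN : (absz (k + N%:Z)%R < N)%N by lia.
rewrite (bigD1 (Ordinal jN))//= big1 => [|j jk].
  by rewrite (_ : (k == _) = true) ?mul1r ?addr0//; lia.
rewrite (_ : (k == _) = false) ?mul0r//.
by apply: contra_neqF jk => /eqP kE; apply: val_inj => /=; lia.
Qed.

Definition pairing t d : R[i] := \prod_(j < N) zchar (t j * d j).

Lemma tail_dual_vsum t d : tail_dual t (vsum d) = pairing t d.
Proof.
rewrite /vsum /pairing; elim/big_rec2: _ => [|j y1 y2 _ <-]; first exact: dual0.
rewrite dualD dualMn addrC tail_dual_gvec (zcharMn p_prime) A_prefix.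
by rewrite -mulr_natr natr_Zp_val.
Qed.

Lemma pairingC t d : pairing t d = pairing d t.
Proof. by apply: eq_bigr => j _; rewrite mulrC. Qed.

Lemma pairing_conj t d s : pairing t d * (pairing s d)^* = pairing (t - s) d.
Proof.
rewrite rmorph_prod -big_split.
apply: eq_bigr => j _; change (zchar (t j * d j) * (zchar (s j * d j))^* = zchar ((t - s) j * d j) :> R[i]).
by rewrite -(zcharN p_prime) -(zcharD p_prime) ffunE ffunE mulrBl.
Qed.

Lemma sum_pairing d : \sum_t pairing t d = p%:R ^+ N * (d == 0)%:R.
Proof.
rewrite -(bigA_distr_bigA (fun (j : 'I_N) a => zchar (a * d j))).
under eq_bigr do rewrite (sum_zchar p_prime).
rewrite big_split/= prodr_const card_ord; congr (_ * _).
have [->|d0] := eqVneq d 0; first by rewrite big1// => j _; rewrite ffunE eqxx.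
have [j dj] : exists j, d j != 0.
  apply/existsP; apply: contraT; rewrite negb_exists => /forallP dj.
  by case/negP: d0; apply/eqP/ffunP => j; rewrite ffunE; apply/eqP; rewrite -[_ == _]negbK.
by rewrite (bigD1 j)//= (negbTE dj) mul0r.
Qed.

Lemma scalingB_vsum z d : scaling (z - vsum d) =
  (p%:R ^+ N)^-1 * \sum_s c s * (pairing s d)^* * atom s z.
Proof.
congr (_ * _); apply: eq_bigr => s _; rewrite -!mulrA; congr (_ * _).
have Gz : (z - vsum d \in G) = (z \in G).
  by rewrite addrC GsubDl//; apply: GsubN; exact: Gsub_vsum.
have E : tail_dual s (z - vsum d) = (pairing s d)^* * tail_dual s z.
  by rewrite dualD mulrC -tail_dual_vsum [in LHS]mulrC !wdualE (wcharN p_prime) mulrC.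
by rewrite /atom Gz E mulrCA.
Qed.

(** A shift by [vsum d] multiplies the coefficient of each [atom s] by the conjugate of
    [pairing s d]. Summation against [pairing t d] isolates [s = t], and the unimodular [c t]
    cancels against its conjugate. *)
Lemma atom_scaling t z : atom t z = (c t)^* * \sum_d pairing t d * scaling (z - vsum d).
Proof.
under eq_bigr do rewrite scalingB_vsum mulrCA.
rewrite -mulr_sumr.
have -> : \sum_d pairing t d * (\sum_s c s * (pairing s d)^* * atom s z) =
    \sum_s c s * atom s z * (p%:R ^+ N * (t - s == 0)%:R).
  under eq_bigr do rewrite mulr_sumr.
  rewrite exchange_big/=; apply: eq_bigr => s _.
  rewrite -sum_pairing mulr_sumr; apply: eq_bigr => d _.
  by rewrite [in RHS]pairingC -pairing_conj; ring.
rewrite (bigD1 t)//= big1 => [|s st]; last by rewrite subr_eq0 eq_sym (negbTE st) !mulr0.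
rewrite subrr eqxx addr0 mulr1.
have -> : (c t)^* * ((p%:R ^+ N)^-1 * (c t * atom t z * p%:R ^+ N)) =
    (c t * (c t)^*) * (((p%:R ^+ N)^-1 * p%:R ^+ N) * atom t z) by ring.
rewrite mulVf ?pN_neq0// mul1r -sqn_conj (eqP (_ : sqn (c t) == 1)) ?mul1r//.
by rewrite sqn_eq1 c_norm.
Qed.

Lemma scaling_orthonormal h h' : H_0 h -> H_0 h' ->
  L2dot mu (fun x => scaling (x - h)) (fun x => scaling (x - h')) = (h == h')%:R.
Proof.
move=> Hh Hh'; rewrite /L2dot.
have scale0 z : z \notin G -> scaling z = 0.
  by move=> zG; rewrite /scaling big1 ?mulr0// => t _; rewrite /atom (negbTE zG) mul0r mulr0.
(* [scaling] is supported on the subgroup [G]: two translates are disjoint unless their shifts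
   differ by an element of [G], which is then some [vsum d]. *)
have [/set_mem Ge|nGe] := boolP (h' - h \in G); last first.
  rewrite (@eq_cintegral _ _ _ _ _ _ (fun=> 0)) ?cintegral0 => [|x _].
    have [hh|//] := eqVneq h h'; move: nGe; rewrite hh subrr => /negP; case.
    by apply/mem_set.
  have [xh|xh] := boolP (x - h \in G); last by rewrite scale0// mul0r.
  rewrite (_ : scaling (x - h') = 0) ?rmorph0 ?mulr0//; apply: scale0; apply: contra nGe => xh'.
  apply/mem_set; have -> : h' - h = (x - h) - (x - h') by rewrite opprB [RHS]addrC addrA subrK.
  by apply: GsubB; exact: set_mem.
have He : H_0 (h' - h) by exact: H_0B.
have vE := vsum_digits He Ge; set d := finfun _ in vE.
pose F x : R[i] := scaling x * (scaling (x - vsum d))^*.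
have LF : cmeas (T := borel (vilenkin p)) F.
  apply: cmeasM; first exact: L2_cmeas scaling_L2.
  apply: cmeas_conj; apply: cmeas_shift; exact: L2_cmeas scaling_L2.
transitivity (cintegral (T := borel (vilenkin p)) mu setT F).
  rewrite -(haar_shift_cintegral mu_haar h measurableT LF) preimage_setT.
  apply: eq_cintegral => x _; rewrite /F -vE; congr (_ * (scaling _)^*).
  by rewrite opprB addrA subrK.
pose f t s x : R[i] := (x \in G)%:R * (tail_dual t x * (tail_dual s x)^*).
have fi t s : cintegrable (T := borel (vilenkin p)) mu setT (f t s).
  apply: (@cintegrable_mkcond _ (borel (vilenkin p)) R mu G
    (fun x => tail_dual t x * (tail_dual s x)^*)); first exact: measurable_Gsub.
  apply: (loc_const_cintegrable mu_haar (n := - N%:Z + H%:Z)).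
    by move=> x y xy; rewrite !(tail_dual_loc_const _ xy).
  by move=> x; rewrite normrM norm_conjC !dual_norm mulr1.
pose P : R[i] := (p%:R ^+ N)^-1.
have FE x : F x = \sum_t \sum_s (P * P * c t * (c s)^* * pairing s d) * f t s x.
  rewrite /F scalingB_vsum /scaling -/P rmorphM rmorph_sum/=.
  have -> : P^* = P by rewrite /P fmorphV rmorphXn rmorph_nat.
  rewrite mulrACA big_distrlr/= mulr_sumr; apply: eq_bigr => t _.
  rewrite mulr_sumr; apply: eq_bigr => s _.
  rewrite /f /atom !rmorphM/= conjCK; case: (x \in G); rewrite ?rmorph1 ?rmorph0; ring.
have fE t s : cintegral (T := borel (vilenkin p)) mu setT (f t s) = p%:R ^+ N * (t == s)%:R.
  rewrite cintegral_restrict//.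
  rewrite (atom_integral t (tail_dual_annihilator s) (tail_dual_gvec s)).
  congr (_ * (nat_of_bool _)%:R); apply/asboolP/eqP => [/A_inj//|->//].
rewrite (_ : F = fun x => \sum_t \sum_s (P * P * c t * (c s)^* * pairing s d) * f t s x); last first.
  exact/boolp.funext.
rewrite cintegral_sum//; last first.
  by move=> t; apply: cintegrable_sum => // s; exact: cintegrableZ.
(* Only the diagonal [s = t] survives. Each atom has squared norm $p^N$, which cancels one of the
   two factors [P]; the sum of the pairings cancels the other. *)
rewrite (eq_bigr (fun t => P * pairing t d)) => [|t _]; last first.
  rewrite cintegral_sum//; last by move=> s; exact: cintegrableZ.
  rewrite (bigD1 t)//= big1 => [|s st]; last first.
    by rewrite cintegralZ// fE eq_sym (negbTE st) !mulr0.
  rewrite addr0 cintegralZ// fE eqxx mulr1.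
  have -> : P * P * c t * (c t)^* * pairing t d * p%:R ^+ N =
    (P * p%:R ^+ N) * (c t * (c t)^*) * (P * pairing t d) by ring.
  rewrite mulVf ?pN_neq0// mul1r -sqn_conj (eqP (_ : sqn (c t) == 1)) ?mul1r//.
  by rewrite sqn_eq1 c_norm.
rewrite -mulr_sumr sum_pairing mulrA mulVf ?pN_neq0// mul1r.
congr (nat_of_bool _)%:R; rewrite [RHS]eq_sym -[RHS]subr_eq0 vE.
apply/eqP/eqP => [->|v0].
  by rewrite /vsum big1// => j _; rewrite ffunE mulr0n.
by apply/ffunP => j; rewrite !ffunE vE v0.
Qed.

End wavelet_atoms.

Lemma eq_lspan_comp (T : Type) (R : realType) (S S' : set (T -> R[i])) (F : T -> T) :
  (forall f, S f -> S' (fun x => f (F x))) ->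
  forall f, lspan S f -> lspan S' (fun x => f (F x)).
Proof.
by move=> SS' _ [n [c [g [Sg ->]]]]; exists n, c, (fun i x => g i (F x)); split=> // i; exact: SS'.
Qed.

(** * The multiresolution analysis *)

Section scaling_MRA.
Context {R : realType} {p : nat} (p_prime : prime p).
Context (mu : {measure set (borel (vilenkin p)) -> \bar R}) (mu_haar : haar_vilenkin mu).
Context (N H : nat) (A : {ffun 'I_N -> 'Z_p} -> nat -> 'Z_p).
Hypothesis A_prefix : forall t (j : 'I_N), A t j = t j.
Hypothesis A_eq0 : forall t j, (H <= j)%N -> A t j = 0.
Hypothesis A_shift : forall t, exists t', forall j, A t' j = A t j.+1.
Hypothesis A_0 : forall j, A 0 j = 0.
Context (c : {ffun 'I_N -> 'Z_p} -> R[i]) (c_norm : forall t, `|c t| = 1).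
Context (phi : vilenkin p -> R[i]) (phi_L2 : L2 mu phi).
Local Notation phi0 := (scaling p_prime H A c).
Hypothesis phi_scaling : {ae mu, forall x, phi x = phi0 x}.
Implicit Types (x y z h : vilenkin p) (t s d : {ffun 'I_N -> 'Z_p}) (n m : int) (f g : vilenkin p -> R[i]).

Definition atoms n : set (vilenkin p -> R[i]) :=
  [set f | exists t h, H_0 h /\ f = fun x => atom p_prime H A t (dil n x - h)].

Local Notation V := (fun n : int => L2closure mu (lspan (dil_shift phi n @` H_0))).
Local Notation W := (fun n : int => L2closure mu (lspan (atoms n))).

Lemma dil_shift_L2 f n h : L2 mu f -> L2 mu (dil_shift f n h).
Proof.
by move=> Lf; apply: (L2_dil p_prime mu_haar n (f := fun x => f (x - h))); exact: L2_shift.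
Qed.

Lemma atoms_L2 n : atoms n `<=` L2 mu.
Proof. by move=> _ [t [h [_ ->]]]; apply: dil_shift_L2; exact: atom_L2. Qed.

Lemma shifts_L2 n : dil_shift phi n @` H_0 `<=` L2 mu.
Proof. by move=> _ [h _ <-]; exact: dil_shift_L2. Qed.

Lemma nsq_phi_scaling n h : nsq mu setT (dil_shift phi n h \- dil_shift phi0 n h) = 0%E.
Proof.
have L0 : L2 mu (phi \- phi0) by apply: L2B => //; exact: scaling_L2.
have n0 : nsq mu setT (phi \- phi0) = 0%E.
  apply: ae0_nsq => //; first exact: L2_cmeas L0.
  by apply: (@filterS _ _ (ae_filter_ringOfSetsType mu) _ _ _ phi_scaling) => x /= ->; rewrite subrr.
pose D x := (phi \- phi0) (x - h).
have -> : dil_shift phi n h \- dil_shift phi0 n h = fun x => D (dil n x) by [].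
rewrite (nsq_dil p_prime mu_haar); last first.
  by apply: cmeas_shift; exact: L2_cmeas L0.
by rewrite nsq_shift ?n0 ?mule0//; exact: L2_cmeas L0.
Qed.

(** For [phi0] each generator of one system is a finite combination of the other. Since [phi] equals
    [phi0] only almost everywhere, its generators are reached as approximations with error 0. *)
Lemma closure_eq n : V n = W n.
Proof.
apply/seteqP; split; apply: closed_span_sub; try exact: atoms_L2; try exact: shifts_L2.
  move=> _ [h Hh <-]; apply: (@closed_span_approx _ _ _ mu (atoms n)).
  - exact: atoms_L2.
  - exact: dil_shift_L2.
  move=> e e0; exists (dil_shift phi0 n h); last by rewrite nsq_phi_scaling lte_fin.
  apply: sub_L2closure; first by apply: lspan_L2; exact: atoms_L2.
  apply: lspanZ; apply: lspan_sum => t; apply: lspanZ; apply: sub_lspan.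
  by exists t, h.
move=> _ [t [h [Hh ->]]].
have -> : (fun x => atom p_prime H A t (dil n x - h)) =
    fun x => (c t)^* * \sum_d pairing t d * dil_shift phi0 n (h + vsum d) x.
  apply/boolp.funext => x; rewrite (atom_scaling p_prime A_prefix A_eq0 c_norm).
  by congr (_ * _); apply: eq_bigr => d _; rewrite /dil_shift opprD addrA.
apply: closed_span_lspan; first exact: shifts_L2.
apply: lspanZ; apply: lspan_sum => d; apply: lspanZ; apply: sub_lspan.
apply: (@closed_span_approx _ _ _ mu (dil_shift phi n @` H_0)).
- exact: shifts_L2.
- by apply: dil_shift_L2; exact: scaling_L2.
move=> e e0; exists (dil_shift phi n (h + vsum d)); last first.
  by rewrite nsqBC nsq_phi_scaling lte_fin.
apply: sub_closed_span; first exact: shifts_L2.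
by exists (h + vsum d) => //; apply: H_0D => //; exact: H_0_vsum.
Qed.

Lemma atoms_succ n : atoms n `<=` lspan (atoms (n + 1)).
Proof.
move=> _ [t [h [Hh ->]]]; have [t' tE] := @atom_shift_eq R p p_prime N H A A_eq0 A_shift t.
have -> : (fun x => atom p_prime H A t (dil n x - h)) = (fun x => \sum_(b : 'Z_p)
    zchar (A t 0 * b) * atom p_prime H A t' (dil (n + 1) x - (dil 1 h + gvec (- N%:Z - 1) *+ b)))
    :> (vilenkin p -> R[i]).
  apply/boolp.funext => x; rewrite tE; apply: eq_bigr => b _; congr (_ * atom _ _ _ _ _).
  by rewrite dilB dil_dil opprD addrA // [1 + n]addrC.
apply: (@lspan_sum _ (borel (vilenkin p)) R) => b; apply: lspanZ; apply: sub_lspan.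
exists t', (dil 1 h + gvec (- N%:Z - 1) *+ b); split=> //.
apply: H_0D; first exact: (H_0_dil 1).
by apply: H_0Mn; apply: H_0_gvec; lia.
Qed.

Lemma W_succ n : W n `<=` W (n + 1).
Proof.
apply: L2closure_sub; first by apply: lspan_L2; exact: atoms_L2.
by apply: lspan_sub; exact: atoms_succ.
Qed.

Lemma W_le m n : m <= n -> W m `<=` W n.
Proof.
move=> mn; have -> : n = m + (absz (n - m)%R)%:Z by lia.
elim: (absz _) => [|k IH]; first by rewrite addr0.
have -> : m + k.+1%:Z = (m + k%:Z) + 1 by lia.
by apply: subset_trans IH _; exact: W_succ.
Qed.

(** [atom 0] is the indicator of [Gsub (- N)]; dilation by [n + N] brings it to level [n], and
    truncation provides a shift in [H_0]. *)
Lemma vball_indic_W n x : W (n + N%:Z) (cindic R (vball n x : set (borel (vilenkin p)))).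
Proof.
apply: sub_closed_span; first exact: atoms_L2.
exists 0, (vtrunc (dil (n + N%:Z) x)); split; first exact: H_0_vtrunc.
apply/boolp.funext => y; rewrite /atom (tail_dual0 p_prime H A_0) mulr1 /cindic.
congr (nat_of_bool _)%:R; apply/idP/idP => /set_mem xy; apply/mem_set.
  move=> k kN; rewrite digitB digit_vtrunc !digit_dil (_ : k < 0); last by lia.
  by apply: xy; lia.
move=> k kn; have := xy (k - (n + N%:Z)); rewrite digitB digit_vtrunc !digit_dil subrK.
by rewrite (_ : (_ < 0) = true); [apply; lia|lia].
Qed.

Lemma bigcup_W_dense : L2closure mu (\bigcup_n W n) = L2 mu.
Proof.
apply/seteqP; split; first exact: L2closure_L2.
apply: subset_trans (vball_dense mu_haar) _.
apply: L2closure_sub; first by move=> f [n _]; exact: L2closure_L2.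
apply: lspan_ind.
- by exists 0 => //; apply: closed_span0; exact: atoms_L2.
- move=> f g [m _ Wf] [n _ Wg]; exists (Order.max m n) => //.
  by apply: closed_spanD; [exact: atoms_L2|apply: W_le Wf|apply: W_le Wg];
    rewrite le_max lexx ?orbT.
- move=> a _ [n [x ->]]; exists (n + N%:Z) => //.
  by apply: closed_spanZ; [exact: atoms_L2|exact: vball_indic_W].
Qed.

Lemma W_loc_const (n : int) f : lspan (atoms n) f -> loc_const (H%:Z - N%:Z + n) f.
Proof.
move: f; apply: (@lspan_ind _ (borel (vilenkin p)) R _ (loc_const _)).
- by [].
- by move=> f g lf lg x y xy /=; rewrite (lf x y)// (lg x y).
- move=> a _ [t [h [_ ->]]] x y xy; congr (_ * _); apply: (atom_loc_const p_prime).
  by move=> k kH; rewrite opprB addrA subrK -dilB digit_dil; apply: xy; lia.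
Qed.

(** [f] is constant on [Gsub L], which contains [Gsub (- k)], so the smaller group carries the
    fraction $p^{k+L}$ of the squared norm over the larger one. *)
Lemma nsq_loc_const_le (L : int) (k : nat) f : L2 mu f -> L <= - k%:Z -> loc_const L f ->
  (nsq mu (Gsub (- k%:Z)) f <= (p%:R ^ (k%:Z + L))%:E * nsq mu setT f)%E.
Proof.
move=> Lf Lk lf; have p0 : 0 < p%:R :> R by rewrite ltr0n prime_gt0.
have -> : nsq mu (Gsub (- k%:Z)) f = ((p%:R ^ (k%:Z + L))%:E * nsq mu (vball L (0 : vilenkin p)%R) f)%E.
  rewrite -vball0 !(nsq_vball mu_haar)//; last exact: loc_const_le lf.
  by rewrite -EFinM opprK mulrCA -expfzDr ?gt_eqF// addrK.
rewrite lee_pmul2l// ?lte_fin ?exprz_gt0//.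
exact: (nsq_subset mu (measurable_vball L _) (L2_cmeas Lf)).
Qed.

Lemma bigcap_W_ae0 f : (forall n, W n f) -> {ae mu, forall x, f x = 0}.
Proof.
move=> Wf; have Lf : L2 mu f by exact: L2closure_L2 (Wf 0).
have mf := L2_cmeas Lf.
have p0 : 0 < p%:R :> R by rewrite ltr0n prime_gt0.
have Gf0 (k : nat) : nsq mu (Gsub (- k%:Z)) f = 0%E.
  have mG : measurable (Gsub (- k%:Z) : set (borel (vilenkin p))) by exact: measurable_Gsub.
  apply/eqP; rewrite eq_le nsq_ge0 andbT; apply/lee_addgt0Pr => e e0; rewrite add0e.
  have [F FE] : exists F : R, nsq mu setT f = F%:E.
    exists (fine (nsq mu setT f)); rewrite fineK// ge0_fin_numE ?nsq_ge0//.
    exact: L2_nsq.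
  have F0 : 0 <= F by rewrite -lee_fin -FE nsq_ge0.
  have F8 : 0 < 8 * (F + 1) by rewrite mulr_gt0// ltr_wpDl.
  have [m mE] : exists m : nat, 8 * (F + 1) < e * m%:R.
    exists (Num.bound (8 * (F + 1) / e)); rewrite [e * _]mulrC -ltr_pdivrMr//; apply: archi_boundP; exact: divr_ge0 (ltW F8) (ltW e0).
  have pm : (m%:R : R) <= p%:R ^+ m by rewrite -natrX ler_nat ltnW// ltn_expl// prime_gt1.
  (* At the level [n] chosen below the span consists of functions constant on balls of level
     [-(N + m + k)]; [q] bounds the fraction of their squared norm over [Gsub (- k)]. *)
  pose q : R := p%:R ^ (- (N + m)%:Z).
  have q0 : 0 < q by rewrite exprz_gt0.
  have p1 : 1 <= p%:R :> R by rewrite ler1n prime_gt0.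
  have qm : q * p%:R ^+ m <= 1.
    rewrite /q -[X in _ * X]/(p%:R ^ (m : int)) -expfzDr ?gt_eqF//.
    by rewrite (_ : _ + _ = - N%:Z); [rewrite -invr_expz invf_le1 ?exprn_gt0// exprn_ege1|lia].
  have q1 : q <= 1.
    by apply: le_trans qm; rewrite ler_peMr ?exprn_ege1// ltW.
  have qF : 8 * (F + 1) * q <= e.
    apply: le_trans (ler_wpM2r (ltW q0) (ltW mE)) _.
    have mq : q * m%:R <= 1 by apply: le_trans (ler_wpM2l (ltW q0) pm) qm.
    by have := ler_wpM2l (ltW e0) mq; nra.
  (* The final bound $2X+2q(2X+2F)$ is at most $6X+4qF$; the constants 12 and 8 make each part at
     most [e / 2]. *)
  have d0 : 0 < e / 12 by rewrite divr_gt0.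
  have [n nE] : exists n : int, n = - (m + k + H)%:Z by exists (- (m + k + H)%:Z).
  have /L2closureP[_ /(_ _ d0)[s Ss fs]] := Wf n.
  have Ls : L2 mu s by exact: (@lspan_L2 _ (borel (vilenkin p)) R mu _ (@atoms_L2 _) _ Ss).
  have ms := L2_cmeas Ls.
  have mfs : cmeas (T := borel (vilenkin p)) (f \- s) by exact: cmeasB.
  have Gs : (nsq mu (Gsub (- k%:Z)) s <= q%:E * nsq mu setT s)%E.
    have Lk : H%:Z - N%:Z + n <= - k%:Z by clear -nE N; lia.
    have := nsq_loc_const_le Ls Lk (W_loc_const Ss).
    have -> : k%:Z + (H%:Z - N%:Z + n) = - (N + m)%:Z by clear -nE N; lia.
    exact.
  have [X XE] : exists X : R, nsq mu setT (f \- s) = X%:E.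
    exists (fine (nsq mu setT (f \- s))); rewrite fineK// ge0_fin_numE ?nsq_ge0//.
    exact: lt_trans fs (ltry _).
  have X0 : 0 <= X by rewrite -lee_fin -XE nsq_ge0.
  have X12 : X < e / 12 by rewrite -lte_fin -XE.
  have sX : (nsq mu setT s <= (2 * X + 2 * F)%:E)%E.
    have sE : s = (s \- f) \+ f by apply/boolp.funext => x; rewrite /= subrK.
    have := nsqD_le mu measurableT (cmeasB ms mf) mf.
    by rewrite -sE nsqBC XE FE -!EFinM -EFinD.
  rewrite (_ : f = (f \- s) \+ s); last by apply/boolp.funext => x; rewrite /= subrK.
  apply: (le_trans (nsqD_le mu mG mfs ms)).
  apply: (@le_trans _ _ (2 * X + 2 * (q * (2 * X + 2 * F)))%:E); last first.
    by rewrite lee_fin; have := ler_wpM2r X0 q1; have := ler_wpM2l F0 q1; nra.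
  rewrite (EFinD (2 * X)) (EFinM 2 X) (EFinM 2); apply: leeD; rewrite lee_pmul2l ?lte_fin//.
    by rewrite -XE; exact: nsq_subset.
  by apply: (le_trans Gs); rewrite (EFinM q) lee_pmul2l// lte_fin.
have : forall k : nat, {ae mu, forall x, Gsub (- k%:Z) x -> f x = 0}.
  by move=> k; apply: nsq_ae0 => //; exact: measurable_Gsub.
move/ae_foralln; apply: (@filterS _ _ (ae_filter_ringOfSetsType mu)) => x fx; have [k kx] := Gsub_ex x; exact: fx kx.
Qed.

(** Dilation maps generators to generators and scales squared norms by $p^{-m}$, which the tolerance
    anticipates. Negative [m] is allowed, and [m = -1] gives the converse in the dilation axiom. *)
Lemma V_dil m n f : V n f -> V (n + m) (fun x => f (dil m x)).
Proof.
move=> /L2closureP[Lf Sf]; apply/L2closureP; split; first exact: L2_dil.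
have p0 : 0 < p%:R :> R by rewrite ltr0n prime_gt0.
have pm : 0 < p%:R ^ m :> R by rewrite exprz_gt0.
move=> e e0; have [g Sg fg] := Sf _ (mulr_gt0 pm e0).
exists (fun x => g (dil m x)).
  apply: eq_lspan_comp Sg => _ [h Hh <-]; exists h => //.
  by apply/boolp.funext => x; rewrite /dil_shift dil_dil.
have mfg : cmeas (T := borel (vilenkin p)) (f \- g).
  by apply: cmeasB; [exact: L2_cmeas Lf|apply: L2_cmeas; exact: (@lspan_L2 _ (borel (vilenkin p)) R mu _ (@shifts_L2 _) _ Sg)].
rewrite (_ : _ \- _ = fun x => (f \- g) (dil m x))// (nsq_dil p_prime mu_haar)//.
have := nsq_ge0 mu setT (f \- g); move: fg; case: (nsq _ _ _) => [r||]//.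
rewrite lte_fin => re _; rewrite -EFinM lte_fin -ltr_pdivlMl ?exprz_gt0//.
by rewrite -invr_expz invrK.
Qed.

Lemma V_shift f h : V 0 f -> H_0 h -> V 0 (fun x => f (x - h)).
Proof.
move=> /L2closureP[Lf Sf] Hh; apply/L2closureP; split; first exact: L2_shift.
move=> e e0; have [g Sg fg] := Sf _ e0.
exists (fun x => g (x - h)).
  apply: (@eq_lspan_comp _ _ _ _ (fun x => x - h)) Sg => _ [h' Hh' <-].
  exists (h' + h); first exact: H_0D.
  by apply/boolp.funext => x; rewrite /dil_shift !dil0 opprD addrA addrAC.
have mfg : cmeas (T := borel (vilenkin p)) (f \- g).
  by apply: cmeasB; [exact: L2_cmeas Lf|apply: L2_cmeas; exact: (@lspan_L2 _ (borel (vilenkin p)) R mu _ (@shifts_L2 _) _ Sg)].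
by rewrite (_ : _ \- _ = fun x => (f \- g) (x - h))// nsq_shift.
Qed.

Lemma phi_orthonormal : orthonormal_system mu H_0 (fun h x => phi (x - h)).
Proof.
split=> [h Hh|h h' Hh Hh']; first exact: L2_shift.
rewrite -(scaling_orthonormal p_prime mu_haar A_prefix A_eq0 c_norm Hh Hh').
have shift_ae h0 : {ae mu, forall x, phi (x - h0) = phi0 (x - h0)}.
  have := nsq_phi_scaling 0 h0 => n0.
  have : {ae mu, forall x, setT x -> (dil_shift phi 0 h0 \- dil_shift phi0 0 h0) x = 0}.
    apply: (nsq_ae0 (D := setT)) n0 => //; apply: cmeasB; apply: L2_cmeas; apply: dil_shift_L2 => //.
    exact: scaling_L2.
  apply: (@filterS _ _ (ae_filter_ringOfSetsType mu)) => x /= /(_ I) /eqP; rewrite /dil_shift dil0 subr_eq0 => /eqP.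
  by [].
have m1 h0 : cmeas (T := borel (vilenkin p)) (fun x => phi (x - h0)).
  by apply: cmeas_shift; exact: L2_cmeas phi_L2.
have m2 h0 : cmeas (T := borel (vilenkin p)) (fun x => phi0 (x - h0)).
  by apply: (L2_cmeas (mu := mu)); apply: (L2_shift mu_haar); exact: scaling_L2.
apply: ae_eq_cintegral.
- by apply: cmeasM => //; exact: cmeas_conj.
- by apply: cmeasM => //; exact: cmeas_conj.
- by apply: (@filterS2 _ _ (ae_filter_ringOfSetsType mu) _ _ _ _ (shift_ae h) (shift_ae h')) => x -> ->.
Qed.

Lemma phi_basis : orthonormal_basis mu H_0 (fun h x => phi (x - h)) (V 0).
Proof.
split; first exact: phi_orthonormal.
congr (L2closure _ (lspan (image _ _))).
by apply/boolp.funext => h; apply/boolp.funext => x; rewrite /dil_shift dil0.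
Qed.

Lemma scaling_MRA : generates_orthogonal_MRA mu phi.
Proof.
split=> //; [exact: phi_orthonormal| |exact: phi_basis].
split.
- by move=> n; apply: closed_span_subspace; exact: shifts_L2.
- by move=> n; rewrite !closure_eq; exact: W_succ.
- split; last by move=> f Vf; apply: bigcap_W_ae0 => n; rewrite -closure_eq.
  by rewrite (eq_bigcupr (fun n _ => closure_eq n)) bigcup_W_dense.
- split; last by move=> f h; exact: V_shift.
  move=> n f; split; first exact: V_dil.
  move=> /(V_dil (-1)); rewrite addrK (_ : (fun _ => _) = f)//.
  by apply/boolp.funext => x; rewrite (dilNK 1).
- by exists phi; split=> //; exact: phi_basis.
Qed.

End scaling_MRA.

(** * Identification of the generated function *)

Section fourier_scaling.
Context {R : realType} {p : nat} (p_prime : prime p).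
Context (mu : {measure set (borel (vilenkin p)) -> \bar R}) (mu_haar : haar_vilenkin mu).
Context (nu : {measure set (borel (vilenkin_dual R p)) -> \bar R}) (nu_haar : haar_dual nu).
Context (N H : nat) (A : {ffun 'I_N -> 'Z_p} -> nat -> 'Z_p).
Hypothesis A_prefix : forall t (j : 'I_N), A t j = t j.
Hypothesis A_eq0 : forall t j, (H <= j)%N -> A t j = 0.
Context (c : {ffun 'I_N -> 'Z_p} -> R[i]).
Context (phi : vilenkin p -> R[i]) (Phi : vilenkin_dual R p -> R[i]).
Hypothesis phi_Phi : is_fourier mu nu phi Phi.
Hypothesis Phi_out : forall chi (s : nat) (a : nat -> 'Z_p), annihilator (s%:Z + 1) chi ->
  (forall k : nat, chi (gvec (k%:Z - N%:Z)) = zchar (a k)) ->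
  (forall t, ~ A t =1 a) -> Phi chi = 0.
Hypothesis Phi_in : forall chi (s : nat) (a : nat -> 'Z_p) t, annihilator (s%:Z + 1) chi ->
  (forall k : nat, chi (gvec (k%:Z - N%:Z)) = zchar (a k)) ->
  A t =1 a -> Phi chi = c t.
Implicit Types (chi psi : vilenkin_dual R p) (f g : vilenkin p -> R[i]).
Local Notation phi0 := (scaling p_prime H A c).

(** At most one term is nonzero, because [A t] begins with [t]. The shape is that of
    [scaling_fourier], which makes the two transforms comparable. *)
Lemma Phi_sum chi (s : nat) (a : nat -> 'Z_p) : annihilator (s%:Z + 1) chi ->
  (forall k : nat, chi (gvec (k%:Z - N%:Z)) = zchar (a k)) ->
  Phi chi = \sum_t c t * (`[< A t =1 a >])%:R.
Proof.
move=> cs ca; have [[t ta]|nt] := pselect (exists t, A t =1 a).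
  rewrite (Phi_in cs ca ta) (bigD1 t)//= asboolT// mulr1 big1 ?addr0// => t' /eqP tt'.
  rewrite asboolF ?mulr0// => ta'; apply: tt'; apply: (A_inj A_prefix) => j.
  by rewrite ta ta'.
rewrite (Phi_out cs ca) => [|t ta]; last by apply: nt; exists t.
by rewrite big1// => t _; rewrite asboolF ?mulr0// => ta; apply: nt; exists t.
Qed.

Lemma trunc_fourierB (n : nat) f g (m : int) chi : L2 mu f -> L2 mu g -> annihilator m chi ->
  trunc_fourier mu n (f \- g) chi = trunc_fourier mu n f chi - trunc_fourier mu n g chi.
Proof.
move=> Lf Lg cm.
have mG : measurable (Gsub (- n%:Z) : set (borel (vilenkin p))) by exact: measurable_Gsub.
have int u : L2 mu u -> cintegrable (T := borel (vilenkin p)) mu (Gsub (- n%:Z))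
    (fun x => u x * (chi x)^*).
  move=> Lu; apply: L2_cintegrable => //; first by rewrite haar_Gsub// ltey.
  apply: (@L2M_norm1 _ (borel (vilenkin p)) _ mu u (fun x => (chi x)^*)) => //.
    apply: cmeas_conj; apply: (@loc_const_cmeas _ _ m).
    exact: annihilator_loc_const.
  by move=> x; rewrite norm_conjC dual_norm.
have [If Ig] := (int f Lf, int g Lg).
have := cintegralZ (-1) mG Ig; have iN := cintegrableZ (-1) mG Ig.
rewrite mulN1r => E; rewrite /trunc_fourier -E -cintegralD//.
by apply: eq_cintegral => x _; rewrite /= mulrBl mulN1r.
Qed.

(** The error whose norm [is_fourier] sends to 0. *)
Let F (n : nat) chi := Phi chi - trunc_fourier mu n phi chi.

Lemma wdual_annihilator (n K : nat) (a : 'I_K -> 'Z_p) :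
  annihilator (K%:Z + 1) (wdual (R := R) p_prime (- n%:Z) a).
Proof. by move=> x Gx; rewrite wdualE wchar_Gsub//; apply: Gsub_le Gx; lia. Qed.

(** The word starts at place [-n], not above [-N], so place [k - N] has index [n - N + k] in it;
    past its end the exponent is 0. *)
Lemma wdual_gvec (n K : nat) (a : 'I_K -> 'Z_p) (k : nat) : (N <= n)%N ->
  wdual (R := R) p_prime (- n%:Z) a (gvec (k%:Z - N%:Z)) =
  zchar (oapp a 0 (insub (n - N + k)%N)).
Proof.
move=> Nn; rewrite wdualE; case: insubP => [j jK jE|jK] /=.
  by rewrite (_ : k%:Z - N%:Z = - n%:Z + j%:Z) ?wchar_gvec_in// jE; lia.
by rewrite zchar0 wchar_gvec_out//; lia.
Qed.

Lemma trunc_fourier_sub_scaling (n K : nat) (a : 'I_K -> 'Z_p) : (N <= n)%N ->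
  trunc_fourier mu n (phi \- phi0) (wdual p_prime (- n%:Z) a) = - F n (wdual p_prime (- n%:Z) a).
Proof.
move=> Nn; have [Lphi _ _] := phi_Phi.
have ca := @wdual_annihilator n K a; have cg k := @wdual_gvec n K a k Nn.
rewrite (trunc_fourierB n Lphi (scaling_L2 p_prime mu_haar H A c) ca).
by rewrite (scaling_fourier p_prime mu_haar A_eq0 c Nn ca cg) -(Phi_sum ca cg) opprB.
Qed.

(** Characters equal on [Gsub (- n)] have the same truncated transform and, as [N <= n], the same
    exponents from place [-N] on, hence the same [Phi]. *)
Lemma truncation_coset (n K : nat) (a : 'I_K -> 'Z_p) psi : (N <= n)%N ->
  dual_coset (- n%:Z) (wdual p_prime (- n%:Z) a) psi -> F n psi = F n (wdual p_prime (- n%:Z) a).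
Proof.
move=> Nn cpsi.
have ca := @wdual_annihilator n K a; have cg k := @wdual_gvec n K a k Nn.
have pa : annihilator (K%:Z + 1) psi.
  by move=> x Gx; rewrite cpsi ?ca//; apply: Gsub_le Gx; lia.
have pg k : psi (gvec (k%:Z - N%:Z)) = zchar (oapp a 0 (insub (n - N + k)%N)).
  by rewrite cpsi ?cg//; apply: Gsub_gvec; lia.
rewrite /F (Phi_sum pa pg) (Phi_sum ca cg); congr (_ - _).
by apply: eq_cintegral => x Gx; rewrite cpsi.
Qed.

Lemma wdual_coset_inj (n K : nat) (a b : {ffun 'I_K -> 'Z_p}) :
  dual_coset (R := R) (- n%:Z) (wdual p_prime (- n%:Z) a) (wdual p_prime (- n%:Z) b) -> a = b.
Proof.
move=> ab; apply/ffunP => j; apply: (zchar_inj p_prime (R := R)).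
have := ab (gvec (- n%:Z + j%:Z)); rewrite !wdualE !wchar_gvec_in => -> //.
by apply: Gsub_gvec; lia.
Qed.

(** At the characters [wdual (- n) a] the truncated transform of the difference is minus the error
    [F n]. The Bessel bound converts the limit in [is_fourier] into the hypothesis of [fourier_inj],
    uniformly in [K]. *)
Lemma ae_eq_scaling : {ae mu, forall x, phi x = phi0 x}.
Proof.
have [Lphi _ Flim] := phi_Phi.
have Lg : L2 mu (phi \- phi0) by apply: L2B => //; exact: scaling_L2.
suff : {ae mu, forall x, (phi \- phi0) x = 0}.
  by apply: (@filterS _ _ (ae_filter_ringOfSetsType mu)) => x /= /eqP; rewrite subr_eq0 => /eqP.
apply: (fourier_inj (p_prime := p_prime) mu_haar) => // e e0.
have se0 : 0 < Num.sqrt e by rewrite sqrtr_gt0.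
have [n0 n0P] := cvge0_lt Flim se0; exists (maxn n0 N) => n K; rewrite geq_max => /andP[n0n Nn].
rewrite -lte_fin; have := n0P n n0n; rewrite L2norm_lt// sqr_sqrtr ?ltW//; apply: le_lt_trans.
under eq_bigr do rewrite trunc_fourier_sub_scaling// sqnN.
apply: (dual_coset_bessel nu_haar).
  by move=> a b; exact: wdual_coset_inj.
by move=> a psi; exact: truncation_coset.
Qed.

End fourier_scaling.

Theorem theorem4p2 (R : realType) (p : nat) (p_ge3 : (3 <= p)%N)
  (p_prime : prime p) (N : nat) (N_gt0 : (0 < N)%N)
  (mu : {measure set (borel (vilenkin p)) -> \bar R})
  (nu : {measure set (borel (vilenkin_dual R p)) -> \bar R})
  (mu_haar : haar_vilenkin mu) (nu_haar : haar_dual nu)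
  (T : tree p) (T_valid : N_valid T N) (H : nat) (T_height : is_height T H)
  (phi : vilenkin p -> R[i]) (phi_gen : generated_by_tree p_prime T N mu nu phi) :
  generates_orthogonal_MRA mu phi.
Proof.
have [m0 [Phi [m0_mask m0_Phi phi_Phi]]] := phi_gen.
have [A [A_prefix A_eq0 A_good A_uniq]] := tree_extension N_gt0 T_valid T_height.
(* Dropping the first term leaves all windows good, so by uniqueness the rest is the continuation of
   its own first [N] terms. *)
have A_shift t : exists t', forall j, A t' j = A t j.+1.
  exists [ffun j : 'I_N => A t j.+1] => j.
  rewrite -(A_uniq (fun k => A t k.+1))// => i.
  exact: (A_good t i.+1).
have A_0 j : A 0 j = 0.
  have := A_uniq (fun=> 0) _ j; rewrite (_ : [ffun _ => _] = 0); last by apply/ffunP => k; rewrite !ffunE.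
  by move=> <- // i; exact: good_window0.
pose c t := Phi (tail_dual (R := R) p_prime H A t).
have c_norm t : `|c t| = 1.
  have ct (k : nat) : tail_dual (R := R) p_prime H A t (gvec (k%:Z - N%:Z)) = zchar (A t k).
    exact: tail_dual_gvec.
  exact: (Phi_norm1 N_gt0 m0_mask m0_Phi (tail_dual_annihilator p_prime A t) ct (A_good t)).
have [phi_L2 _ _] := phi_Phi.
have Phi_out chi (s : nat) (a : nat -> 'Z_p) : annihilator (s%:Z + 1) chi ->
    (forall k : nat, chi (gvec (k%:Z - N%:Z)) = zchar (a k)) ->
    (forall t, ~ A t =1 a) -> Phi chi = 0.
  (* A nonzero [Phi chi] forces every window of its exponents to be good, and uniqueness identifies
     them with the continuation of their first [N] terms. *)
  move=> cs ca nt; apply: contrapT => Phi0; apply: (nt [ffun j : 'I_N => a j]) => k.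
  rewrite -A_uniq// => i; apply: contrapT => bad; apply: Phi0.
  exact: (Phi_eq0 N_gt0 m0_mask m0_Phi cs ca bad).
have Phi_in chi (s : nat) (a : nat -> 'Z_p) t : annihilator (s%:Z + 1) chi ->
    (forall k : nat, chi (gvec (k%:Z - N%:Z)) = zchar (a k)) ->
    A t =1 a -> Phi chi = c t.
  move=> cs ca ta.
  have ct (k : nat) : tail_dual (R := R) p_prime H A t (gvec (k%:Z - N%:Z)) = zchar (a k).
    by rewrite -ta; exact: tail_dual_gvec.
  exact: (Phi_eq N_gt0 m0_mask m0_Phi cs (tail_dual_annihilator p_prime A t) ca ct).
have phi_scaling := ae_eq_scaling p_prime mu_haar nu_haar A_prefix A_eq0 phi_Phi Phi_out Phi_in.
exact: (scaling_MRA mu_haar A_prefix A_eq0 A_shift A_0 c_norm phi_L2 phi_scaling).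
Qed.
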